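(* With the data of the context (geometric data $E^{\mathcal B},E^{\mathcal F},\nabla^{\mathcal B},\nabla^{\mathcal F}$, canonical weighted spinor bundle $\mathcal S$ with connection $\nabla^{\mathcal S}$, and the action $\Phi_U$ of tensor fields on $\Gamma_U(\mathcal S)$ by iterating $\mathbb A=\nabla^{\mathcal S}+\kappa$), for any open subset $U\subset M$ and any tensor fields $\mathcal X\in\Gamma_U(T(E^{\mathcal B,\mathcal F}))$, $\mathcal Y\in\Pi_U(T(E^{\mathcal B,\mathcal F}))$, we have $$\Phi_U(\mathcal X\otimes\mathcal Y)=\Phi_U(\mathcal X)\,\Phi_U(\mathcal Y).$$ In particular, $\Phi_U$ defines a module structure on $\Gamma_U(\mathcal S)$ for the associative algebra $\Pi_U(T(E^{\mathcal B,\mathcal F}))$ of parallel tensor fields.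
   Context: **Courant algebroids.** A Courant algebroid on $M$ is a real vector bundle $E\to M$ with a nondegenerate symmetric bilinear form $h$, a bilinear operation $\circ$ on $\Gamma(E)$ and an anchor $\rho:E\to TM$ with, for $e_i\in\Gamma(E)$, $f\in C^\infty(M)$: $e_1\circ(e_2\circ e_3)=(e_1\circ e_2)\circ e_3+e_2\circ(e_1\circ e_3)$; $\rho(e_1\circ e_2)=[\rho(e_1),\rho(e_2)]$; $e_1\circ(fe_2)=(\rho(e_1)f)e_2+f(e_1\circ e_2)$; $\rho(e_1)h(e_2,e_3)=h(e_1\circ e_2,e_3)+h(e_2,e_1\circ e_3)$; $e_1\circ e_2+e_2\circ e_1=Dh(e_1,e_2)$, where $h(Df,e)=\rho(e)f$. It is transitive if $\rho$ is surjective. An $E$-connection on a bundle $F$ is an operation $\nabla_es$ with $\nabla_{fe}s=f\nabla_es$, $\nabla_e(fs)=(\rho(e)f)s+f\nabla_es$. A generalized metric is a bundle isomorphism $\mathcal G:E\to E$ with $\mathcal G^2=\mathrm{id}$, $h(\mathcal Gu,v)=h(u,\mathcal Gv)$ and $G(u,v)=h(\mathcal Gu,v)$ positive definite. A generalized Levi-Civita connection for $\mathcal G$ is an $E$-connection on $E$ preserving $h$ and $\mathcal G$ with vanishing torsion $T(e_1,e_2)=\nabla_{e_1}e_2-\nabla_{e_2}e_1-e_1\circ e_2+(\nabla e_1)^*e_2$ ($(\nabla e_1)^*$ the $h$-adjoint of $e\mapsto\nabla_ee_1$). **Geometric data.** $M$ is a smooth manifold; $E^{\mathcal B}$ a transitive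 Courant algebroid on $M$ with generalized metric $\mathcal G^{\mathcal B}$; $E^{\mathcal F}$ a copy with a Courant algebroid isomorphism $\iota:E^{\mathcal B}\to E^{\mathcal F}$ and generalized metric $\iota\mathcal G^{\mathcal B}\iota^{-1}$; $\nabla^{\mathcal B}$ a chosen generalized Levi-Civita connection for $\mathcal G^{\mathcal B}$; $\nabla^{\mathcal F}$ the $E^{\mathcal B}$-connection on $E^{\mathcal F}$ with $\nabla^{\mathcal F}_X(\iota Y)=\iota(\nabla^{\mathcal B}_XY)$. Everything is complexified, keeping notation. $E^{\mathcal B,\mathcal F}=E^{\mathcal B}\oplus E^{\mathcal F}$; $\nabla^T$ is the $E^{\mathcal B}$-connection on the tensor algebra bundle $T(E^{\mathcal B,\mathcal F})$ induced from $\nabla^{\mathcal B}\oplus\nabla^{\mathcal F}$ by the Leibniz rule; $\Pi_U$ denotes sections over $U$ parallel for $\nabla^T$ in all directions, an associative algebra under $\otimes$. **Spinors.** The real bundle $E_{\mathbb R}$ underlying $E^{\mathcal F}$ has even rank and carries a fixed real vector bundle $S_{0,\mathbb R}$ of modules over its Clifford algebra, with Clifford action $c$, $c(e)^2=h(e,e)$, absolutely irreducible: $\operatorname{End}_{\mathcal C\ell(E_{\mathbb R})}(S_{0,\mathbb R})=\mathbb R\,\mathrm{id}$ and $\mathcal C\ell(E_{\mathbb R},h)\cong\operatorname{End}_{\mathbb R}(S_{0,\mathbb R})$. For a vector bundle $V$ of rank $r$, $|\det V^*|^s$ is the real line bundle of $s$-densities (functions $\omega:\Lambda^rV_p\setminus\{0\}\to\mathbb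 R$ with $\omega(\lambda\mathbf v)=|\lambda|^s\omega(\mathbf v)$). With $\mathrm{rk}=\operatorname{rank}S_{0,\mathbb R}$, $S_{\mathbb R}=S_{0,\mathbb R}\otimes|\det S_{0,\mathbb R}^*|^{1/\mathrm{rk}}$. Given the real generalized connection $\nabla$ on $E_{\mathbb R}$ (transported from $\nabla^{\mathcal B}$ by $\iota$), any Clifford-compatible $E_{\mathbb R}$-connection on $S_{0,\mathbb R}$ (i.e. $\nabla_{e_1}(c(e_2)s)=c(\nabla_{e_1}e_2)s+c(e_2)\nabla_{e_1}s$) induces the same connection $\nabla^{S_{\mathbb R}}$ on $S_{\mathbb R}$, where on densities $\nabla_e|\omega|^{1/\mathrm{rk}}=\frac1{\mathrm{rk}}\alpha(e)|\omega|^{1/\mathrm{rk}}$ if $\nabla_e\omega=\alpha(e)\omega$ on $\det S_{0,\mathbb R}^*$. $S=S_{\mathbb R}\otimes\mathbb C$ with complexified connection $\nabla^S$, and a fixed global involution $J$ with $J^2=\mathrm{id}$, $Jc(e)=-c(e)J$. $L=|\det T^*M|^{1/2}$ has the $E$-connection $\nabla^L_v\mu=\mathcal L_{\rho(v)}\mu-\frac12\operatorname{div}^\nabla(v)\mu$, $\operatorname{div}^\nabla(v)=\operatorname{tr}(\nabla v)$. The canonical weighted spinor bundle is $\mathcal S=S\otimes L$ with connection $\nabla^{\mathcal S}=\nabla^S\otimes\mathrm{id}+\mathrm{id}\otimes\nabla^L$ and grading $J\otimes\mathrm{id}$; via $\iota$ on directions it is an $E^{\mathcal B}$-connection with $\nabla^{\mathcal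 S}_{e_1}(c(e_2)s)=c(\nabla^{\mathcal F}_{e_1}e_2)s+c(e_2)\nabla^{\mathcal S}_{e_1}s$ for $e_1\in\Gamma(E^{\mathcal B})$, $e_2\in\Gamma(E^{\mathcal F})$. **Action $\Phi_U$.** Let $\pi_{\mathcal B},\pi_{\mathcal F}$ be the projections of $E^{\mathcal B,\mathcal F}$; its anchor is $\rho\circ\pi_{\mathcal B}$, and $\nabla^{\mathcal B,\mathcal F}_Z:=\nabla^T_{\pi_{\mathcal B}Z}$. With $(\kappa s)(Y)=c(Y)s$, $\mathbb A=\nabla^{\mathcal S}+\kappa$, i.e. $\mathbb A_Zs=\nabla^{\mathcal S}_{\pi_{\mathcal B}Z}s+c(\pi_{\mathcal F}Z)s$. Define $\mathbb A^0s=s$ and $\mathbb A^{k}s\in\Gamma_U((E^{\mathcal B,\mathcal F,*})^{\otimes k}\otimes\mathcal S)$ recursively by $$(\mathbb A^{k+1}s)(X_0,\dots,X_k)=\mathbb A_{X_0}\big((\mathbb A^ks)(X_1,\dots,X_k)\big)-\sum_{j=1}^k(\mathbb A^ks)(X_1,\dots,\nabla^{\mathcal B,\mathcal F}_{X_0}X_j,\dots,X_k).$$ For $\tau\in\Gamma_U((E^{\mathcal B,\mathcal F})^{\otimes k})$, $\Phi_U(\tau)s$ is the full ordered contraction of $\mathbb A^ks$ with $\tau$: $\Phi_U(X_1\otimes\cdots\otimes X_k)s=(\mathbb A^ks)(X_1,\dots,X_k)$, extended $C^\infty$-linearly; $\Phi_U(f)s=fs$ in degree $0$; extended additively to $\Gamma_U(T(E^{\mathcal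 B,\mathcal F}))$ (sections with locally finite tensor degree). *)

(* Defs.v *)
From HB Require Import structures.
From mathcomp Require Import all_boot all_order all_algebra.
From mathcomp Require Import complex.
From mathcomp Require Import all_classical all_reals all_analysis.

Set Implicit Arguments.
Unset Strict Implicit.
Unset Printing Implicit Defensive.

Import Order.TTheory GRing.Theory Num.Theory numFieldNormedType.Exports.

Local Open Scope classical_set_scope.
Local Open Scope ring_scope.

(* (u, v) : cplx V stands for u + i v. *)
Definition cplx (V : Type) : Type := (V * V)%type.

HB.instance Definition _ (V : zmodType) :=
  GRing.Zmodule.copy (cplx V) (V * V)%type.

Section CplxLmod.
Variables (R : rcfType) (V : lmodType R).

Definition cplx_scale (a : complex R) (z : cplx V) : cplx V :=
  (complex.Re a *: z.1 - complex.Im a *: z.2,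
   complex.Re a *: z.2 + complex.Im a *: z.1).

Lemma cplx_scaleA a b z : cplx_scale a (cplx_scale b z) = cplx_scale (a * b) z.
Proof.
case: a b z => [a1 a2] [b1 b2] [u v]; rewrite /cplx_scale /=.
rewrite !scalerBr !scalerDr !scalerA !scalerBl !scalerDl !opprD.
by congr pair; rewrite [X in _ + X = _]addrC addrACA.
Qed.

Lemma cplx_scale1 : left_id 1 cplx_scale.
Proof.
by move=> [u v]; rewrite /cplx_scale /= !scale1r !scale0r subr0 addr0.
Qed.

Lemma cplx_scaleDr : right_distributive cplx_scale +%R.
Proof.
move=> a [u v] [u' v']; rewrite /cplx_scale /=.
by congr pair; rewrite !scalerDr ?opprD addrACA.
Qed.

Lemma cplx_scaleDl z : {morph cplx_scale^~ z : a b / a + b}.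
Proof.
case: z => [u v] [a1 a2] [b1 b2]; rewrite /cplx_scale /=.
by congr pair; rewrite !scalerDl ?opprD addrACA.
Qed.

HB.instance Definition _ := GRing.Zmodule_isLmodule.Build (complex R) (cplx V)
  cplx_scaleA cplx_scale1 cplx_scaleDr cplx_scaleDl.
End CplxLmod.

Section CplxVect.
Import VectorInternalTheory.
Variables (R : rcfType) (V : vectType R).

Lemma cplx_vector_axiom : Vector.axiom (dim V) (cplx V).
Proof.
pose f (z : cplx V) : 'rV[complex R]_(dim V) :=
  \row_i (v2r z.1 0 i
           +i* v2r z.2 0 i)%C.
pose g (w : 'rV[complex R]_(dim V)) : cplx V :=
  (r2v (\row_i complex.Re (w 0 i)),
   r2v (\row_i complex.Im (w 0 i))).
exists f.
  move=> [a1 a2] [u v] [u' v']; apply/rowP => i; rewrite !mxE.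
  rewrite [LHS](_ : _ = (v2r (a1 *: u - a2 *: v + u') 0 i
                         +i* v2r (a1 *: v + a2 *: u + v') 0 i)%C) //.
  by rewrite !(linearD, linearN, linearZ) !mxE mulrN.
exists g.
- move=> [u v]; rewrite /f /g /=; congr pair; apply: (can_inj v2rK).
  + by rewrite r2vK; apply/rowP => i; rewrite !mxE.
  + by rewrite r2vK; apply/rowP => i; rewrite !mxE.
- move=> w; apply/rowP => i; rewrite !mxE !r2vK !mxE.
  by case: (w 0 i).
Qed.

HB.instance Definition _ :=
  Lmodule_hasFinDim.Build (complex R) (cplx V) cplx_vector_axiom.
End CplxVect.


(* [Ck k W f], for W open: f is differentiable on W, and so are all its
   iterated partial derivatives of order < k; all those of order <= k are
   continuous on W.  [smooth_on W f] is f being C^oo on W. *)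
Fixpoint Ck (R : realType) (n k : nat) (W : set 'rV[R]_n)
    (f : 'rV[R]_n -> R^o) : Prop :=
  match k with
  | 0 => forall v, W v -> {for v, continuous f}
  | k'.+1 => (forall v, W v -> differentiable f v) /\
      forall j : 'I_n, Ck k' W (fun v => 'D_(delta_mx 0 j) f v)
  end.

Definition smooth_on (R : realType) (n : nat) (W : set 'rV[R]_n)
    (f : 'rV[R]_n -> R^o) : Prop := forall k, Ck k W f.

(* An n-dimensional smooth manifold, given by an atlas.  The charts are indexed
   by the points of the manifold, [chart x] being a chart around x; every atlas
   contains such a subatlas, which generates the same smooth structure.
   [chart x] and its inverse [chinv x] are total functions, meaningful only on
   [cdom x] and on its image. *)
Record manifold (R : realType) (n : nat) := Manifold {
  mpoint :> topologicalType;
  m_hausdorff : hausdorff_space mpoint;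
  m_second_countable : @second_countable mpoint;
  cdom : mpoint -> set mpoint;
  chart : mpoint -> mpoint -> 'rV[R]_n;
  chinv : mpoint -> 'rV[R]_n -> mpoint;
  cdom_open : forall x, open (cdom x);
  cdom_center : forall x, cdom x x;
  chart_im_open : forall x, open (chart x @` cdom x);
  chartK : forall x p, cdom x p -> chinv x (chart x p) = p;
  chart_cont : forall x p, cdom x p -> {for p, continuous (chart x)};
  chinv_cont : forall x p, cdom x p -> {for chart x p, continuous (chinv x)};
  transition_smooth : forall x y (i : 'I_n),
    smooth_on (chart x @` (cdom x `&` cdom y))
              (fun v => chart y (chinv x v) 0 i) }.

Section Functions.
Variables (R : realType) (n : nat) (M : manifold R n).

Definition rsmooth (U : set M) (f : M -> R) : Prop :=
  forall x : M, smooth_on (chart x @` (cdom x `&` U)) (f \o chinv x).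

Definition csmooth (U : set M) (f : M -> complex R) : Prop :=
  rsmooth U (fun p => complex.Re (f p)) /\ rsmooth U (fun p => complex.Im (f p)).

End Functions.

Section Bundles.
Variables (R : realType) (n : nat) (M : manifold R n).

(* A family of vector spaces with its smooth local sections.  Sections are
   total functions, so [bsm U s] only concerns the restriction of s to U. *)
Record bundle (K : nzRingType) := Bundle {
  bfib : M -> lmodType K;
  bsm : set M -> (forall p, bfib p) -> Prop }.

Arguments bsm {K} b U s.

Definition sect (K : nzRingType) (F : bundle K) := forall p, bfib F p.

(* A family of vector spaces with local frames; as for charts, the frames are
   indexed by points, [frame x] being a frame on the neighbourhood [fdom x]
   of x. *)
Record framed (r : nat) := Framed {
  ffib :> M -> vectType R;
  fdom : M -> set M;
  frame : M -> forall q, r.-tuple (ffib q) }.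

Definition fcoord (r : nat) (E : framed r) (x q : M) (i : 'I_r) (v : E q) : R :=
  coord (frame E x q) i v.

Definition bundle_of (r : nat) (E : framed r) : bundle R := Bundle (bfib := fun p => E p : lmodType R)
  (fun U s => forall (x : M) (i : 'I_r),
     rsmooth (U `&` fdom E x) (fun q => fcoord x i (s q))).
Coercion bundle_of : framed >-> bundle.

Record vbundle (r : nat) := VBundle {
  vframed :> framed r;
  fdom_open : forall x, open (fdom vframed x);
  fdom_center : forall x, fdom vframed x x;
  frame_basis : forall x q, fdom vframed x q ->
    basis_of fullv (frame vframed x q);
  frame_smooth : forall x y (i j : 'I_r),
    rsmooth (fdom vframed x `&` fdom vframed y)
      (fun q => fcoord y j (tnth (frame vframed x q) i)) }.

(* The local section extending v : E p with constant coefficients in the frame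
   around p. *)
Definition ext (r : nat) (E : framed r) (p : M) (v : E p) : sect E :=
  fun q => \sum_(i < r) fcoord p i v *: tnth (frame E p q) i.

(* A tangent vector at q is represented by its coordinates
   in the chart around q; v acts on functions by [tder]. *)
Definition tder (q : M) (v : 'rV[R]_n) (f : M -> R) : R :=
  'D_v (f \o chinv q : 'rV[R]_n -> R^o) (chart q q).

(* The frame around x consists of the coordinate fields of the chart around x. *)
Definition tangent : framed n := Framed (ffib := fun _ => 'rV[R]_n : vectType R)
  (@cdom R n M)
  (fun x q => [tuple \row_(k < n)
     ('D_(delta_mx 0 j) (fun u => chart q (chinv x u) 0 k : R^o) (chart x q))
     | j < n]).

Definition vfder (X : sect tangent) (f : M -> R) : M -> R :=
  fun q => tder q (X q) f.

Definition lie_bracket (X Y : sect tangent) : sect tangent :=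
  fun q => \row_(k < n)
    (vfder X (vfder Y (fun p => chart q p 0 k)) q
     - vfder Y (vfder X (fun p => chart q p 0 k)) q).

Definition trivial_bundle : bundle R :=
  Bundle (bfib := fun _ => R^o : lmodType R) (@rsmooth R n M).

Definition cplxb (F : bundle R) : bundle (complex R) :=
  Bundle (bfib := fun p => cplx (bfib F p) : lmodType (complex R))
  (fun U s => bsm F U (fun p => (s p).1) /\ bsm F U (fun p => (s p).2)).

Definition sumb (K : nzRingType) (F G : bundle K) : bundle K :=
  Bundle (bfib := fun p => (bfib F p * bfib G p)%type : lmodType K)
  (fun U s => bsm F U (fun p => (s p).1) /\ bsm G U (fun p => (s p).2)).

End Bundles.

Arguments bsm {R n M K} b U s.
Arguments sect {R n M K} F.
Arguments ext {R n M r} E p v.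
Arguments fcoord {R n M r} E x q i v.
Arguments tangent {R n} M.
Arguments trivial_bundle {R n} M.

Section Connections.
Variables (R : realType) (n : nat) (M : manifold R n).

(* A connection on F along a bundle A whose sections act as derivations on
   functions through [act].  As a local operator it is defined on sections over
   every open U, compatibly with restrictions; here it is a total operation on
   total functions, specified on those that are smooth on U, and [conn_local]
   says that the value on U only depends on the restrictions to U. *)
Record is_connection (K : nzRingType) (ksm : set M -> (M -> K) -> Prop)
    (A F : bundle M K) (act : sect A -> (M -> K) -> M -> K)
    (D : sect A -> sect F -> sect F) : Prop := IsConnection {
  conn_smooth : forall U e s, open U -> bsm A U e -> bsm F U s ->
    bsm F U (D e s);
  conn_local : forall U e e' s s', open U ->
    bsm A U e -> bsm A U e' -> bsm F U s -> bsm F U s' ->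
    (forall p, U p -> e p = e' p) -> (forall p, U p -> s p = s' p) ->
    forall p, U p -> D e s p = D e' s' p;
  conn_addl : forall U e e' s, open U ->
    bsm A U e -> bsm A U e' -> bsm F U s ->
    forall p, U p -> D (fun q => e q + e' q) s p = D e s p + D e' s p;
  conn_addr : forall U e s s', open U ->
    bsm A U e -> bsm F U s -> bsm F U s' ->
    forall p, U p -> D e (fun q => s q + s' q) p = D e s p + D e s' p;
  conn_scalel : forall U f e s, open U ->
    ksm U f -> bsm A U e -> bsm F U s ->
    forall p, U p -> D (fun q => f q *: e q) s p = f p *: D e s p;
  conn_leibniz : forall U f e s, open U ->
    ksm U f -> bsm A U e -> bsm F U s ->
    forall p, U p ->
      D e (fun q => f q *: s q) p = act e f p *: s p + f p *: D e s p }.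

Definition cplx_act (A : bundle M R) (act : sect A -> (M -> R) -> M -> R)
    (e : sect (cplxb A)) (f : M -> complex R) : M -> complex R := fun p =>
  let er q := (e q).1 in let ei q := (e q).2 in
  let u q := complex.Re (f q) in let v q := complex.Im (f q) in
  ((act er u p - act ei v p) +i* (act er v p + act ei u p))%C.

Definition cplx_conn (A F : bundle M R) (D : sect A -> sect F -> sect F)
    (e : sect (cplxb A)) (s : sect (cplxb F)) : sect (cplxb F) := fun p =>
  let er q := (e q).1 in let ei q := (e q).2 in
  let u q := (s q).1 in let v q := (s q).2 in
  (D er u p - D ei v p, D er v p + D ei u p).

End Connections.

Section Courant.
Variables (R : realType) (n : nat) (M : manifold R n) (m : nat).

(* The vector w with h(w, u) = phi(u) for all u. *)
Definition sharp (V : vectType R) (h : 'Hom(V, 'Hom(V, R^o))) (phi : V -> R) :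
  V := xget 0 [set w | forall u, h w u = phi u].

(* The operation [dorf] on sections is
   encoded as connections are, see [is_connection]. *)
Record courant (E : vbundle M m) := Courant {
  pairing : forall p, 'Hom(E p, 'Hom(E p, R^o));
  anchor : forall p, 'Hom(E p, tangent M p);
  dorf : sect E -> sect E -> sect E;
  ader := fun (e : sect E) (f : M -> R) =>
    (vfder (fun q => anchor q (e q)) f : M -> R);
  (* D f, defined by h(D f, e) = rho(e) f *)
  cdiff := fun (f : M -> R) =>
    ((fun p => sharp (pairing p) (fun u => tder p (anchor p u) f)) : sect E);
  pairing_sym : forall p u v, pairing p u v = pairing p v u;
  pairing_nondeg : forall p u, (forall v, pairing p u v = 0) -> u = 0;
  pairing_smooth : forall U (u v : sect E), open U -> bsm E U u -> bsm E U v ->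
    rsmooth U (fun p => pairing p (u p) (v p));
  anchor_smooth : forall U (e : sect E), open U -> bsm E U e ->
    bsm (tangent M) U (fun p => anchor p (e p));
  dorf_smooth : forall U e1 e2, open U -> bsm E U e1 -> bsm E U e2 ->
    bsm E U (dorf e1 e2);
  dorf_local : forall U e1 e1' e2 e2', open U ->
    bsm E U e1 -> bsm E U e1' -> bsm E U e2 -> bsm E U e2' ->
    (forall p, U p -> e1 p = e1' p) -> (forall p, U p -> e2 p = e2' p) ->
    forall p, U p -> dorf e1 e2 p = dorf e1' e2' p;
  dorf_linearl : forall U (a : R) e1 e1' e2, open U ->
    bsm E U e1 -> bsm E U e1' -> bsm E U e2 ->
    forall p, U p ->
      dorf (fun q => a *: e1 q + e1' q) e2 p = a *: dorf e1 e2 p + dorf e1' e2 p;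
  dorf_linearr : forall U (a : R) e1 e2 e2', open U ->
    bsm E U e1 -> bsm E U e2 -> bsm E U e2' ->
    forall p, U p ->
      dorf e1 (fun q => a *: e2 q + e2' q) p = a *: dorf e1 e2 p + dorf e1 e2' p;
  dorf_jacobi : forall U e1 e2 e3, open U ->
    bsm E U e1 -> bsm E U e2 -> bsm E U e3 ->
    forall p, U p ->
      dorf e1 (dorf e2 e3) p = dorf (dorf e1 e2) e3 p + dorf e2 (dorf e1 e3) p;
  anchor_dorf : forall U e1 e2, open U -> bsm E U e1 -> bsm E U e2 ->
    forall p, U p -> anchor p (dorf e1 e2 p) =
      lie_bracket (fun q => anchor q (e1 q)) (fun q => anchor q (e2 q)) p;
  dorf_leibniz : forall U f e1 e2, open U ->
    rsmooth U f -> bsm E U e1 -> bsm E U e2 ->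
    forall p, U p -> dorf e1 (fun q => f q *: e2 q) p =
      ader e1 f p *: e2 p + f p *: dorf e1 e2 p;
  dorf_pairing : forall U e1 e2 e3, open U ->
    bsm E U e1 -> bsm E U e2 -> bsm E U e3 ->
    forall p, U p -> ader e1 (fun q => pairing q (e2 q) (e3 q)) p =
      pairing p (dorf e1 e2 p) (e3 p) + pairing p (e2 p) (dorf e1 e3 p);
  dorf_sym : forall U e1 e2, open U -> bsm E U e1 -> bsm E U e2 ->
    forall p, U p -> dorf e1 e2 p + dorf e2 e1 p =
      cdiff (fun q => pairing q (e1 q) (e2 q)) p }.

Section Structures.
Variables (E : vbundle M m) (C : courant E).

Definition transitive_courant : Prop := forall p, limg (anchor C p) = fullv.

Definition is_rconnection (F : bundle M R) (D : sect E -> sect F -> sect F) :=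
  is_connection (@rsmooth R n M) (ader C) D.

Definition is_cconnection (F : bundle M (complex R))
    (D : sect (cplxb E) -> sect F -> sect F) :=
  is_connection (@csmooth R n M) (cplx_act (ader C)) D.

Record is_gmetric (G : forall p, 'End(E p)) : Prop := IsGMetric {
  gmetric_smooth : forall U (u : sect E), open U -> bsm E U u ->
    bsm E U (fun p => G p (u p));
  gmetric_invol : forall p u, G p (G p u) = u;
  gmetric_sym : forall p u v,
    pairing C p (G p u) v = pairing C p u (G p v);
  gmetric_pos : forall p u, u != 0 -> 0 < (pairing C p (G p u) u : R) }.

(* ((nabla e1)^* e2)(p), for the h-adjoint of u |-> nabla_u e1 *)
Definition adj_cov (D : sect E -> sect E -> sect E) (e1 e2 : sect E) : sect E :=
  fun p => sharp (pairing C p) (fun u => pairing C p (e2 p) (D (ext E p u) e1 p)).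

Definition torsion (D : sect E -> sect E -> sect E) (e1 e2 : sect E) : sect E :=
  fun p => D e1 e2 p - D e2 e1 p - dorf C e1 e2 p + adj_cov D e1 e2 p.

(* the trace of u |-> nabla_u v *)
Definition divergence (D : sect E -> sect E -> sect E) (v : sect E) : M -> R :=
  fun p => \sum_(i < m) fcoord E p p i (D (fun q => tnth (frame E p q) i) v p).

Record is_levi_civita (G : forall p, 'End(E p))
    (D : sect E -> sect E -> sect E) : Prop := IsLeviCivita {
  lc_connection : is_rconnection D;
  lc_pairing : forall U e u v, open U ->
    bsm E U e -> bsm E U u -> bsm E U v ->
    forall p, U p -> ader C e (fun q => pairing C q (u q) (v q)) p =
      pairing C p (D e u p) (v p) + pairing C p (u p) (D e v p);
  lc_gmetric : forall U e u, open U -> bsm E U e -> bsm E U u ->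
    forall p, U p -> D e (fun q => G q (u q)) p = G p (D e u p);
  lc_torsion : forall U e1 e2, open U -> bsm E U e1 -> bsm E U e2 ->
    forall p, U p -> torsion D e1 e2 p = 0 }.

End Structures.

Record is_courant_iso (E E' : vbundle M m) (C : courant E) (C' : courant E')
    (iota : forall p, 'Hom(E p, E' p)) : Prop := IsCourantIso {
  iso_ker : forall p, lker (iota p) = 0%VS;
  iso_img : forall p, limg (iota p) = fullv;
  iso_smooth : forall U (e : sect E), open U -> bsm E U e ->
    bsm E' U (fun p => iota p (e p));
  iso_inv_smooth : forall U (e : sect E'), open U -> bsm E' U e ->
    bsm E U (fun p => (iota p)^-1%VF (e p));
  iso_pairing : forall p u v,
    pairing C' p (iota p u) (iota p v) = pairing C p u v;
  iso_anchor : forall p u, anchor C' p (iota p u) = anchor C p u;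
  iso_dorf : forall U e1 e2, open U -> bsm E U e1 -> bsm E U e2 ->
    forall p, U p -> iota p (dorf C e1 e2 p) =
      dorf C' (fun q => iota q (e1 q)) (fun q => iota q (e2 q)) p }.

End Courant.

(* [weighted V j chi W], for V of dimension r: the W-valued functions on
   r-tuples in V that are multiplied by chi(det A) under the action of
   r x r matrices A.  Such a function omega factors through the map
   (v_1, ..., v_r) |-> v_1 /\ ... /\ v_r onto Lambda^r V and satisfies
   omega(a v) = chi(a) omega(v), so that
   - for chi = id this is W (x) det V^*,
   - for chi(a) = |a|^s with s != 0 this is W (x) |det V^*|^s, the density
     being extended by 0 at 0.
   W is a module over K, where j : R -> K. *)
Definition mxact (R : realType) (V : vectType R) (r : nat) (A : 'M[R]_r)
  (b : r.-tuple V) : r.-tuple V :=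
  [tuple \sum_(k < r) A i k *: tnth b k | i < r].

Section Weighted.
Variables (R : realType) (V : vectType R) (r : nat) (chi : R -> R).
Variables (K : comNzRingType) (j : {rmorphism R -> K}) (W : lmodType K).

Definition is_weighted : {pred (r.-tuple V -> W)} := fun f =>
  `[< forall A b, f (mxact A b) = j (chi (\det A)) *: f b >].

Lemma is_weighted_submod : submod_closed is_weighted.
Proof.
split; first by apply/asboolP => A b; rewrite scaler0.
move=> a f g /asboolP fw /asboolP gw; apply/asboolP => A b.
rewrite -[LHS]/(a *: f (mxact A b) + g (mxact A b)) fw gw.
by rewrite -[in RHS]/(a *: f b + g b) scalerDr !scalerA mulrC.
Qed.

HB.instance Definition _ :=
  GRing.isSubmodClosed.Build K (r.-tuple V -> W) is_weighted is_weighted_submod.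

Record weighted := Weighted {
  weighted_val :> r.-tuple V -> W;
  weightedP : weighted_val \in is_weighted }.

HB.instance Definition _ := [isSub for weighted_val].
HB.instance Definition _ := [Choice of weighted by <:].
HB.instance Definition _ := [SubChoice_isSubLmodule of weighted by <:].

End Weighted.

Section WeightedOps.
Variables (R : realType) (V : vectType R) (r : nat) (chi : R -> R).
Variables (K : comNzRingType) (j : {rmorphism R -> K}) (W : lmodType K).

Lemma wtens_subproof (s : W) (mu : weighted V r chi idfun R^o) :
  (fun b => j (mu b) *: s) \in @is_weighted R V r chi K j W.
Proof.
apply/asboolP => A b; have /asboolP -> := weightedP mu.
by rewrite -[_ *: mu b]/(_ * _) rmorphM scalerA.
Qed.

(* s (x) mu, for s in W and mu in the real line of weight chi *)
Definition wtens (s : W) (mu : weighted V r chi idfun R^o) :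
  weighted V r chi j W := Weighted (wtens_subproof s mu).

Lemma wmap_subproof (phi : {linear W -> W}) (w : weighted V r chi j W) :
  phi \o w \in @is_weighted R V r chi K j W.
Proof.
apply/asboolP => A b; have /asboolP fw := weightedP w.
by rewrite /= fw linearZ.
Qed.

(* phi (x) id *)
Definition wmap (phi : {linear W -> W}) (w : weighted V r chi j W) :
  weighted V r chi j W := Weighted (wmap_subproof phi w).

End WeightedOps.

Definition abspow (R : realType) (s : R) : R -> R := fun a => `|a| `^ s.

Section AbsDensity.
Variables (R : realType) (V : vectType R) (r : nat) (s : R).

Lemma wabs_subproof (w : weighted V r id idfun R^o) :
  (fun b => `|w b| `^ s) \in @is_weighted R V r (abspow s) R idfun R^o.
Proof.
apply/asboolP => A b; have /asboolP -> := weightedP w.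
by rewrite -[_ *: w b]/(_ * _) normrM powRM.
Qed.

(* |omega|^s, for omega in det V^* *)
Definition wabs (w : weighted V r id idfun R^o) :
  weighted V r (abspow s) idfun R^o := Weighted (wabs_subproof w).

End AbsDensity.

Section WeightedBundles.
Variables (R : realType) (n : nat) (M : manifold R n).
Variables (r : nat) (V : framed M r).

Definition weightb (chi : R -> R) (K : comNzRingType) (j : {rmorphism R -> K})
    (W : bundle M K) : bundle M K :=
  Bundle (bfib := fun p => weighted (V p) r chi j (bfib W p) : lmodType K)
  (fun U w => forall x : M,
     bsm W (U `&` fdom V x) (fun q => w q (frame V x q))).

Definition detb : bundle M R := weightb id idfun (trivial_bundle M).
Definition densb (s : R) : bundle M R :=
  weightb (abspow s) idfun (trivial_bundle M).

(* D = D1 (x) id + id (x) D2 on W (x) L, for L the real line bundle of weight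
   chi.  D2 is a connection along A, whereas D1 and D are connections along A'
   (which is A itself or its complexification), inc being the inclusion. *)
Definition is_tensor_conn (chi : R -> R) (K : comNzRingType)
    (j : {rmorphism R -> K}) (W : bundle M K)
    (A : bundle M R) (A' : bundle M K) (inc : sect A -> sect A')
    (D1 : sect A' -> sect W -> sect W)
    (D2 : sect A -> sect (weightb chi idfun (trivial_bundle M)) ->
          sect (weightb chi idfun (trivial_bundle M)))
    (D : sect A' -> sect (weightb chi j W) -> sect (weightb chi j W)) : Prop :=
  forall U e s mu, open U -> bsm A U e -> bsm W U s ->
    bsm (weightb chi idfun (trivial_bundle M)) U mu ->
    forall p, U p -> D (inc e) (fun q => wtens j (s q) (mu q)) p =
      wtens j (D1 (inc e) s p) (mu p) + wtens j (s p) (D2 e mu p).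

(* nabla_e omega = alpha(e) omega on det V^*, with a = alpha(e), for the
   connection on det V^* induced by D. *)
Definition det_derivative (m : nat) (E : vbundle M m) (C : courant E)
    (D : sect E -> sect V -> sect V) (U : set M) (e : sect E) (w : sect detb)
    (a : M -> R) : Prop :=
  forall W (v : 'I_r -> sect V), open W -> W `<=` U ->
    (forall i, bsm V W (v i)) ->
    forall p, W p ->
      ader C e (fun q => w q [tuple (v i q : V q) | i < r]) p
      - \sum_(k < r)
          w p [tuple ((if i == k then D e (v k) p else v i p) : V p) | i < r]
      = a p * w p [tuple (v i p : V p) | i < r].

(* Ds is the connection on |det V^*|^s induced by D: it sends |omega|^s to
   s alpha(e) |omega|^s if nabla_e omega = alpha(e) omega. *)
Definition is_density_conn (m : nat) (E : vbundle M m) (C : courant E) (s : R)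
    (D : sect E -> sect V -> sect V)
    (Ds : sect E -> sect (densb s) -> sect (densb s)) : Prop :=
  is_rconnection C Ds /\
  forall U e (w : sect detb) (a : M -> R), open U ->
    bsm E U e -> bsm detb U w -> (forall p, U p -> w p != 0) ->
    det_derivative C D U e w a ->
    forall p, U p ->
      Ds e (fun q => wabs s (w q)) p = (s * a p) *: wabs s (w p).

End WeightedBundles.

Section LieDerivative.
Variables (R : realType) (n : nat) (M : manifold R n).

(* nu = L_X mu for s-densities on M: in the coordinates of any chart,
   L_X (u |dx|^s) = (X u + s (sum_i d_i X^i) u) |dx|^s. *)
Definition is_lie_derivative (s : R) (U : set M) (X : sect (tangent M))
    (mu nu : sect (densb (tangent M) s)) : Prop :=
  forall x q, U q -> cdom x q ->
    nu q (frame (tangent M) x q) =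
      vfder X (fun q' => mu q' (frame (tangent M) x q')) q
      + s * (\sum_(i < n) tder q (tnth (frame (tangent M) x q) i)
               (fun q' => fcoord (tangent M) x q' i (X q')))
          * mu q (frame (tangent M) x q).

End LieDerivative.

(* End(W), with c : V -> End(W), is the Clifford algebra of (V, h) for the
   convention c(v)^2 = h(v, v). *)
Definition is_clifford_algebra (R : realType) (V W : vectType R)
    (h : 'Hom(V, 'Hom(V, R^o))) (c : 'Hom(V, 'End(W))) : Prop :=
  (forall v, (c v \o c v)%VF = (h v v : R) *: \1%VF) /\
  forall (B : algType R) (g : {linear V -> B}),
    (forall v, g v * g v = (h v v : R)%:A) ->
    exists! phi : 'End(W) -> B,
      [/\ linear phi, phi \1%VF = 1,
          forall f f', phi (f \o f')%VF = phi f * phi f' &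
          forall v, phi (c v) = g v].

Section Spinors.
Variables (R : realType) (n : nat) (M : manifold R n) (m N : nat).
Variables (E : vbundle M m) (C : courant E) (S0 : vbundle M N).
Variable c : forall p, 'Hom(E p, 'End(S0 p)).

Record is_spinor_module : Prop := IsSpinorModule {
  clifford_smooth : forall U (e : sect E) (s : sect S0), open U ->
    bsm E U e -> bsm S0 U s -> bsm S0 U (fun p => c p (e p) (s p));
  clifford_sqr : forall p v s, c p v (c p v s) = (pairing C p v v : R) *: s;
  clifford_commutant : forall p (f : 'End(S0 p)),
    (forall v, (f \o c p v)%VF = (c p v \o f)%VF) ->
    exists a : R, f = a *: \1%VF;
  clifford_iso : forall p, is_clifford_algebra (pairing C p) (c p) }.

Definition clifford_compatible (D : sect E -> sect E -> sect E)
    (D0 : sect E -> sect S0 -> sect S0) : Prop :=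
  forall U e1 e2 s, open U -> bsm E U e1 -> bsm E U e2 -> bsm S0 U s ->
    forall p, U p ->
      D0 e1 (fun q => c q (e2 q) (s q)) p =
      c p (D e1 e2 p) (s p) + c p (e2 p) (D0 e1 s p).

(* |det S_0^*|^(1/N), S_R = S_0 (x) |det S_0^*|^(1/N), S = S_R (x) C,
   L = |det T^*M|^(1/2), and the canonical weighted spinor bundle S (x) L *)
Definition spin_density : bundle M R := densb S0 N%:R^-1.
Definition real_spinor : bundle M R :=
  weightb S0 (abspow N%:R^-1) idfun S0.
Definition spinor : bundle M (complex R) := cplxb real_spinor.
Definition half_density : bundle M R := densb (tangent M) 2^-1.
Definition weighted_spinor : bundle M (complex R) :=
  weightb (tangent M) (abspow 2^-1) (real_complex R) spinor.

(* The complex linear extensions of c (x) id to S and to S (x) L. *)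
Definition clifford_spinor p (z : cplx (E p)) (t : bfib spinor p) :
    bfib spinor p :=
  (wmap (c p z.1) t.1 - wmap (c p z.2) t.2,
   wmap (c p z.1) t.2 + wmap (c p z.2) t.1).

Lemma clifford_spinor_linear p z : linear (@clifford_spinor p z).
Proof.
pose T (v : E p) (t : bfib real_spinor p) : bfib real_spinor p := wmap (c p v) t.
have TD v t t' : T v (t + t') = T v t + T v t'.
  by apply/val_inj/funext => b; apply: linearD.
have TZ v a t : T v (a *: t) = a *: T v t.
  by apply/val_inj/funext => b; apply: linearZ.
have TN v t : T v (- t) = - T v t by rewrite -scaleN1r TZ scaleN1r.
move=> [a1 a2] [u v] [u' v']; congr pair.
- rewrite -[LHS]/(T z.1 (a1 *: u - a2 *: v + u')
                  - T z.2 (a1 *: v + a2 *: u + v')).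
  rewrite -[RHS]/(a1 *: (T z.1 u - T z.2 v) - a2 *: (T z.1 v + T z.2 u)
                  + (T z.1 u' - T z.2 v')).
  rewrite !(TD, TZ, TN) !opprD addrACA; congr (_ + _).
  by rewrite scalerBr scalerDr opprD [X in _ + X = _]addrC addrACA -!addrA;
    congr (_ + _); rewrite addrCA addrA addrC.
- rewrite -[LHS]/(T z.1 (a1 *: v + a2 *: u + v')
                  + T z.2 (a1 *: u - a2 *: v + u')).
  rewrite -[RHS]/(a1 *: (T z.1 v + T z.2 u) + a2 *: (T z.1 u - T z.2 v)
                  + (T z.1 v' + T z.2 u')).
  rewrite !(TD, TZ, TN) addrACA; congr (_ + _).
  by rewrite scalerBr scalerDr addrACA.
Qed.

HB.instance Definition _ p z := GRing.isLinear.Build (complex R)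
  (bfib spinor p) (bfib spinor p) _ (@clifford_spinor p z)
  (clifford_spinor_linear z).

Definition clifford_weighted p (z : cplx (E p)) (t : bfib weighted_spinor p) :
    bfib weighted_spinor p := wmap (@clifford_spinor p z) t.

Record is_spinor_involution (J : forall p, bfib spinor p -> bfib spinor p) :
    Prop := IsSpinorInvolution {
  involution_linear : forall p, linear (@J p);
  involution_smooth : forall U s, open U -> bsm spinor U s ->
    bsm spinor U (fun p => J p (s p));
  involutionK : forall p t, J p (J p t) = t;
  involution_clifford : forall p z t,
    J p (clifford_spinor z t) = - clifford_spinor z (J p t) }.

(* The connections that D0 induces on S_R and, tensored with nabla^L, on
   S (x) L. *)
Definition is_real_spinor_conn (D0 : sect E -> sect S0 -> sect S0)
    (DSR : sect E -> sect real_spinor -> sect real_spinor) : Prop :=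
  is_rconnection C DSR /\
  exists2 Dd : sect E -> sect spin_density -> sect spin_density,
    is_density_conn C D0 Dd & is_tensor_conn id D0 Dd DSR.

(* nabla^L_v mu = L_{rho(v)} mu - (1/2) div(v) mu *)
Definition is_half_density_conn (D : sect E -> sect E -> sect E)
    (DL : sect E -> sect half_density -> sect half_density) : Prop :=
  is_rconnection C DL /\
  forall U v mu, open U -> bsm E U v -> bsm half_density U mu ->
    is_lie_derivative U (fun p => anchor C p (v p)) mu
      (fun p => DL v mu p + (2^-1 * divergence D v p) *: mu p).

Definition real_dir (e : sect E) : sect (cplxb E) := fun p => (e p, 0).

Definition is_weighted_spinor_conn
    (DSR : sect E -> sect real_spinor -> sect real_spinor)
    (DL : sect E -> sect half_density -> sect half_density)
    (DS : sect (cplxb E) -> sect weighted_spinor -> sect weighted_spinor) :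
    Prop :=
  is_cconnection C DS /\ is_tensor_conn real_dir (cplx_conn DSR) DL DS.

End Spinors.

Section Action.
Variables (R : realType) (n : nat) (M : manifold R n) (m : nat).
Variables (EB EF : vbundle M m) (CB : courant EB).
Variable iota : forall p, 'Hom(EB p, EF p).
Variable DB : sect EB -> sect EB -> sect EB.

Definition iota_inv (s : sect EF) : sect EB := fun p => (iota p)^-1%VF (s p).

(* nabla^F, with nabla^F_X (iota Y) = iota (nabla^B_X Y), as a connection along
   E^B, and as a connection along E^F. *)
Definition connF (X : sect EB) (Z : sect EF) : sect EF :=
  fun p => iota p (DB X (iota_inv Z) p).
Definition connFF (X Z : sect EF) : sect EF := connF (iota_inv X) Z.

(* The complexification of E^B (+) E^F, and nabla^B (+) nabla^F on it. *)
Definition EBF (p : M) : vectType (complex R) :=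
  (cplx (EB p) * cplx (EF p))%type.
Definition EBFb : bundle M (complex R) := sumb (cplxb EB) (cplxb EF).

Definition projB (Z : sect EBFb) : sect (cplxb EB) := fun p => (Z p).1.
Definition projF (Z : sect EBFb) : sect (cplxb EF) := fun p => (Z p).2.

Definition actB (e : sect (cplxb EB)) : (M -> complex R) -> M -> complex R :=
  cplx_act (ader CB) e.
Definition connBF (e : sect (cplxb EB)) (Z : sect EBFb) : sect EBFb :=
  fun p => (cplx_conn DB e (projB Z) p, cplx_conn connF e (projF Z) p).

Definition frameBF (x q : M) : (m + m).-tuple (EBF q) :=
  cat_tuple
    [tuple ((tnth (frame EB x q) i, 0), 0) : EBF q | i < m]
    [tuple (0, (tnth (frame EF x q) i, 0)) : EBF q | i < m].

Definition extBF (p : M) (v : EBF p) : sect EBFb :=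
  fun q => \sum_(i < m + m) coord (frameBF p p) i v *: tnth (frameBF p q) i.

Definition covector (p : M) := 'Hom(EBF p, (complex R)^o).
Definition dsect := forall p, covector p.

Definition dsmooth (U : set M) (a : dsect) : Prop :=
  forall W (Z : sect EBFb), open W -> W `<=` U -> bsm EBFb W Z ->
    csmooth W (fun p => a p (Z p)).

Definition coframeBF (x q : M) (i : 'I_(m + m)) : covector q :=
  linfun (fun v => coord (frameBF x q) i v : (complex R)^o).

(* (nabla_e a)(Y) = e (a(Y)) - a(nabla_e Y) *)
Definition dual_conn (e : sect (cplxb EB)) (a : dsect) : dsect := fun p =>
  linfun (fun u : EBF p =>
    actB e (fun q => a q (extBF u q)) p - a p (connBF e (extBF u) p)
    : (complex R)^o).

(* Elements of the k-th tensor power of a finite-dimensional space are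
   multilinear forms of k covectors; an element of the tensor algebra of
   (E^{B,F})_p is a function on lists of covectors, its component of degree k
   being the restriction to lists of length k. *)
Definition multilinear (p : M) (t : seq (covector p) -> complex R) : Prop :=
  forall l l' (z : complex R) a b,
    t (l ++ (z *: a + b) :: l') = z * t (l ++ a :: l') + t (l ++ b :: l').

Definition tensor := forall p, seq (covector p) -> complex R.

Record tensor_field (U : set M) (t : tensor) : Prop := TensorField {
  tensor_multilinear : forall p, U p -> multilinear (t p);
  tensor_locally_finite : forall p, U p -> exists W k,
    [/\ open W, W p & forall q l, W q -> U q -> (k < size l)%N -> t q l = 0];
  tensor_smooth : forall W k (a : 'I_k -> dsect), open W -> W `<=` U ->
    (forall i, dsmooth W (a i)) ->
    csmooth W (fun p => t p [tuple a i p | i < k]) }.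

(* (nabla^T_e t)(a_1, ..., a_k) *)
Definition connT (e : sect (cplxb EB)) (t : tensor) (k : nat)
    (a : 'I_k -> dsect) : M -> complex R := fun p =>
  actB e (fun q => t q [tuple a i q | i < k]) p
  - \sum_(h < k) t p [tuple if i == h then dual_conn e (a h) p else a i p
                     | i < k].

(* Pi_U *)
Definition parallel (U : set M) (t : tensor) : Prop :=
  tensor_field U t /\
  forall W e k (a : 'I_k -> dsect), open W -> W `<=` U ->
    bsm (cplxb EB) W e -> (forall i, dsmooth W (a i)) ->
    forall p, W p -> connT e t a p = 0.

Definition tprod (t t' : tensor) : tensor := fun p l =>
  \sum_(i < (size l).+1) t p (take i l) * t' p (drop i l).
Definition tone : tensor := fun p l => (nilp l)%:R.
Definition tlin (z : complex R) (t t' : tensor) : tensor :=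
  fun p l => z * t p l + t' p l.
Arguments tprod t t' p l : clear implicits.
Arguments tone p l : clear implicits.
Arguments tlin z t t' p l : clear implicits.

(* The operator A = nabla^S + kappa, for a bundle SS with a connection DS along
   the complexification of E^F and with Clifford action cl. *)
Variables (SS : bundle M (complex R)).
Variable cl : forall p, cplx (EF p) -> bfib SS p -> bfib SS p.
Variable DS : sect (cplxb EF) -> sect SS -> sect SS.

Definition iota_cplx (e : sect (cplxb EB)) : sect (cplxb EF) :=
  fun p => (iota p (e p).1, iota p (e p).2).

Definition superconn (Z : sect EBFb) (s : sect SS) : sect SS := fun p =>
  DS (iota_cplx (projB Z)) s p + cl (projF Z p) (s p).

Fixpoint superconn_iter (k : nat) (s : sect SS) : ('I_k -> sect EBFb) -> sect SS :=
  match k with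
  | 0 => fun _ => s
  | k'.+1 => fun X p =>
      let X0 := X ord0 in
      let Xr i := X (lift ord0 i) in
      superconn X0 (superconn_iter s Xr) p
      - \sum_(h < k') superconn_iter s
          (fun i => if i == h then connBF (projB X0) (Xr h) else Xr i) p
  end.

(* Phi(t) s: the contraction of t with the iterates of A, computed at p in the
   frame around p; the sum over the degrees k has finite support. *)
Definition Phi (t : tensor) (s : sect SS) : sect SS := fun p =>
  \sum_(k \in [set: nat]) \sum_(I : k.-tuple 'I_(m + m))
    t p [seq coframeBF p p i | i <- I] *:
      superconn_iter s (fun i q => tnth (frameBF p q) (tnth I i)) p.

(* Pi_U is an associative algebra, and Gamma_U(SS) is a module over it; all
   equalities are between restrictions to U. *)
Record parallel_algebra (U : set M) : Prop := ParallelAlgebra {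
  parallel_one : parallel U tone;
  parallel_tprod : forall t t', parallel U t -> parallel U t' ->
    parallel U (tprod t t');
  parallel_tlin : forall z t t', parallel U t -> parallel U t' ->
    parallel U (tlin z t t');
  tprodA : forall t t' t'',
    parallel U t -> parallel U t' -> parallel U t'' ->
    forall p, U p -> tprod t (tprod t' t'') p = tprod (tprod t t') t'' p;
  tprod1t : forall t, parallel U t -> forall p, U p -> tprod tone t p = t p;
  tprodt1 : forall t, parallel U t -> forall p, U p -> tprod t tone p = t p;
  tprod_linl : forall z t t' t'',
    parallel U t -> parallel U t' -> parallel U t'' ->
    forall p, U p ->
      tprod (tlin z t t') t'' p = tlin z (tprod t t'') (tprod t' t'') p;
  tprod_linr : forall z t t' t'',
    parallel U t -> parallel U t' -> parallel U t'' ->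
    forall p, U p ->
      tprod t (tlin z t' t'') p = tlin z (tprod t t') (tprod t t'') p }.

Record parallel_module (U : set M) : Prop := ParallelModule {
  section_lin : forall z s s', bsm SS U s -> bsm SS U s' ->
    bsm SS U (fun q => z *: s q + s' q);
  Phi_smooth : forall t s, parallel U t -> bsm SS U s -> bsm SS U (Phi t s);
  Phi_local : forall t t' s s', parallel U t -> parallel U t' ->
    bsm SS U s -> bsm SS U s' ->
    (forall p, U p -> t p = t' p) -> (forall p, U p -> s p = s' p) ->
    forall p, U p -> Phi t s p = Phi t' s' p;
  Phi_linl : forall z t t' s, parallel U t -> parallel U t' -> bsm SS U s ->
    forall p, U p -> Phi (tlin z t t') s p = z *: Phi t s p + Phi t' s p;
  Phi_linr : forall z t s s', parallel U t -> bsm SS U s -> bsm SS U s' ->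
    forall p, U p ->
      Phi t (fun q => z *: s q + s' q) p = z *: Phi t s p + Phi t s' p;
  Phi_one : forall s, bsm SS U s -> forall p, U p -> Phi tone s p = s p;
  Phi_mul : forall t t' s, parallel U t -> parallel U t' -> bsm SS U s ->
    forall p, U p -> Phi (tprod t t') s p = Phi t (Phi t' s) p }.

End Action.

(* Main.v *)
Require Import Defs.
From HB Require Import structures.
From mathcomp Require Import all_boot all_order all_algebra.
From mathcomp Require Import complex ring.
From mathcomp Require Import all_classical all_reals all_analysis.

Set Implicit Arguments.
Unset Strict Implicit.
Unset Printing Implicit Defensive.

Import Order.TTheory GRing.Theory Num.Theory numFieldNormedType.Exports.

Local Open Scope classical_set_scope.
Local Open Scope ring_scope.

(** Over a small open set W the smooth functions form a ring and the smooth
sections form modules over it, so that the iterates A^k become an algebraic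
object.  The Leibniz rules make A^k s multilinear over functions; hence Phi,
which is computed at each point in its own frame, can be computed near a point
in one fixed frame F, as the sum of the Y_J A^l s(F_J) over multi-indices J.
If Y is parallel, then the derivatives of the coefficients Y_J cancel the terms
in which the connection hits the slots F_J, so that, by induction on k,
A^k(sum_J Y_J A^l s(F_J))(X_1, ..., X_k) = sum_J Y_J A^(k+l) s(X_1, ..., X_k, F_J),
and contracting with X gives Phi(X (x) Y) s. *)

(** * Leibniz sums and iterated covariant derivatives over lists *)

(** The data are operators on total functions, specified only over open sets on which their
    arguments are smooth, and every identity holds only there. Extending sections over W by 0 turns
    such identities into equations in a module: smoothness across the boundary of W is never asked
    for, and locality makes the values over W independent of the extension. A second obstacle is
    that the frame used by Phi changes with the point, so Phi(Y)s is not visibly a smooth section to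
    which A could be applied again. Independence of the frame, together with the local bound on the
    degree, makes it a finite sum with smooth coefficients near each point. The asymmetry between
    the factors has a simple source: the operators A contracted with X differentiate the
    coefficients of Y, whereas the coefficients of X stand outside all derivatives. Slots are kept
    in lists rather than indexed families, so that removing the first slot and concatenating slots
    are plain list operations. *)

Lemma mktuple_cons (T : Type) k (b : 'I_k.+1 -> T) :
  [tuple b i | i < k.+1] = b ord0 :: [tuple b (lift ord0 i) | i < k] :> seq T.
Proof. by rewrite /= enum_ordSl /= -map_comp. Qed.

Section ListDerivation.
Variables (X : Type) (d : X -> X).

(* The sum over h of T [:: x_1; ...; d x_h; ...; x_k]. *)
Fixpoint lder (V : zmodType) (T : seq X -> V) (l : seq X) : V :=
  if l is x :: l' then T (d x :: l') + lder (fun m => T (x :: m)) l' else 0.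

Section Target.
Variable V : zmodType.
Implicit Types T : seq X -> V.

(** [lder] evaluates T only at lists as long as l; this is how an induction hypothesis on the length
    is used under [lder]. *)
Lemma lder_ext T T' l :
  (forall m, size m = size l -> T m = T' m) -> lder T l = lder T' l.
Proof.
elim: l T T' => //= x l IH T T' TT'; congr (_ + _); first exact: TT'.
by apply: IH => m sm; apply: TT'; rewrite /= sm.
Qed.

Lemma lder_cat T l1 l2 :
  lder T (l1 ++ l2) =
  lder (fun m => T (m ++ l2)) l1 + lder (fun m => T (l1 ++ m)) l2.
Proof.
elim: l1 T => [|x l1 IH] T /=; first by rewrite add0r.
by rewrite IH addrA.
Qed.

Lemma lder0 l : lder (fun _ => 0 : V) l = 0.
Proof. by elim: l => //= x l ->; rewrite addr0. Qed.

Lemma lderD T T' l :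
  lder (fun m => T m + T' m) l = lder T l + lder T' l.
Proof.
by elim: l T T' => [|x l IH] T T' /=; rewrite ?addr0 // IH addrACA.
Qed.

Lemma lder_sum (I : Type) (r : seq I) (P : pred I) (T : I -> seq X -> V) l :
  lder (fun m => \sum_(i <- r | P i) T i m) l =
  \sum_(i <- r | P i) lder (T i) l.
Proof.
elim: r => [|i r IH].
  by rewrite big_nil -[RHS](lder0 l); apply: lder_ext => m _; rewrite big_nil.
rewrite big_cons; case: ifP => Pi; rewrite -IH -?lderD; apply: lder_ext => m _.
  by rewrite big_cons Pi.
by rewrite big_cons Pi.
Qed.

(** The bridge to the sums over slots in [superconn_iter] and [connT]. *)
Lemma lder_tuple k (T : seq X -> V) (a : 'I_k -> X) :
  lder T [tuple a i | i < k] =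
  \sum_(h < k) T [tuple if i == h then d (a h) else a i | i < k].
Proof.
elim: k T a => [|k IH] T a; first by rewrite big_ord0 tuple0.
rewrite mktuple_cons /= IH big_ord_recl; congr (_ + _).
  by rewrite mktuple_cons.
by apply: eq_bigr => h _; rewrite [in RHS]mktuple_cons.
Qed.

End Target.

Lemma lder_morph (V W : zmodType) (g : {additive V -> W}) T l :
  lder (fun m => g (T m)) l = g (lder T l).
Proof.
elim: l T => [|x l IH] T /=; first by rewrite raddf0.
by rewrite IH raddfD.
Qed.

Lemma lderMl (O : pzRingType) c (T : seq X -> O) l :
  lder (fun m => c * T m) l = c * lder T l.
Proof. by elim: l T => [|x l IH] T /=; rewrite ?mulr0 // IH mulrDr. Qed.

Lemma lderMr (O : pzRingType) c (T : seq X -> O) l :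
  lder (fun m => T m * c) l = lder T l * c.
Proof. by elim: l T => [|x l IH] T /=; rewrite ?mul0r // IH mulrDl. Qed.

End ListDerivation.

Lemma big_tuple0 (V : nmodType) (I : finType) (f : seq I -> V) :
  \sum_(J : 0.-tuple I) f J = f [::].
Proof. by rewrite (big_pred1 [tuple]) // => J; apply/esym/eqP/tuple0. Qed.

Lemma big_tupleS (V : nmodType) (I : finType) k (f : seq I -> V) :
  \sum_(J : k.+1.-tuple I) f J = \sum_(i : I) \sum_(J : k.-tuple I) f (i :: J).
Proof.
rewrite pair_big /=.
rewrite (reindex (fun iJ : I * k.-tuple I => [tuple of iJ.1 :: iJ.2])) //=.
exists (fun J : k.+1.-tuple I => (thead J, [tuple of behead J])) => J _ /=.
  by case: J => i J; congr pair; apply/val_inj.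
by rewrite -tuple_eta.
Qed.

Lemma big_tuple_cat (V : nmodType) (I : finType) k l (f : seq I -> seq I -> V) :
  \sum_(J : (k + l).-tuple I) f (take k J) (drop k J) =
  \sum_(J : k.-tuple I) \sum_(J' : l.-tuple I) f J J'.
Proof.
elim: k f => [|k IH] f.
  rewrite [RHS](big_tuple0 (fun J => \sum_(J' : l.-tuple I) f J J')).
  by apply: eq_bigr => J _; rewrite take0 drop0.
rewrite (big_tupleS _ (fun J => f (take k.+1 J) (drop k.+1 J))).
rewrite (big_tupleS _ (fun J => \sum_(J' : l.-tuple I) f J J')).
by apply: eq_bigr => i _ /=; rewrite (IH (fun J J' => f (i :: J) J')).
Qed.

(* The sum over h and j of w J_h j * c [:: J_1; ...; j; ...; J_k], with j in
   position h. *)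
Fixpoint ider (O : pzRingType) (I : finType) (w : I -> I -> O)
    (c : seq I -> O) (J : seq I) : O :=
  if J is i :: J' then
    \sum_j w i j * c (j :: J') + ider w (fun m => c (i :: m)) J'
  else 0.

Lemma big_tuple_take (V : nmodType) (I : finType) k i (f : seq I -> seq I -> V) :
  (i <= k)%N ->
  \sum_(J : k.-tuple I) f (take i J) (drop i J) =
  \sum_(J : i.-tuple I) \sum_(J' : (k - i).-tuple I) f J J'.
Proof.
move=> ik; rewrite -big_tuple_cat.
(* The types [k.-tuple I] and [(i + (k - i)).-tuple I] differ; generalizing [k - i] allows k itself
   to be replaced. *)
by move: (k - i)%N (subnKC ik) => l <-.
Qed.

(** Pairs of degrees grouped by total degree or by first degree. It serves both the product formula
    for Phi and the associativity of [tprod]. *)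
Lemma big_triangle (V : nmodType) n (g : nat -> nat -> V) :
  \sum_(k < n) \sum_(i < k.+1) g i (k - i)%N =
  \sum_(i < n) \sum_(j < n - i) g i j.
Proof.
elim: n => [|n IH]; first by rewrite !big_ord0.
rewrite big_ord_recr /= IH [RHS]big_ord_recr /= subSnn big_ord1.
rewrite big_ord_recr /= subnn addrA; congr (_ + _).
rewrite -big_split /=; apply: eq_bigr => i _.
by rewrite subSn ?big_ord_recr //= ltnW.
Qed.

(** Valid for every bound N beyond the support, so using it in both directions changes the bound of
    a sum. *)
Lemma big_nat_fsum (V : nmodType) N (F : nat -> V) :
  (forall k, (N <= k)%N -> F k = 0) ->
  \sum_(k \in [set: nat]) F k = \sum_(k < N) F k.
Proof.
move=> F0; rewrite fsbig_ord; apply/esym/fsbig_widen => // k [_ /negP].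
by rewrite /= -leqNgt => /F0.
Qed.

(** * Multilinear maps on lists *)

Section Multilinear.
Variables (O : comPzRingType) (G S : lmodType O).

Definition mlin (T : seq G -> S) := forall l l' f a b,
  T (l ++ (f *: a + b) :: l') = f *: T (l ++ a :: l') + T (l ++ b :: l').

(* Multilinearity on lists of length n + 1. *)
Definition mlinn n (T : seq G -> S) := forall l l' f a b, (size l + size l')%N = n ->
  T (l ++ (f *: a + b) :: l') = f *: T (l ++ a :: l') + T (l ++ b :: l').

Lemma mlin_consl T x : mlin T -> mlin (fun l => T (x :: l)).
Proof. by move=> hT l l' f a b; rewrite -cat_cons hT. Qed.

Lemma mlin_catl T m : mlin T -> mlin (fun l => T (m ++ l)).
Proof. by move=> hT l l' f a b; rewrite catA hT !catA. Qed.

Lemma mlin_sum T (I : finType) (c : I -> O) (F : I -> G) l : mlin T ->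
  T ((\sum_i c i *: F i) :: l) = \sum_i c i *: T (F i :: l).
Proof.
move=> hT; have D a b : T ((a + b) :: l) = T (a :: l) + T (b :: l).
  by have := hT [::] l 1 a b; rewrite !scale1r.
have T0 : T (0 :: l) = 0 by apply: (addrI (T (0 :: l))); rewrite -D !addr0.
elim/big_rec2: _ => // i y x _ <-; exact: (hT [::]).
Qed.

(** All slots are expanded at once, the coefficient being a product over the paired multi-indices;
    this is the form needed for a change of frame. *)
Lemma mlin_expand T (I J : finType) (c : J -> I -> O) (F : I -> G) k :
  mlin T -> forall js : k.-tuple J,
  T [seq \sum_i c j i *: F i | j <- js] =
  \sum_(Is : k.-tuple I)
    (\prod_(ji <- zip js Is) c ji.1 ji.2) *: T [seq F i | i <- Is].
Proof.
elim: k T => [|k IH] T hT js.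
  rewrite tuple0 (big_tuple0 (fun Is => (\prod_(ji <- zip [tuple] Is)
    c ji.1 ji.2) *: T [seq F i | i <- Is])).
  by rewrite /= big_nil scale1r.
case/tupleP: js => j js /=.
rewrite (big_tupleS _ (fun Is => (\prod_(ji <- zip (j :: js) Is) c ji.1 ji.2)
  *: T [seq F i | i <- Is])) mlin_sum //.
apply: eq_bigr => i _ /=; rewrite (IH _ (mlin_consl _ hT)) scaler_sumr.
by apply: eq_bigr => Is _; rewrite big_cons /= scalerA.
Qed.

End Multilinear.

(** * Iterates of a superconnection over a commutative ring *)

Section Iteration.
Variables (O : comPzRingType) (G S : lmodType O).
Variables (act : G -> O -> O) (conn : G -> G -> G) (sc : G -> S -> S).
Hypothesis connl : forall f X X' Y,
  conn (f *: X + X') Y = f *: conn X Y + conn X' Y.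
Hypothesis connr : forall X f Y Y',
  conn X (f *: Y + Y') = act X f *: Y + f *: conn X Y + conn X Y'.
Hypothesis scl : forall f X X' s, sc (f *: X + X') s = f *: sc X s + sc X' s.
Hypothesis scr : forall X f s s',
  sc X (f *: s + s') = act X f *: s + f *: sc X s + sc X s'.
Hypothesis act1 : forall X, act X 1 = 0.

(** The recursion is on a separate length k because [lder] calls the previous iterate on modified
    tails, which are not sublists of l. *)
Fixpoint iterA k (s : S) (l : seq G) : S :=
  match k, l with
  | k'.+1, X :: l' => sc X (iterA k' s l') - lder (conn X) (iterA k' s) l'
  | _, _ => s
  end.

(* (A^k s)(X_1, ..., X_k), for l = [:: X_1; ...; X_k] *)
Definition covA s l := iterA (size l) s l.

Lemma covA_cons s X l :
  covA s (X :: l) = sc X (covA s l) - lder (conn X) (covA s) l.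
Proof.
by congr (_ - _); apply: lder_ext => m sm; rewrite /covA sm.
Qed.

Lemma sc_sum (I : finType) X (c : I -> O) (s : I -> S) :
  sc X (\sum_i c i *: s i) = \sum_i (act X (c i) *: s i + c i *: sc X (s i)).
Proof.
(* Additivity is [scr] at f = 1, where [act1] kills the derivative. *)
have D s1 s2 : sc X (s1 + s2) = sc X s1 + sc X s2.
  by have := scr X 1 s1 s2; rewrite !scale1r act1 scale0r add0r.
have sc0 : sc X 0 = 0 by apply: (addrI (sc X 0)); rewrite -D !addr0.
by elim/big_rec2: _ => // i y x _ <-; rewrite scr.
Qed.

(** Only the summand in which the connection hits the slot [f *: a + b] differentiates f, so
    linearity fails by a single [act X f] term. *)
Lemma lder_mlinn n (T : seq G -> S) X l l' f a b :
  mlinn n T -> (size l + size l')%N = n ->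
  lder (conn X) T (l ++ (f *: a + b) :: l') =
  act X f *: T (l ++ a :: l') +
  f *: lder (conn X) T (l ++ a :: l') + lder (conn X) T (l ++ b :: l').
Proof.
move=> hT sl; rewrite !lder_cat /=.
have -> : lder (conn X) (fun m => T (m ++ (f *: a + b) :: l')) l =
    f *: lder (conn X) (fun m => T (m ++ a :: l')) l +
    lder (conn X) (fun m => T (m ++ b :: l')) l.
  rewrite -(lder_morph _ ( *:%R f : {additive S -> S})) -lderD.
  by apply: lder_ext => m sm; rewrite hT ?sm.
have -> : lder (conn X) (fun m => T (l ++ (f *: a + b) :: m)) l' =
    f *: lder (conn X) (fun m => T (l ++ a :: m)) l' +
    lder (conn X) (fun m => T (l ++ b :: m)) l'.
  rewrite -(lder_morph _ ( *:%R f : {additive S -> S})) -lderD.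
  by apply: lder_ext => m sm; rewrite hT ?sm.
rewrite connr -[act _ _ *: a + _ + _]addrA hT // hT // !scalerDr.
set A := lder _ _ _; set B := lder _ _ _; set C := lder _ _ _; set D := lder _ _ _.
set t1 := act _ _ *: _; set t2 := _ *: T _; set t3 := T _.
by rewrite !addrA [LHS](ACl (3*1*4*6*2*5*7)).
Qed.

Lemma lder_connl n (T : seq G -> S) f X X' l :
  mlinn n T -> size l = n.+1 ->
  lder (conn (f *: X + X')) T l =
  f *: lder (conn X) T l + lder (conn X') T l.
Proof.
elim: l n T => [|x l IH] n T hT //= [sl]; rewrite connl.
have /= -> := hT [::] l f (conn X x) (conn X' x) sl.
case: l IH sl => [|y l] IH sl; first by rewrite /= !addr0.
rewrite (IH (size l)) => [|l1 l2 g a b sl12|//]; last first.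
  by rewrite -!cat_cons hT //= addSn sl12.
by rewrite [X in _ = X + _]scalerDr addrACA.
Qed.

(** The induction is on the length, since [lder] evaluates the previous iterate at other lists of
    the same length. The first slot is linear by [scl] and [lder_connl]; in a later slot the
    [act X f] term of [scr] cancels the one of [lder_mlinn]. *)
Lemma mlin_covA s : mlin (covA s).
Proof.
suff H n : mlinn n (covA s) by move=> l l' f a b; exact: (H (size l + size l')%N).
elim: n => [|n IH] [|x l] l' f a b //= sl; rewrite ?cat0s ?cat_cons !covA_cons.
- by move/size0nil: sl => -> /=; rewrite !subr0; exact: scl.
- rewrite scl (lder_connl _ _ _ IH) // scalerBr opprD; exact: addrACA.
- have {}sl : (size l + size l')%N = n by case: sl.
  rewrite IH // scr (lder_mlinn _ _ _ _ IH) // scalerBr !opprD.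
  by rewrite [LHS](AC (3*3) (1*4*(2*5)*(3*6))) /= subrr add0r.
Qed.

(* The hypothesis says that the tensor sum_a c_a L_a is parallel. *)
Lemma covA_parallel (I : finType) (c : I -> O) (L : I -> seq G) s :
  (forall (T : seq G -> S) X, mlin T ->
     \sum_a (act X (c a) *: T (L a) + c a *: lder (conn X) T (L a)) = 0) ->
  forall l, covA (\sum_a c a *: covA s (L a)) l =
    \sum_a c a *: covA s (l ++ L a).
Proof.
move=> par l; have [n] := ubnP (size l); elim: n l => // n IH [|X l] //= sl.
rewrite covA_cons IH // sc_sum.
have -> : lder (conn X) (covA (\sum_a c a *: covA s (L a))) l =
    \sum_a c a *: lder (conn X) (fun m => covA s (m ++ L a)) l.
  under [RHS]eq_bigr do rewrite -(lder_morph _ ( *:%R _ : {additive S -> S})).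
  by rewrite -lder_sum; apply: lder_ext => m sm; rewrite IH ?sm.
(* Besides the common terms, the left side contains the derivatives [act X (c a)] and the right side
   the terms of [lder] falling on [L a], with a minus sign. They agree by [par] for the multilinear
   map [m |-> covA s (l ++ m)], which is added here as a zero. *)
rewrite -sumrB -[RHS]addr0.
rewrite -[X in _ = _ + X](par _ X (mlin_catl l (mlin_covA s))) -big_split /=.
apply: eq_bigr => a _; rewrite covA_cons lder_cat.
rewrite scalerBr scalerDr opprD.
set u := act _ _ *: _; set v := _ *: sc _ _; set w := _ *: lder _ _ _.
set z := _ *: lder _ _ _.
by rewrite !addrA [RHS](ACl (4*1*2*(3*5))) /= addNr addr0.
Qed.

(** The iterates differentiate s and are linear only over functions killed by [act]; this is applied
    to constants. *)
Lemma covA_lin z s s' l : (forall X, act X z = 0) ->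
  covA (z *: s + s') l = z *: covA s l + covA s' l.
Proof.
move=> az; have [n] := ubnP (size l); elim: n l => // n IH [|X l] //= sl.
rewrite !covA_cons IH // scr az scale0r add0r scalerBr.
have -> : lder (conn X) (covA (z *: s + s')) l =
    z *: lder (conn X) (covA s) l + lder (conn X) (covA s') l.
  rewrite -(lder_morph _ ( *:%R z : {additive S -> S})) -lderD.
  by apply: lder_ext => m sm; rewrite IH ?sm.
by rewrite opprD addrACA.
Qed.

Lemma covA_sum (I : Type) (r : seq I) (s : I -> S) l :
  covA (\sum_(i <- r) s i) l = \sum_(i <- r) covA (s i) l.
Proof.
have D s1 s2 : covA (s1 + s2) l = covA s1 l + covA s2 l.
  by have := covA_lin s1 s2 l act1; rewrite !scale1r.
elim: r => [|i r IH]; last by rewrite !big_cons D IH.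
by rewrite !big_nil; apply: (addrI (covA 0 l)); rewrite -D !addr0.
Qed.

(** With w the connection matrix of the frame F, the last hypothesis is the equation for the
    components of a parallel tensor. Exchanging the two sums over the index of a slot moves w from
    the frame vectors to the coefficients. *)
Lemma frame_parallel (I : finType) (F : I -> G) (w : I -> I -> O) X k
    (c : seq I -> O) (T : seq G -> S) :
  (forall j, conn X (F j) = \sum_i w i j *: F i) -> mlin T ->
  (forall J : k.-tuple I, act X (c J) = - ider w c J) ->
  \sum_(J : k.-tuple I) (act X (c J) *: T (map F J) +
    c J *: lder (conn X) T (map F J)) = 0.
Proof.
move=> cF hT cw.
under eq_bigr do rewrite cw scaleNr.
rewrite big_split /= sumrN; apply/eqP; rewrite addrC subr_eq0; apply/eqP.
elim: k c T hT {cw} => [|k IH] c T hT.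
  rewrite (big_tuple0 (fun J => c J *: lder (conn X) T (map F J))).
  by rewrite (big_tuple0 (fun J => ider w c J *: T (map F J))) /= scaler0 scale0r.
rewrite (big_tupleS _ (fun J => c J *: lder (conn X) T (map F J))).
rewrite (big_tupleS _ (fun J => ider w c J *: T (map F J))) /=.
under eq_bigr do under eq_bigr do rewrite scalerDr.
under [RHS]eq_bigr do under eq_bigr do rewrite scalerDl.
under eq_bigr do rewrite big_split /=.
under [RHS]eq_bigr do rewrite big_split /=.
rewrite !big_split /=; congr (_ + _); last first.
  by apply: eq_bigr => i _; apply: (IH (fun m => c (i :: m))); apply: mlin_consl.
(* The first slot: i and j swap roles between the expansion of [conn X (F j)] and the first term of
   [ider]. *)
rewrite exchange_big [RHS]exchange_big /=; apply: eq_bigr => J _.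
under eq_bigr do rewrite cF mlin_sum // scaler_sumr.
rewrite exchange_big /=; apply: eq_bigr => i _.
by rewrite scaler_suml; apply: eq_bigr => j _; rewrite scalerA mulrC.
Qed.

End Iteration.

(** * Smooth functions *)

Section SmoothFunctions.
Variables (R : realType) (n : nat).
Implicit Types (W : set 'rV[R]_n) (f g : 'rV[R]_n -> R^o).

(** Used to see that differentiability depends only on the germ: near v the remainder with respect
    to the zero map is identically 0. *)
Lemma near0_differentiable f v : (\near v, f v = 0) -> differentiable f v.
Proof.
move=> f0; have fv : f v = 0 by apply: nbhs_singleton f0.
have E : f \o shift v = cst (f v) + (\0 : {linear 'rV[R]_n -> R^o}) +o_ 0 id.
  apply/eqaddoP => e e0; rewrite fv.
  have : \forall y \near 0, f (y + v) = 0.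
    by move: f0; rewrite (near_shift 0); apply: filterS => y /=; rewrite subr0.
  apply: filterS => y fy.
  rewrite (_ : (_ - _) y = 0) ?normr0 ?mulr_ge0 // ?ltW //.
  by rewrite -[LHS]/(f (y + v) - (0 + 0)) fy addr0 subr0.
have C : continuous (\0 : {linear 'rV[R]_n -> R^o}) by exact: cst_continuous.
by apply/diff_locallyP; rewrite (diff_unique C E).
Qed.

Lemma near_eq_differentiable f g v :
  (\near v, f v = g v) -> differentiable f v -> differentiable g v.
Proof.
move=> fg df; have -> : g = f + (g - f) by rewrite addrC subrK.
apply: differentiableD => //; apply: near0_differentiable.
by apply: filterS fg => w fgw; rewrite -[LHS]/(g w - f w) fgw subrr.
Qed.

Lemma Ck_sub k W W' f : W' `<=` W -> Ck k W f -> Ck k W' f.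
Proof.
move=> sW; elim: k f => [|k IH] f /=; first by move=> fW v /sW; exact: fW.
by move=> [df Df]; split=> [v /sW|j]; [exact: df | exact: IH].
Qed.

(** [Ck] is a condition at each point of W on derivatives of one total function, so local conditions
    glue at once. *)
Lemma Ck_local k W f :
  (forall v, W v -> exists2 W', W' v & Ck k W' f) -> Ck k W f.
Proof.
elim: k f => [|k IH] f /= fW.
  by move=> v /fW [W' W'v]; exact.
split=> [v /fW [W' W'v [df _]]|j]; first exact: df.
by apply: IH => v /fW [W' W'v [_ Df]]; exists W'.
Qed.

(** Openness of W turns equality on W into equality of germs, which passes to all partial
    derivatives. *)
Lemma Ck_eq k W f g : open W -> {in W, f =1 g} -> Ck k W f -> Ck k W g.
Proof.
move=> oW; elim: k f g => [|k IH] f g fg;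
  have N v : W v -> \near v, f v = g v by
    move=> Wv; apply: filterS (open_nbhs_nbhs (conj oW Wv)) => u Wu;
    apply: fg; rewrite inE.
  move=> fW v Wv; rewrite /prop_for /continuous_at -(fg v) ?inE //.
  exact: cvg_trans (@near_eq_cvg _ _ (nbhs v) (nbhs_filter v) _ _ (N v Wv)) (fW v Wv).
move=> [df Df]; split=> [v Wv|j].
  by apply: near_eq_differentiable (df v Wv); exact: N.
apply: IH (Df j) => v; rewrite inE => Wv; exact: near_eq_derive (N v Wv).
Qed.

Lemma CkS k W f : Ck k.+1 W f -> Ck k W f.
Proof.
elim: k f => [|k IH] f [df Df].
  by move=> v Wv; apply: differentiable_continuous; exact: df.
by split=> // j; apply: IH; exact: Df.
Qed.

Lemma Ck_cst k W a : Ck k W (cst a).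
Proof.
elim: k a => [|k IH] a /=; first by move=> v _; exact: cst_continuous.
split=> [v _|j]; first exact: differentiable_cst.
rewrite (_ : (fun _ => _) = cst 0); first exact: IH.
by apply/funext => v; rewrite derive_cst.
Qed.

Lemma Ck_add k W f g : open W -> Ck k W f -> Ck k W g -> Ck k W (f + g).
Proof.
move=> oW; elim: k f g => [|k IH] f g /=.
  by move=> fW gW v Wv; apply: continuousD; [exact: fW | exact: gW].
move=> [df Df] [dg Dg]; split=> [v Wv|j].
  by apply: differentiableD; [exact: df | exact: dg].
apply: Ck_eq (IH _ _ (Df j) (Dg j)) => // v; rewrite inE => Wv; apply/esym.
exact: (deriveD (diff_derivable (df v Wv)) (diff_derivable (dg v Wv))).
Qed.

Lemma Ck_mul k W f g : open W -> Ck k W f -> Ck k W g -> Ck k W (f * g).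
Proof.
move=> oW; elim: k f g => [|k IH] f g.
  by move=> fW gW v Wv; apply: continuousM; [exact: fW | exact: gW].
move=> fW gW; have [df Df] := fW; have [dg Dg] := gW; split=> [v Wv|j].
  by apply: differentiableM; [exact: df | exact: dg].
apply: (@Ck_eq _ _ (f * (fun v => 'D_(delta_mx 0 j) g v) +
                    g * (fun v => 'D_(delta_mx 0 j) f v))) => //.
  move=> v; rewrite inE => Wv; apply/esym.
  exact: (deriveM (diff_derivable (df v Wv)) (diff_derivable (dg v Wv))).
(* The derivative of the product still contains f and g undifferentiated; [CkS] lowers them to the
   order of the induction hypothesis. *)
by apply: Ck_add => //; apply: IH; (exact: CkS || exact: Df || exact: Dg).
Qed.

End SmoothFunctions.

(** * Smooth functions on the manifold and their derivatives *)

Section SmoothOnManifold.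
Variables (R : realType) (n : nat) (M : manifold R n).
Implicit Types (U : set M) (f g : M -> R).

Lemma chart_image_open (x : M) U : open U -> open (chart x @` (cdom x `&` U)).
Proof.
move=> oU; rewrite openE => _ [p [xp Up] <-].
have N1 : \forall v \near chart x p, (chart x @` cdom x) v.
  by apply: open_nbhs_nbhs; split; [exact: chart_im_open | exists p].
have N2 : \forall v \near chart x p, U (chinv x v).
  by apply: (chinv_cont xp); rewrite chartK //; apply: open_nbhs_nbhs.
near=> v; have [q xq qv] : (chart x @` cdom x) v by near: v.
exists q => //; split => //; rewrite -(chartK xq) qv; near: v; exact: N2.
Unshelve. all: by end_near. Qed.

Lemma rsmooth_sub U U' f : U' `<=` U -> rsmooth U f -> rsmooth U' f.
Proof.
move=> sU fU x k; apply: Ck_sub (fU x k).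
by move=> _ [p [xp /sU Up] <-]; exists p.
Qed.

Lemma rsmooth_local U f :
  (forall p, U p -> exists2 U', U' p & rsmooth U' f) -> rsmooth U f.
Proof.
move=> fU x k; apply: Ck_local => _ [p [xp /fU [U' U'p fU']] <-].
by exists (chart x @` (cdom x `&` U')); [exists p | exact: fU'].
Qed.

Lemma rsmooth_eq U f g : open U -> (forall p, U p -> f p = g p) ->
  rsmooth U f -> rsmooth U g.
Proof.
move=> oU fg fU x k; apply: Ck_eq (fU x k); first exact: chart_image_open.
by move=> v; rewrite inE => -[p [xp Up] <-] /=; rewrite chartK // fg.
Qed.

Lemma rsmooth_cst U a : rsmooth U (fun _ => a).
Proof. by move=> x k; exact: Ck_cst. Qed.

Lemma rsmoothD U f g : open U -> rsmooth U f -> rsmooth U g ->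
  rsmooth U (fun p => f p + g p).
Proof.
by move=> oU fU gU x k; apply: Ck_add; [exact: chart_image_open|exact: fU|exact: gU].
Qed.

Lemma rsmoothM U f g : open U -> rsmooth U f -> rsmooth U g ->
  rsmooth U (fun p => f p * g p).
Proof.
by move=> oU fU gU x k; apply: Ck_mul; [exact: chart_image_open|exact: fU|exact: gU].
Qed.

Lemma rsmoothN U f : open U -> rsmooth U f -> rsmooth U (fun p => - f p).
Proof.
move=> oU fU; apply: (@rsmooth_eq _ (fun p => -1 * f p)) => //.
  by move=> p _; rewrite mulN1r.
by apply: rsmoothM => //; exact: rsmooth_cst.
Qed.

Lemma rsmoothB U f g : open U -> rsmooth U f -> rsmooth U g ->
  rsmooth U (fun p => f p - g p).
Proof. by move=> oU fU gU; apply: rsmoothD => //; exact: rsmoothN. Qed.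

Lemma rsmooth_differentiable U f p : rsmooth U f -> U p ->
  differentiable (f \o chinv p : 'rV[R]_n -> R^o) (chart p p).
Proof.
move=> fU Up; have [df _] := fU p 1%N; apply: df; exists p => //.
by split=> //; exact: cdom_center.
Qed.

Lemma tder_eq U f g (p : M) v : open U -> U p -> (forall q, U q -> f q = g q) ->
  tder p v f = tder p v g.
Proof.
move=> oU Up fg; apply: near_eq_derive; have xp := @cdom_center _ _ M p.
have N : \forall w \near chart p p, U (chinv p w).
  by apply: (chinv_cont xp); rewrite chartK //; apply: open_nbhs_nbhs.
by apply: filterS N => w /= /fg.
Qed.

Lemma tder_cst (p : M) v a : tder p v (fun _ => a) = 0 :> R.
Proof. exact: derive_cst. Qed.

Lemma tderD U f g (p : M) v : rsmooth U f -> rsmooth U g -> U p ->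
  tder p v (fun q => f q + g q) = tder p v f + tder p v g.
Proof.
move=> fU gU Up; rewrite /tder -deriveD //; apply: diff_derivable;
  exact: rsmooth_differentiable Up.
Qed.

Lemma tderM U f g (p : M) v : rsmooth U f -> rsmooth U g -> U p ->
  tder p v (fun q => f q * g q) = f p * tder p v g + g p * tder p v f.
Proof.
move=> fU gU Up; have xp := @cdom_center _ _ M p.
rewrite /tder [LHS](deriveM (diff_derivable (rsmooth_differentiable fU Up))
  (diff_derivable (rsmooth_differentiable gU Up))) /=.
by rewrite chartK.
Qed.

Lemma tder0 f (p : M) : tder p 0 f = 0.
Proof. exact: derive0. Qed.

End SmoothOnManifold.

(** * Sheaves of sections *)

Section ComplexSmooth.
Variables (R : realType) (n : nat) (M : manifold R n).
Implicit Types (U : set M) (f g : M -> complex R).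

Lemma csmooth_sub U U' f : U' `<=` U -> csmooth U f -> csmooth U' f.
Proof. by move=> sU [fr fi]; split; apply: rsmooth_sub sU _. Qed.

Lemma csmooth_eq U f g : open U -> (forall p, U p -> f p = g p) ->
  csmooth U f -> csmooth U g.
Proof.
by move=> oU fg [fr fi]; split; [apply: rsmooth_eq oU _ fr|apply: rsmooth_eq oU _ fi]
  => p Up; rewrite fg.
Qed.

Lemma csmooth_cst U a : csmooth U (fun _ => a).
Proof. by split; exact: rsmooth_cst. Qed.

Lemma csmoothD U f g : open U -> csmooth U f -> csmooth U g ->
  csmooth U (fun p => f p + g p).
Proof.
move=> oU [fr fi] [gr gi]; split.
  apply: (rsmooth_eq _ _ (rsmoothD oU fr gr)) => // p _.
  by case: (f p) (g p) => [? ?] [].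
apply: (rsmooth_eq _ _ (rsmoothD oU fi gi)) => // p _.
by case: (f p) (g p) => [? ?] [].
Qed.

Lemma csmoothM U f g : open U -> csmooth U f -> csmooth U g ->
  csmooth U (fun p => f p * g p).
Proof.
move=> oU [fr fi] [gr gi]; split.
  apply: (rsmooth_eq _ _ (rsmoothB oU (rsmoothM oU fr gr) (rsmoothM oU fi gi))) => // p _.
  by case: (f p) (g p) => [? ?] [].
apply: (rsmooth_eq _ _ (rsmoothD oU (rsmoothM oU fr gi) (rsmoothM oU fi gr))) => // p _.
by case: (f p) (g p) => [? ?] [].
Qed.

Lemma csmoothN U f : open U -> csmooth U f -> csmooth U (fun p => - f p).
Proof.
move=> oU fU; apply: (csmooth_eq _ _ (csmoothM oU (csmooth_cst U (-1)) fU)) => // p _.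
by rewrite mulN1r.
Qed.

Lemma csmooth_sum U (I : Type) (r : seq I) (f : I -> M -> complex R) : open U ->
  (forall i, csmooth U (f i)) -> csmooth U (fun p => \sum_(i <- r) f i p).
Proof.
move=> oU fU; elim: r => [|i r IH].
  apply: (csmooth_eq _ _ (csmooth_cst U 0)) => // p _.
  by rewrite big_nil.
apply: (csmooth_eq _ _ (csmoothD oU (fU i) IH)) => // p _.
by rewrite big_cons.
Qed.

End ComplexSmooth.

Section SectionSheaves.
Variables (R : realType) (n : nat) (M : manifold R n).

(* The sections smooth over open sets form a sheaf of modules over ksm; as
   sections are total functions, restriction is inclusion. *)
Record section_sheaf (K : nzRingType) (ksm : set M -> (M -> K) -> Prop)
    (F : bundle M K) : Prop := SectionSheaf {
  bsm_sub : forall U U' s, U' `<=` U -> bsm F U s -> bsm F U' s;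
  bsm_local : forall U s,
    (forall p, U p -> exists2 U', U' p & bsm F U' s) -> bsm F U s;
  bsm_eq : forall U s s', open U -> (forall p, U p -> s p = s' p) ->
    bsm F U s -> bsm F U s';
  bsm0 : forall U, bsm F U (fun _ => 0);
  bsmD : forall U s s', open U -> bsm F U s -> bsm F U s' ->
    bsm F U (fun p => s p + s' p);
  bsmZ : forall U f s, open U -> ksm U f -> bsm F U s ->
    bsm F U (fun p => f p *: s p) }.

Lemma fcoordD r (E : framed M r) x q i : {morph fcoord E x q i : u v / u + v}.
Proof. by move=> u v; exact: linearD. Qed.

Lemma fcoordZ r (E : framed M r) x q i a u :
  fcoord E x q i (a *: u) = a * fcoord E x q i u.
Proof. exact: linearZ. Qed.

Lemma framed_sheaf r (E : framed M r) : (forall x, open (fdom E x)) ->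
  section_sheaf (@rsmooth R n M) (bundle_of E).
Proof.
move=> oE; split=> /=.
- by move=> U U' s sU sm x i; apply: rsmooth_sub (sm x i) => p [/sU].
- move=> U s sm x i; apply: rsmooth_local => p [/sm [U' U'p sm'] xp].
  by exists (U' `&` fdom E x).
- move=> U s s' oU ss' sm x i; apply: rsmooth_eq (sm x i); first exact: openI.
  by move=> p [Up _]; rewrite ss'.
- move=> U x i; rewrite [X in rsmooth _ X](_ : _ = fun _ => 0); first exact: rsmooth_cst.
  by apply/funext => p; rewrite /fcoord linear0.
- move=> U s s' oU sm sm' x i; have oUx : open (U `&` fdom E x) by exact: openI.
  by apply: (rsmooth_eq _ _ (rsmoothD oUx (sm x i) (sm' x i))) => // p _; rewrite fcoordD.
- move=> U f s oU fU sm x i; have oUx : open (U `&` fdom E x) by exact: openI.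
  have fU' : rsmooth (U `&` fdom E x) f by apply: rsmooth_sub fU => p [].
  by apply: (rsmooth_eq _ _ (rsmoothM oUx fU' (sm x i))) => // p _; rewrite fcoordZ.
Qed.

Lemma vbundle_sheaf r (E : vbundle M r) : section_sheaf (@rsmooth R n M) E.
Proof. by apply: framed_sheaf => x; exact: fdom_open. Qed.

Lemma section_sheafN (K : nzRingType) ksm (F : bundle M K) U s : section_sheaf ksm F ->
  ksm U (fun _ => -1) -> open U -> bsm F U s -> bsm F U (fun p => - s p).
Proof.
move=> hF k1 oU sm; apply: (bsm_eq hF _ _ (bsmZ hF oU k1 sm)) => // p _.
by rewrite scaleN1r.
Qed.

Lemma section_sheafB (K : nzRingType) ksm (F : bundle M K) U s s' : section_sheaf ksm F ->
  ksm U (fun _ => -1) -> open U -> bsm F U s -> bsm F U s' ->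
  bsm F U (fun p => s p - s' p).
Proof.
by move=> hF k1 oU sm sm'; apply: (bsmD hF) => //;
  exact: section_sheafN hF k1 oU sm'. Qed.

Lemma cplxb_sheaf (F : bundle M R) : section_sheaf (@rsmooth R n M) F ->
  section_sheaf (@csmooth R n M) (cplxb F).
Proof.
move=> hF; split=> /=.
- by move=> U U' s sU [sr si]; split; apply: (bsm_sub hF) sU _.
- move=> U s sm; split; apply: (bsm_local hF) => p /sm [U' U'p [sr si]];
  by exists U'.
- move=> U s s' oU ss' [sr si]; split;
    [apply: (bsm_eq hF) sr | apply: (bsm_eq hF) si] => //;
  by move=> p Up; rewrite ss'.
- by move=> U; split; exact: (bsm0 hF).
- by move=> U s s' oU [sr si] [sr' si']; split; apply: (bsmD hF).
- move=> U f s oU [fr fi] [sr si]; split.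
    by apply: (section_sheafB hF) => //;
      [exact: rsmooth_cst|apply: (bsmZ hF)|apply: (bsmZ hF)].
  by apply: (bsmD hF) => //; apply: (bsmZ hF).
Qed.

Lemma sumb_sheaf (K : nzRingType) ksm (F G : bundle M K) : section_sheaf ksm F ->
  section_sheaf ksm G -> section_sheaf ksm (sumb F G).
Proof.
move=> hF hG; split=> /=.
- by move=> U U' s sU [sr si]; split; [apply: (bsm_sub hF) sU _|apply: (bsm_sub hG) sU _].
- move=> U s sm; split; [apply: (bsm_local hF) | apply: (bsm_local hG)];
  by move=> p /sm [U' U'p [sr si]]; exists U'.
- move=> U s s' oU ss' [sr si]; split;
    [apply: (bsm_eq hF) sr | apply: (bsm_eq hG) si] => //;
  by move=> p Up; rewrite ss'.
- by move=> U; split; [exact: (bsm0 hF) | exact: (bsm0 hG)].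
- by move=> U s s' oU [sr si] [sr' si']; split; [apply: (bsmD hF)|apply: (bsmD hG)].
- by move=> U f s oU fU [sr si]; split; [apply: (bsmZ hF)|apply: (bsmZ hG)].
Qed.

Lemma weightb_sheaf r (V : framed M r) chi (K : comNzRingType)
    (j : {rmorphism R -> K}) ksm (F : bundle M K) :
  (forall U U' f, U' `<=` U -> ksm U f -> ksm U' f) ->
  (forall x, open (fdom V x)) -> section_sheaf ksm F ->
  section_sheaf ksm (weightb V chi j F).
Proof.
move=> ksub oV hF; split=> /=.
- by move=> U U' s sU sm x; apply: (bsm_sub hF) (sm x) => p [/sU].
- move=> U s sm x; apply: (bsm_local hF) => p [/sm [U' U'p sm'] xp].
  by exists (U' `&` fdom V x).
- move=> U s s' oU ss' sm x; apply: (bsm_eq hF) (sm x); first exact: openI.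
  by move=> p [Up _]; rewrite ss'.
- by move=> U x; exact: (bsm0 hF).
- by move=> U s s' oU sm sm' x; apply: (bsmD hF); [exact: openI|exact: sm|exact: sm'].
- move=> U f s oU fU sm x; apply: (bsmZ hF); [exact: openI| |exact: sm].
  by apply: ksub fU => p [].
Qed.

End SectionSheaves.

(** * The ring of functions and the modules of sections over a fixed open set *)

Section TypedSections.
Variables (R : realType) (n : nat) (M : manifold R n).
Let K := complex R.

(** Openness and the sheaf property are bundled with their carriers, so that the ring and module
    structures below can be attached to types. *)
Record odom := ODom { oset :> set M; oset_open : open oset }.
Record cbundle := CBundle {
  cbundle_val :> bundle M K;
  cbundleP : section_sheaf (@csmooth R n M) cbundle_val }.

(* Functions and sections over W are represented by their extension by 0, so
   that equality over W is Leibniz equality. *)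
Record ofun (W : odom) := OFun {
  ofun_val :> M -> K;
  ofun_smooth : csmooth W ofun_val;
  ofun_out : forall p, ~ oset W p -> ofun_val p = 0 }.

Record gsec (F : cbundle) (W : odom) := GSec {
  gsec_val :> forall p, bfib F p;
  gsec_smooth : bsm F W gsec_val;
  gsec_out : forall p, ~ oset W p -> gsec_val p = 0 }.

Lemma ofun_eq W (f g : ofun W) : (forall p, oset W p -> f p = g p) -> f = g.
Proof.
case: f g => [f fs fo] [g gs go] /= fg.
have {}fg : f = g.
  apply/funext => p; have [Wp|Wp] := pselect (oset W p); first exact: fg.
  by rewrite fo // go.
by case: _ / fg gs go => gs go; congr OFun; exact: Prop_irrelevance.
Qed.

Lemma gsec_eq F W (s t : gsec F W) : (forall p, oset W p -> s p = t p) -> s = t.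
Proof.
case: s t => [s ss so] [t ts to'] /= st.
have {}st : s = t.
  apply: functional_extensionality_dep => p.
  by have [Wp|Wp] := pselect (oset W p); [exact: st | rewrite so // to'].
by case: _ / st ts to' => ts to'; congr GSec; exact: Prop_irrelevance.
Qed.

Section OfunRing.
Variable W : odom.
Let oW := oset_open W.
Implicit Types f g : ofun W.

HB.instance Definition _ := gen_eqMixin (ofun W).
HB.instance Definition _ := gen_choiceMixin (ofun W).

Definition ofun0 : ofun W :=
  OFun (csmooth_cst W 0) (fun _ _ => erefl).

(** Extension by 0 forces the unit to be the indicator function of W. *)
Lemma ofun1_smooth : csmooth W (fun p => (`[< oset W p >])%:R : K).
Proof.
by apply: (csmooth_eq _ _ (csmooth_cst W 1)) => // p Wp; rewrite asboolT.
Qed.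

Lemma ofun1_out p : ~ oset W p -> (`[< oset W p >])%:R = 0 :> K.
Proof. by move=> Wp; rewrite asboolF. Qed.

Definition ofun1 : ofun W := OFun ofun1_smooth ofun1_out.

Lemma ofunD_out f g p : ~ oset W p -> f p + g p = 0.
Proof. by move=> Wp; rewrite !ofun_out // addr0. Qed.

Definition ofunD f g : ofun W :=
  OFun (csmoothD oW (ofun_smooth f) (ofun_smooth g)) (@ofunD_out f g).

Lemma ofunN_out f p : ~ oset W p -> - f p = 0.
Proof. by move=> Wp; rewrite ofun_out // oppr0. Qed.

Definition ofunN f : ofun W :=
  OFun (csmoothN oW (ofun_smooth f)) (@ofunN_out f).

Lemma ofunM_out f g p : ~ oset W p -> f p * g p = 0.
Proof. by move=> Wp; rewrite ofun_out // mul0r. Qed.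

Definition ofunM f g : ofun W :=
  OFun (csmoothM oW (ofun_smooth f) (ofun_smooth g)) (@ofunM_out f g).

Lemma ofunDA : associative ofunD.
Proof. by move=> f g h; apply: ofun_eq => p _; exact: addrA. Qed.
Lemma ofunDC : commutative ofunD.
Proof. by move=> f g; apply: ofun_eq => p _; exact: addrC. Qed.
Lemma ofun0D : left_id ofun0 ofunD.
Proof. by move=> f; apply: ofun_eq => p _; exact: add0r. Qed.
Lemma ofunND : left_inverse ofun0 ofunN ofunD.
Proof. by move=> f; apply: ofun_eq => p _; exact: addNr. Qed.

HB.instance Definition _ :=
  GRing.isZmodule.Build (ofun W) ofunDA ofunDC ofun0D ofunND.

Lemma ofunMA : associative ofunM.
Proof. by move=> f g h; apply: ofun_eq => p _; exact: mulrA. Qed.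
Lemma ofunMC : commutative ofunM.
Proof. by move=> f g; apply: ofun_eq => p _; exact: mulrC. Qed.
Lemma ofun1M : left_id ofun1 ofunM.
Proof. by move=> f; apply: ofun_eq => p Wp; rewrite /= asboolT // mul1r. Qed.
Lemma ofunDM : left_distributive ofunM ofunD.
Proof. by move=> f g h; apply: ofun_eq => p _; exact: mulrDl. Qed.

(** Over the empty set 1 = 0, hence a ring that may be zero. *)
HB.instance Definition _ :=
  GRing.Zmodule_isComPzRing.Build (ofun W) ofunMA ofunMC ofun1M ofunDM.

End OfunRing.

Section GsecModule.
Variables (F : cbundle) (W : odom).
Let oW := oset_open W.
Let hF := cbundleP F.
Implicit Types s t : gsec F W.

HB.instance Definition _ := gen_eqMixin (gsec F W).
HB.instance Definition _ := gen_choiceMixin (gsec F W).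

Definition gsec0 : gsec F W := GSec (bsm0 hF W) (fun _ _ => erefl).

Lemma gsecD_out s t p : ~ oset W p -> s p + t p = 0.
Proof. by move=> Wp; rewrite !gsec_out // addr0. Qed.

Definition gsecD s t : gsec F W :=
  GSec (bsmD hF oW (gsec_smooth s) (gsec_smooth t)) (@gsecD_out s t).

Lemma gsecN_out s p : ~ oset W p -> - s p = 0.
Proof. by move=> Wp; rewrite gsec_out // oppr0. Qed.

Definition gsecN s : gsec F W :=
  GSec (section_sheafN hF (csmooth_cst W (-1)) oW (gsec_smooth s)) (@gsecN_out s).

Lemma gsecZ_out (f : ofun W) s p : ~ oset W p -> f p *: s p = 0.
Proof. by move=> Wp; rewrite gsec_out // scaler0. Qed.

Definition gsecZ (f : ofun W) s : gsec F W :=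
  GSec (bsmZ hF oW (ofun_smooth f) (gsec_smooth s)) (@gsecZ_out f s).

Lemma gsecDA : associative gsecD.
Proof. by move=> f g h; apply: gsec_eq => p _; exact: addrA. Qed.
Lemma gsecDC : commutative gsecD.
Proof. by move=> f g; apply: gsec_eq => p _; exact: addrC. Qed.
Lemma gsec0D : left_id gsec0 gsecD.
Proof. by move=> f; apply: gsec_eq => p _; exact: add0r. Qed.
Lemma gsecND : left_inverse gsec0 gsecN gsecD.
Proof. by move=> f; apply: gsec_eq => p _; exact: addNr. Qed.

HB.instance Definition _ :=
  GRing.isZmodule.Build (gsec F W) gsecDA gsecDC gsec0D gsecND.

Lemma gsecZA f g s : gsecZ f (gsecZ g s) = gsecZ (f * g) s.
Proof. by apply: gsec_eq => p _; exact: scalerA. Qed.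
Lemma gsec1Z : left_id 1 gsecZ.
Proof. by move=> s; apply: gsec_eq => p Wp; rewrite /= asboolT // scale1r. Qed.
Lemma gsecZDr : right_distributive gsecZ +%R.
Proof. by move=> f s t; apply: gsec_eq => p _; exact: scalerDr. Qed.
Lemma gsecZDl s : {morph gsecZ^~ s : f g / f + g}.
Proof. by move=> f g; apply: gsec_eq => p _; exact: scalerDl. Qed.

HB.instance Definition _ := GRing.Zmodule_isLmodule.Build (ofun W) (gsec F W)
  gsecZA gsec1Z gsecZDr gsecZDl.

Lemma gsecDE s t p : (s + t) p = s p + t p. Proof. by []. Qed.
Lemma gsecNE s p : (- s) p = - s p. Proof. by []. Qed.
Lemma gsecZE (f : ofun W) s p : (f *: s) p = f p *: s p. Proof. by []. Qed.

Lemma gsec_sumE (I : Type) (r : seq I) (P : pred I) (s : I -> gsec F W) p :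
  (\sum_(i <- r | P i) s i) p = \sum_(i <- r | P i) s i p.
Proof. by elim/big_rec2: _ => // i y x _ <-. Qed.

Section Truncation.
Variables (s : sect F) (sm : bsm F W s).

(** The cut-off may jump at the boundary of W; smoothness is required over W only. *)
Definition trunc : sect F := fun p => if `[< oset W p >] then s p else 0.

Lemma trunc_in p : oset W p -> trunc p = s p.
Proof. by move=> Wp; rewrite /trunc asboolT. Qed.

Lemma trunc_smooth : bsm F W trunc.
Proof. by apply: (bsm_eq hF) sm => // p Wp; rewrite trunc_in. Qed.

Lemma trunc_out p : ~ oset W p -> trunc p = 0.
Proof. by move=> Wp; rewrite /trunc asboolF. Qed.

Definition gtr : gsec F W := GSec trunc_smooth trunc_out.

Lemma gtrE p : oset W p -> gtr p = s p. Proof. exact: trunc_in. Qed.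
End Truncation.

End GsecModule.

Section OfunTruncation.
Variables (W : odom) (f : M -> K) (fs : csmooth W f).

Definition ftrunc : M -> K := fun p => if `[< oset W p >] then f p else 0.

Lemma ftrunc_in p : oset W p -> ftrunc p = f p.
Proof. by move=> Wp; rewrite /ftrunc asboolT. Qed.

Lemma ftrunc_smooth : csmooth W ftrunc.
Proof.
by apply: csmooth_eq fs; [exact: oset_open | move=> p Wp; rewrite ftrunc_in].
Qed.

Lemma ftrunc_out p : ~ oset W p -> ftrunc p = 0.
Proof. by move=> Wp; rewrite /ftrunc asboolF. Qed.

Definition otr : ofun W := OFun ftrunc_smooth ftrunc_out.

Lemma otrE p : oset W p -> otr p = f p. Proof. exact: ftrunc_in. Qed.
End OfunTruncation.

End TypedSections.

(** * Connections and derivations of functions *)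

Section CplxConn.
Variables (R : realType) (n : nat) (M : manifold R n).
Variables (A F : bundle M R) (act : sect A -> (M -> R) -> M -> R).
Variable D : sect A -> sect F -> sect F.
Hypothesis hA : section_sheaf (@rsmooth R n M) A.
Hypothesis hF : section_sheaf (@rsmooth R n M) F.
Hypothesis hD : is_connection (@rsmooth R n M) act D.

Lemma conn_subr U e s s' : open U -> bsm A U e -> bsm F U s -> bsm F U s' ->
  forall p, U p -> D e (fun q => s q - s' q) p = D e s p - D e s' p.
Proof.
move=> oU eU sU s'U p Up.
have dU := section_sheafB hF (rsmooth_cst U (-1)) oU sU s'U.
apply/eqP; rewrite eq_sym subr_eq -(conn_addr hD oU eU dU s'U Up); apply/eqP.
congr (D e _ p); apply: functional_extensionality_dep => q; by rewrite subrK.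
Qed.

Lemma conn_subl U e e' s : open U -> bsm A U e -> bsm A U e' -> bsm F U s ->
  forall p, U p -> D (fun q => e q - e' q) s p = D e s p - D e' s p.
Proof.
move=> oU eU e'U sU p Up.
have dU := section_sheafB hA (rsmooth_cst U (-1)) oU eU e'U.
apply/eqP; rewrite eq_sym subr_eq -(conn_addl hD oU dU e'U sU Up); apply/eqP.
congr (D _ s p); apply: functional_extensionality_dep => q; by rewrite subrK.
Qed.

(** A clause for complex sections recombines the clauses of D for real and imaginary parts. In the
    last two clauses, multiplication by f is split into real products before D is applied. *)
Lemma cplx_connection :
  is_connection (A := cplxb A) (F := cplxb F) (@csmooth R n M) (cplx_act act)
    (cplx_conn D).
Proof.
have k1 U : rsmooth U (fun _ : M => -1 : R) by exact: rsmooth_cst.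
split.
- move=> U e s oU [er ei] [sr si]; split.
    by apply: (section_sheafB hF) => //; exact: (conn_smooth hD).
  by apply: (bsmD hF) => //; exact: (conn_smooth hD).
- move=> U e e' s s' oU [er ei] [er' ei'] [sr si] [sr' si'] ee ss p Up.
  have eer q : U q -> (e q).1 = (e' q).1 by move=> /ee ->.
  have eei q : U q -> (e q).2 = (e' q).2 by move=> /ee ->.
  have ssr q : U q -> (s q).1 = (s' q).1 by move=> /ss ->.
  have ssi q : U q -> (s q).2 = (s' q).2 by move=> /ss ->.
  congr pair; congr (_ + _); [|congr (- _)| |]; exact: (conn_local hD oU).
- move=> U e e' s oU [er ei] [er' ei'] [sr si] p Up; congr pair.
    rewrite [LHS](congr2 (fun x y => x - y) (conn_addl hD oU er er' sr Up)
      (conn_addl hD oU ei ei' si Up)).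
    by rewrite opprD addrACA.
  rewrite [LHS](congr2 (fun x y => x + y) (conn_addl hD oU er er' si Up)
      (conn_addl hD oU ei ei' sr Up)).
  by rewrite addrACA.
- move=> U e s s' oU [er ei] [sr si] [sr' si'] p Up; congr pair.
    rewrite [LHS](congr2 (fun x y => x - y) (conn_addr hD oU er sr sr' Up)
      (conn_addr hD oU ei si si' Up)).
    by rewrite opprD addrACA.
  rewrite [LHS](congr2 (fun x y => x + y) (conn_addr hD oU er si si' Up)
      (conn_addr hD oU ei sr sr' Up)).
  by rewrite addrACA.
- move=> U f e s oU [fr fi] [er ei] [sr si] p Up.
  have Dr t : bsm F U t -> D (fun q => (f q *: e q).1) t p =
      complex.Re (f p) *: D (fun q => (e q).1) t p
      - complex.Im (f p) *: D (fun q => (e q).2) t p.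
    move=> tU; rewrite [LHS](conn_subl oU (bsmZ hA oU fr er) (bsmZ hA oU fi ei) tU Up).
    by rewrite !(conn_scalel hD oU _ _ tU Up).
  have Di t : bsm F U t -> D (fun q => (f q *: e q).2) t p =
      complex.Re (f p) *: D (fun q => (e q).2) t p
      + complex.Im (f p) *: D (fun q => (e q).1) t p.
    move=> tU; rewrite [LHS](conn_addl hD oU (bsmZ hA oU fr ei) (bsmZ hA oU fi er) tU Up).
    by rewrite !(conn_scalel hD oU _ _ tU Up).
  rewrite /cplx_conn !Dr // !Di //.
  congr pair; rewrite !(scalerDr, scalerN, opprD, opprK) /=.
    by rewrite [LHS](AC (2*2) (1*3*(4*2))).
  
  by rewrite [LHS](AC (2*2) (1*3*(4*2))).
  
- move=> U f e s oU [fr fi] [er ei] [sr si] p Up.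
  have Dr a : bsm A U a -> D a (fun q => (f q *: s q).1) p =
      act a (fun q => complex.Re (f q)) p *: (s p).1
      + complex.Re (f p) *: D a (fun q => (s q).1) p
      - (act a (fun q => complex.Im (f q)) p *: (s p).2
      + complex.Im (f p) *: D a (fun q => (s q).2) p).
    move=> aU; rewrite [LHS](conn_subr oU aU (bsmZ hF oU fr sr) (bsmZ hF oU fi si) Up).
    by rewrite !(conn_leibniz hD oU _ aU _ Up).
  have Di a : bsm A U a -> D a (fun q => (f q *: s q).2) p =
      act a (fun q => complex.Re (f q)) p *: (s p).2
      + complex.Re (f p) *: D a (fun q => (s q).2) p
      + (act a (fun q => complex.Im (f q)) p *: (s p).1
      + complex.Im (f p) *: D a (fun q => (s q).1) p).
    move=> aU; rewrite [LHS](conn_addr hD oU aU (bsmZ hF oU fr si) (bsmZ hF oU fi sr) Up).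
    by rewrite !(conn_leibniz hD oU _ aU _ Up).
  rewrite /cplx_conn !Dr // !Di //.
  congr pair; rewrite /= !(scalerDr, scalerDl, scalerN, scaleNr, opprD, opprK).
    by rewrite [LHS](AC ((2*2)*(2*2)) ((1*7)*(3*5)*((2*6)*(4*8)))).
  by rewrite [LHS](AC ((2*2)*(2*2)) ((1*7)*(3*5)*((2*6)*(4*8)))).
Qed.

End CplxConn.

(** * The derivation of functions given by the anchor *)

Section CourantAction.
Variables (R : realType) (n : nat) (M : manifold R n) (m : nat).
Variables (E : vbundle M m) (C : courant E).

Lemma frame_section_smooth x i U : U `<=` fdom E x ->
  bsm E U (fun q => tnth (frame E x q) i).
Proof.
move=> Ux y j; apply: rsmooth_sub (@frame_smooth _ _ _ _ E x y i j) => p [/Ux].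
by split.
Qed.

(** By the Leibniz rule, [ader C e f] times a frame section F is [D e (f F) - f D e F], which is
    smooth as D preserves smoothness; its coordinate along F is [ader C e f]. *)
Lemma ader_smooth (D : sect E -> sect E -> sect E) U e f :
  is_rconnection C D -> open U -> bsm E U e -> rsmooth U f ->
  rsmooth U (ader C e f).
Proof.
move=> hD oU eU fU; have hE := vbundle_sheaf E.
apply: rsmooth_local => x Ux; exists (U `&` fdom E x).
  by split=> //; exact: fdom_center.
have oV : open (U `&` fdom E x) by apply: openI => //; exact: fdom_open.
have VU : U `&` fdom E x `<=` U by move=> p [].
have eV := bsm_sub hE VU eU; have fV := rsmooth_sub VU fU.
(* In rank 0 there is no frame section F, but then e vanishes and so does the derivative. *)
have [m0|] := eqVneq m 0%N.
  apply: (rsmooth_eq _ _ (rsmooth_cst _ 0)) => // p [_ xp].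
  have e0 : e p = 0.
    rewrite (coord_basis (frame_basis xp) (memvf (e p))) big1 // => -[i im].
    by exfalso; move: im; rewrite m0.
  by rewrite /ader /vfder e0 linear0 tder0.
rewrite -lt0n => m0; pose i := Ordinal m0.
pose F : sect E := fun q => tnth (frame E x q) i.
have FV : bsm E (U `&` fdom E x) F by apply: frame_section_smooth => p [].
have dV : bsm E (U `&` fdom E x)
    (fun p => D e (fun q => f q *: F q) p - f p *: D e F p).
  apply: (section_sheafB hE) => //; first exact: rsmooth_cst.
    by apply: (conn_smooth hD) => //; exact: (bsmZ hE).
  by apply: (bsmZ hE) => //; exact: (conn_smooth hD).
have := dV x i; rewrite -setIA setIid => /rsmooth_eq; apply => // p Vp.
rewrite (conn_leibniz hD oV fV eV FV Vp) addrK fcoordZ.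
have [_ xp] := Vp; rewrite /fcoord /F (tnth_nth 0) coord_free ?eqxx ?mulr1 //.
exact: basis_free (frame_basis xp).
Qed.

Lemma ader_eq U e e' f g p : open U -> U p -> e p = e' p ->
  (forall q, U q -> f q = g q) -> ader C e f p = ader C e' g p.
Proof. by move=> oU Up ee fg; rewrite /ader /vfder ee; exact: tder_eq fg. Qed.

Lemma aderD U e f g p : U p -> rsmooth U f -> rsmooth U g ->
  ader C e (fun q => f q + g q) p = ader C e f p + ader C e g p.
Proof. by move=> Up fU gU; exact: tderD Up. Qed.

Lemma aderM U e f g p : U p -> rsmooth U f -> rsmooth U g ->
  ader C e (fun q => f q * g q) p = f p * ader C e g p + g p * ader C e f p.
Proof. by move=> Up fU gU; exact: tderM Up. Qed.

Lemma ader_cst e a p : ader C e (fun _ => a) p = 0.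
Proof. exact: tder_cst. Qed.

Lemma aderN U e f p : U p -> open U -> rsmooth U f ->
  ader C e (fun q => - f q) p = - ader C e f p.
Proof.
move=> Up oU fU; apply/eqP; rewrite -subr_eq0 opprK.
rewrite -(aderD _ Up (rsmoothN oU fU) fU) -(ader_cst e 0 p); apply/eqP.
by apply: (ader_eq oU) => // q _; rewrite addNr.
Qed.

Lemma aderB U e f g p : U p -> open U -> rsmooth U f -> rsmooth U g ->
  ader C e (fun q => f q - g q) p = ader C e f p - ader C e g p.
Proof.
by move=> Up oU fU gU; rewrite (aderD _ Up fU (rsmoothN oU gU)) (aderN _ Up oU gU).
Qed.

Let cact := cplx_act (ader C).

Lemma cact_smooth (D : sect E -> sect E -> sect E) U e f :
  is_rconnection C D -> open U -> bsm (cplxb E) U e -> csmooth U f ->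
  csmooth U (cact e f).
Proof.
move=> hD oU [er ei] [fr fi].
by split; [apply: rsmoothB => //|apply: rsmoothD => //]; exact: ader_smooth hD _ _ _.
Qed.

Lemma cact_eq U e e' f g p : open U -> U p -> e p = e' p ->
  (forall q, U q -> f q = g q) -> cact e f p = cact e' g p.
Proof.
move=> oU Up ee fg.
have ee1 : (e p).1 = (e' p).1 by rewrite ee.
have ee2 : (e p).2 = (e' p).2 by rewrite ee.
have fg1 q : U q -> complex.Re (f q) = complex.Re (g q) by move=> /fg ->.
have fg2 q : U q -> complex.Im (f q) = complex.Im (g q) by move=> /fg ->.
rewrite /cact /cplx_act.
by congr ((_ - _) +i* (_ + _))%C; apply: (ader_eq oU).
Qed.

Lemma cact_cst e a p : cact e (fun _ => a) p = 0.
Proof. by rewrite /cact /cplx_act !ader_cst subr0 addr0. Qed.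

Lemma cactD U e f g p : U p -> open U -> csmooth U f -> csmooth U g ->
  cact e (fun q => f q + g q) p = cact e f p + cact e g p.
Proof.
move=> Up oU [fr fi] [gr gi].
have Rr q : complex.Re (f q + g q) = complex.Re (f q) + complex.Re (g q).
  by case: (f q) (g q) => [? ?] [].
have Ri q : complex.Im (f q + g q) = complex.Im (f q) + complex.Im (g q).
  by case: (f q) (g q) => [? ?] [].
rewrite /cact /cplx_act (funext Rr) (funext Ri).
rewrite !(aderD _ Up fr gr) !(aderD _ Up fi gi).
by congr (_ +i* _)%C; rewrite ?opprD addrACA.
Qed.

Lemma cactM U e f g p : U p -> open U -> csmooth U f -> csmooth U g ->
  cact e (fun q => f q * g q) p = cact e f p * g p + f p * cact e g p.
Proof.
move=> Up oU [fr fi] [gr gi].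
have Rr q : complex.Re (f q * g q) = complex.Re (f q) * complex.Re (g q)
    - complex.Im (f q) * complex.Im (g q).
  by case: (f q) (g q) => [? ?] [].
have Ri q : complex.Im (f q * g q) = complex.Re (f q) * complex.Im (g q)
    + complex.Im (f q) * complex.Re (g q).
  by case: (f q) (g q) => [? ?] [].
rewrite /cact /cplx_act (funext Rr) (funext Ri).
rewrite !(aderB _ Up oU (rsmoothM oU fr gr) (rsmoothM oU fi gi)).
rewrite !(aderD _ Up (rsmoothM oU fr gi) (rsmoothM oU fi gr)).
rewrite !(aderM _ Up fr gr) !(aderM _ Up fi gi) !(aderM _ Up fr gi) !(aderM _ Up fi gr).
case: (f p) (g p) => [f1 f2] [g1 g2]; apply/eqP; rewrite eq_complex /=.
do !move: (ader C _ _ p) => ?.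
by apply/andP; split; apply/eqP; ring.
Qed.

End CourantAction.

(** * Connections as operations on modules of sections *)

Section TypedConnection.
Variables (R : realType) (n : nat) (M : manifold R n).
Variables (A F : cbundle M) (act : sect A -> (M -> complex R) -> M -> complex R).
Variable D : sect A -> sect F -> sect F.
Hypothesis act_smooth : forall U e f, open U -> bsm A U e -> csmooth U f ->
  csmooth U (act e f).
Hypothesis hD : is_connection (@csmooth R n M) act D.
Variable W : odom M.
Implicit Types (X : gsec A W) (s : gsec F W) (f : ofun W).

Definition tact X f : ofun W :=
  otr (act_smooth (oset_open W) (gsec_smooth X) (ofun_smooth f)).

Definition tconn X s : gsec F W :=
  gtr (conn_smooth hD (oset_open W) (gsec_smooth X) (gsec_smooth s)).

Lemma tconnE X s p : oset W p -> tconn X s p = D (gsec_val X) (gsec_val s) p.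
Proof. exact: gtrE. Qed.

Lemma tactE X f p : oset W p -> tact X f p = act (gsec_val X) (ofun_val f) p.
Proof. exact: otrE. Qed.

(** Together with [tconnr], this has exactly the shape of the hypotheses [connl], [connr], [scl] and
    [scr] of the abstract iteration. *)
Lemma tconnl f X X' s : tconn (f *: X + X') s = f *: tconn X s + tconn X' s.
Proof.
have oW := oset_open W; apply: gsec_eq => p Wp.
rewrite gsecDE gsecZE !tconnE //.
rewrite [LHS](conn_addl hD oW (gsec_smooth (f *: X)) (gsec_smooth X')
  (gsec_smooth s) Wp).
by rewrite [X in X + _](conn_scalel hD oW (ofun_smooth f) (gsec_smooth X)
  (gsec_smooth s) Wp).
Qed.

Lemma tconnr X f s s' :
  tconn X (f *: s + s') = tact X f *: s + f *: tconn X s + tconn X s'.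
Proof.
have oW := oset_open W; apply: gsec_eq => p Wp.
rewrite !gsecDE !gsecZE !tconnE // tactE //.
rewrite [LHS](conn_addr hD oW (gsec_smooth X) (gsec_smooth (f *: s))
  (gsec_smooth s') Wp).
by rewrite [X in X + _](conn_leibniz hD oW (ofun_smooth f) (gsec_smooth X)
  (gsec_smooth s) Wp).
Qed.

End TypedConnection.

(** * The direct sum connection and the superconnection A *)

Section Superconnection.
Variables (R : realType) (n : nat) (M : manifold R n) (m : nat).
Variables (EB EF : vbundle M m) (CB : courant EB) (CF : courant EF).
Variable iota : forall p, 'Hom(EB p, EF p).
Variable DB : sect EB -> sect EB -> sect EB.
Variable SS : bundle M (complex R).
Variable cl : forall p, cplx (EF p) -> bfib SS p -> bfib SS p.
Variable DS : sect (cplxb EF) -> sect SS -> sect SS.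
Hypothesis iotaP : is_courant_iso CB CF iota.
Hypothesis DBP : is_rconnection CB DB.
Hypothesis SSP : section_sheaf (@csmooth R n M) SS.
Hypothesis DSP : is_cconnection CF DS.
Hypothesis cl_smooth : forall U z t, open U -> bsm (cplxb EF) U z ->
  bsm SS U t -> bsm SS U (fun p => cl (z p) (t p)).
Hypothesis cll : forall p a (z z' : cplx (EF p)) t,
  cl (a *: z + z') t = a *: cl z t + cl z' t.
Hypothesis clr : forall p a (z : cplx (EF p)) t t',
  cl z (a *: t + t') = a *: cl z t + cl z t'.

(** Conjugation by [iota], which is fibrewise linear, preserves every clause; the undifferentiated
    term of the Leibniz rule needs [iota] composed with its inverse to be the identity, which is
    surjectivity. *)
Lemma connF_connection : is_connection (A := EB) (F := EF) (@rsmooth R n M)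
  (ader CB) (connF iota DB).
Proof.
have iK p : cancel (iota p)^-1%VF (iota p).
  by move=> u; apply: limg_lfunVK; rewrite (iso_img iotaP) memvf.
have isD s s' : iota_inv iota (fun q => s q + s' q) =
    fun q => iota_inv iota s q + iota_inv iota s' q.
  by apply: functional_extensionality_dep => q; rewrite /iota_inv linearD.
have isZ (f : M -> R) s : iota_inv iota (fun q => f q *: s q) =
    fun q => f q *: iota_inv iota s q.
  by apply: functional_extensionality_dep => q; rewrite /iota_inv linearZ.
have ism U s : open U -> bsm EF U s -> bsm EB U (iota_inv iota s).
  exact: (iso_inv_smooth iotaP).
split.
- move=> U e s oU eU sU; apply: (iso_smooth iotaP) => //.
  by apply: (conn_smooth DBP) => //; exact: ism.
- move=> U e e' s s' oU eU eU' sU sU' ee ss p Up; congr (iota p _).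
  apply: (conn_local DBP oU) => //; try exact: ism.
  by move=> q Uq; rewrite /iota_inv ss.
- move=> U e e' s oU eU eU' sU p Up.
  by rewrite /connF (conn_addl DBP oU eU eU' (ism _ _ oU sU) Up) linearD.
- move=> U e s s' oU eU sU sU' p Up; rewrite /connF isD.
  by rewrite (conn_addr DBP oU eU (ism _ _ oU sU) (ism _ _ oU sU') Up) linearD.
- move=> U f e s oU fU eU sU p Up; rewrite /connF.
  by rewrite (conn_scalel DBP oU fU eU (ism _ _ oU sU) Up) linearZ.
- move=> U f e s oU fU eU sU p Up; rewrite /connF isZ.
  rewrite (conn_leibniz DBP oU fU eU (ism _ _ oU sU) Up) linearD !linearZ.
  congr (_ *: _ + _); exact: iK.
Qed.

Definition actZ (Z : sect (EBFb EB EF)) (f : M -> complex R) : M -> complex R :=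
  actB CB (projB Z) f.

Lemma EBFb_sheaf : section_sheaf (@csmooth R n M) (EBFb EB EF).
Proof. by apply: sumb_sheaf; apply: cplxb_sheaf; exact: vbundle_sheaf. Qed.

Lemma actZ_smooth U Z f : open U -> bsm (EBFb EB EF) U Z -> csmooth U f ->
  csmooth U (actZ Z f).
Proof. by move=> oU [ZB _] fU; exact: cact_smooth DBP oU ZB fU. Qed.

(** Directions are taken in the full sum, through [projB], because the abstract iteration requires
    directions and slots to lie in one module. *)
Lemma connBF_connection :
  is_connection (A := EBFb EB EF) (F := EBFb EB EF) (@csmooth R n M) actZ
    (fun X Y => connBF iota DB (projB X) Y).
Proof.
have hB := cplx_connection (vbundle_sheaf EB) (vbundle_sheaf EB) DBP.
have hF := cplx_connection (vbundle_sheaf EB) (vbundle_sheaf EF) connF_connection.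
split.
- move=> U e s oU [eU _] [sB sF]; split.
    exact: (conn_smooth hB oU eU sB).
  exact: (conn_smooth hF oU eU sF).
- move=> U e e' s s' oU [eU _] [eU' _] [sB sF] [sB' sF'] ee ss p Up.
  have eeB q : U q -> projB e q = projB e' q by move=> /ee; rewrite /projB => ->.
  congr pair.
    by apply: (conn_local hB oU eU eU' sB sB' eeB _ Up) => q /ss; rewrite /projB => ->.
  by apply: (conn_local hF oU eU eU' sF sF' eeB _ Up) => q /ss; rewrite /projF => ->.
- move=> U e e' s oU [eU _] [eU' _] [sB sF] p Up; congr pair.
    exact: (conn_addl hB oU eU eU' sB Up).
  exact: (conn_addl hF oU eU eU' sF Up).
- move=> U e s s' oU [eU _] [sB sF] [sB' sF'] p Up; congr pair.
    exact: (conn_addr hB oU eU sB sB' Up).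
  exact: (conn_addr hF oU eU sF sF' Up).
- move=> U f e s oU fU [eU _] [sB sF] p Up; congr pair.
    exact: (conn_scalel hB oU fU eU sB Up).
  exact: (conn_scalel hF oU fU eU sF Up).
- move=> U f e s oU fU [eU _] [sB sF] p Up; congr pair.
    exact: (conn_leibniz hB oU fU eU sB Up).
  exact: (conn_leibniz hF oU fU eU sF Up).
Qed.

Lemma iota_cplxD e e' : iota_cplx iota (fun q => e q + e' q) =
  fun q => iota_cplx iota e q + iota_cplx iota e' q.
Proof.
apply: functional_extensionality_dep => q; rewrite /iota_cplx /=.
by rewrite !linearD.
Qed.

Lemma iota_cplxZ (f : M -> complex R) e : iota_cplx iota (fun q => f q *: e q) =
  fun q => f q *: iota_cplx iota e q.
Proof.
apply: functional_extensionality_dep => q; rewrite /iota_cplx /=.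
by congr pair; rewrite ?linearB ?linearD !linearZ.
Qed.

(** [iota] preserves anchors, so differentiating along E^F through [iota] is differentiating along
    E^B. *)
Lemma actB_iota e f : cplx_act (ader CF) (iota_cplx iota e) f = actB CB e f.
Proof.
have aE (a : sect EB) g : ader CF (fun q => iota q (a q)) g = ader CB a g.
  rewrite /ader /vfder; apply/funext => q.
  by rewrite (iso_anchor iotaP).
by apply/funext => q; rewrite /actB /cplx_act -!aE.
Qed.

(** The Clifford term is linear over functions in both arguments, so adding it to the covariant
    derivative leaves the Leibniz rule unchanged. *)
Lemma superconn_connection :
  is_connection (A := EBFb EB EF) (F := SS) (@csmooth R n M) actZ
    (superconn iota cl DS).
Proof.
have im U e : open U -> bsm (cplxb EB) U e -> bsm (cplxb EF) U (iota_cplx iota e).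
  by move=> oU [er ei]; split; apply: (iso_smooth iotaP).
split.
- move=> U e s oU [eB eF] sU; apply: (bsmD SSP) => //; last exact: cl_smooth.
  by apply: (conn_smooth DSP) => //; exact: im.
- move=> U e e' s s' oU [eB eF] [eB' eF'] sU sU' ee ss p Up.
  rewrite /superconn /projF ee // ss //; congr (_ + _).
  apply: (conn_local DSP oU (im _ _ oU eB) (im _ _ oU eB') sU sU') => // q Uq.
  by rewrite /iota_cplx /projB ee.
- move=> U e e' s oU [eB eF] [eB' eF'] sU p Up; rewrite /superconn.
  rewrite [in X in X + _](_ : projB _ = fun q => projB e q + projB e' q) //.
  rewrite iota_cplxD (conn_addl DSP oU (im _ _ oU eB) (im _ _ oU eB') sU Up).
  rewrite addrACA; congr (_ + _).
  by have := cll 1 (projF e p) (projF e' p) (s p); rewrite !scale1r.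
- move=> U e s s' oU [eB eF] sU sU' p Up; rewrite /superconn.
  rewrite (conn_addr DSP oU (im _ _ oU eB) sU sU' Up) addrACA; congr (_ + _).
  by have := clr 1 (projF e p) (s p) (s' p); rewrite !scale1r.
- move=> U f e s oU fU [eB eF] sU p Up; rewrite /superconn.
  rewrite [in X in X + _](_ : projB _ = fun q => f q *: projB e q) //.
  rewrite iota_cplxZ (conn_scalel DSP oU fU (im _ _ oU eB) sU Up) scalerDr.
  congr (_ + _); have c0 : cl 0 (s p) = 0.
    apply: (addrI (cl 0 (s p))); rewrite addr0.
    by have := cll 1 (0 : cplx (EF p)) 0 (s p); rewrite !scale1r !addr0 => <-.
  by have := cll (f p) (projF e p) 0 (s p); rewrite c0 !addr0.
- move=> U f e s oU fU [eB eF] sU p Up; rewrite /superconn.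
  rewrite (conn_leibniz DSP oU fU (im _ _ oU eB) sU Up) actB_iota scalerDr addrA.
  congr (_ + _); have c0 : cl (projF e p) 0 = 0.
    apply: (addrI (cl (projF e p) 0)); rewrite addr0.
    by have := clr 1 (projF e p) 0 0; rewrite !scale1r !addr0 => <-.
  by have := clr (f p) (projF e p) (s p) 0; rewrite c0 !addr0.
Qed.

End Superconnection.

(** * Frames *)

Section Frames.
Variables (R : realType) (n : nat) (M : manifold R n) (m : nat).
Variables (EB EF : vbundle M m).
Let K := complex R.

Definition fdBF (x : M) : set M := fdom EB x `&` fdom EF x.

Lemma fdBF_open x : open (fdBF x).
Proof. by apply: openI; exact: fdom_open. Qed.

Lemma fdBF_center x : fdBF x x.
Proof. by split; exact: fdom_center. Qed.

(** Built from the real frame coordinates, which give linearity and smoothness directly; over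
    [fdBF x] it is the coordinate in [frameBF], by [coord_frameBF]. *)
Definition coordBF (x q : M) (j : 'I_(m + m)) (v : EBF EB EF q) : K :=
  match fintype.split j with
  | inl i => (fcoord EB x q i v.1.1 +i* fcoord EB x q i v.1.2)%C
  | inr i => (fcoord EF x q i v.2.1 +i* fcoord EF x q i v.2.2)%C
  end.

Lemma coordBF_linear x q j a u v :
  @coordBF x q j (a *: u + v) = a * coordBF x j u + coordBF x j v.
Proof.
have L (E : vbundle M m) i (w w' : cplx (E q)) :
    (fcoord E x q i (a *: w + w').1 +i* fcoord E x q i (a *: w + w').2)%C =
    a * (fcoord E x q i w.1 +i* fcoord E x q i w.2)%C +
    (fcoord E x q i w'.1 +i* fcoord E x q i w'.2)%C.
  have Z b (t : E q) : fcoord E x q i (b *: t) = b * fcoord E x q i t by exact: fcoordZ.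
  have D (t t' : E q) : fcoord E x q i (t + t') = fcoord E x q i t + fcoord E x q i t'.
    exact: fcoordD.
  have N (t : E q) : fcoord E x q i (- t) = - fcoord E x q i t.
    by rewrite -scaleN1r Z mulN1r.
  rewrite [(_ + _).1](_ : _ = complex.Re a *: w.1 - complex.Im a *: w.2 + w'.1) //.
  rewrite [(_ + _).2](_ : _ = complex.Re a *: w.2 + complex.Im a *: w.1 + w'.2) //.
  rewrite !D !N !Z; case: a => a1 a2 /=; apply/eqP; rewrite eq_complex /=.
  by apply/andP; split; apply/eqP; ring.
by rewrite /coordBF; case: (fintype.split j) => i; exact: L.
Qed.

Lemma coordBF0 x q j : coordBF x j (0 : EBF EB EF q) = 0.
Proof.
have := coordBF_linear x j 1 0 (0 : EBF EB EF q).
rewrite scale1r mul1r addr0 => c0.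
by apply: (addrI (coordBF x j (0 : EBF EB EF q))); rewrite addr0 -c0.
Qed.

Lemma coordBF_sum x q j (I : finType) (c : I -> K) (F : I -> EBF EB EF q) :
  coordBF x j (\sum_i c i *: F i) = \sum_i c i * coordBF x j (F i).
Proof.
elim/big_rec2: _ => [|i y z _ <-]; first exact: coordBF0.
exact: coordBF_linear.
Qed.

Lemma frameBF_lshift x q i : tnth (frameBF EB EF x q) (lshift m i) =
  ((tnth (frame EB x q) i, 0), 0) :> EBF EB EF q.
Proof. by rewrite tnth_lshift tnth_mktuple. Qed.

Lemma frameBF_rshift x q i : tnth (frameBF EB EF x q) (rshift m i) =
  (0, (tnth (frame EF x q) i, 0)) :> EBF EB EF q.
Proof. by rewrite tnth_rshift tnth_mktuple. Qed.

Lemma split_lshift i : fintype.split (lshift m i) = inl i :> 'I_m + 'I_m.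
Proof. exact: (unsplitK (inl i)). Qed.

Lemma split_rshift i : fintype.split (rshift m i) = inr i :> 'I_m + 'I_m.
Proof. exact: (unsplitK (inr i)). Qed.

Lemma coordBF_frame x q i j : fdBF x q ->
  coordBF x j (tnth (frameBF EB EF x q) i) = (i == j)%:R.
Proof.
case=> xB xF.
have L (E : vbundle M m) (k l : 'I_m) : fdom E x q ->
    fcoord E x q l (tnth (frame E x q) k) = (k == l)%:R.
  move=> xE; rewrite /fcoord (tnth_nth 0) coord_free //.
  exact: basis_free (frame_basis xE).
have L0 (E : vbundle M m) (l : 'I_m) : fcoord E x q l 0 = 0.
  by rewrite /fcoord linear0.
have cR (b : bool) : (b%:R +i* 0)%C = b%:R :> K by case: b.
rewrite -(splitK i) -(splitK j) /coordBF; case: (fintype.split i) (fintype.split j) =>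
  k [] l /=; rewrite ?frameBF_lshift ?frameBF_rshift ?split_lshift ?split_rshift /=.
- by rewrite L // L0 cR (inj_eq (@lshift_inj _ _)).
- by rewrite !L0 eq_lrshift.
- by rewrite !L0 eq_rlshift.
- by rewrite L // L0 cR (inj_eq (@rshift_inj _ _)).
Qed.

Lemma coordBF_expand x q (v : EBF EB EF q) : fdBF x q ->
  v = \sum_j coordBF x j v *: tnth (frameBF EB EF x q) j.
Proof.
case=> xB xF; rewrite big_split_ord /=.
have L (E : vbundle M m) (w : E q) : fdom E x q ->
    w = \sum_i fcoord E x q i w *: tnth (frame E x q) i.
  move=> xE; rewrite {1}(coord_basis (frame_basis xE) (memvf w)).
  by apply: eq_bigr => i _; rewrite (tnth_nth 0).
under eq_bigr do rewrite frameBF_lshift /coordBF split_lshift.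
under [X in _ + X]eq_bigr do rewrite frameBF_rshift /coordBF split_rshift.
have Z (V : lmodType R) (a : K) (t : V) :
    a *: ((t, 0) : cplx V) = (complex.Re a *: t, complex.Im a *: t).
  transitivity (complex.Re a *: t - complex.Im a *: 0,
                complex.Re a *: 0 + complex.Im a *: t) => //.
  by rewrite !scaler0 subr0 add0r.
have S (V : lmodType R) (c : 'I_m -> K) (t : 'I_m -> V) :
    \sum_i c i *: ((t i, 0) : cplx V) =
    (\sum_i complex.Re (c i) *: t i, \sum_i complex.Im (c i) *: t i).
  by elim/big_rec3: _ => // i y1 y2 y3 _ ->; rewrite Z.
have S1 (c : 'I_m -> K) (t : 'I_m -> cplx (EB q)) :
    \sum_i c i *: ((t i, 0) : EBF EB EF q) = (\sum_i c i *: t i, 0).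
  elim/big_rec2: _ => // i y1 y2 _ ->.
  transitivity (c i *: t i + y1, c i *: (0 : cplx (EF q)) + 0) => //.
  by rewrite scaler0 addr0.
have S2 (c : 'I_m -> K) (t : 'I_m -> cplx (EF q)) :
    \sum_i c i *: ((0, t i) : EBF EB EF q) = (0, \sum_i c i *: t i).
  elim/big_rec2: _ => // i y1 y2 _ ->.
  transitivity (c i *: (0 : cplx (EB q)) + 0, c i *: t i + y1) => //.
  by rewrite scaler0 addr0.
rewrite S1 S2 !S /= -!L //.
by case: v => [[v1 v2] [w1 w2]]; congr ((_, _), (_, _)); rewrite /= ?add0r ?addr0.
Qed.

Lemma frameBF_basis x q : fdBF x q -> basis_of fullv (frameBF EB EF x q).
Proof.
move=> xq; apply/andP; split.
  rewrite eqEsubv subvf /=.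
  apply/subvP => v _; rewrite (coordBF_expand v xq); apply: memv_suml => j _.
  by apply/memvZ/memv_span/mem_tnth.
apply/freeP => k k0 i; have := congr1 (coordBF x i) k0.
under eq_bigr do rewrite -tnth_nth.
rewrite coordBF_sum (bigD1 i) //= coordBF_frame // eqxx mulr1 big1 ?addr0.
  by move=> ->; exact: coordBF0.
by move=> j ji; rewrite coordBF_frame // (negPf ji) mulr0.
Qed.

Lemma coord_frameBF x q j v : fdBF x q ->
  coord (frameBF EB EF x q) j v = coordBF x j v.
Proof.
move=> xq; rewrite {1}(coordBF_expand v xq).
under eq_bigr do rewrite (tnth_nth 0).
by rewrite coord_sum_free // (basis_free (frameBF_basis xq)).
Qed.

Lemma coordBF_smooth U (Z : sect (EBFb EB EF)) x j : open U -> U `<=` fdBF x ->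
  bsm (EBFb EB EF) U Z -> csmooth U (fun q => coordBF x j (Z q)).
Proof.
move=> oU Ux [[Z1 Z2] [Z3 Z4]].
have UB : U `<=` U `&` fdom EB x by move=> q Uq; split=> //; have [] := Ux q Uq.
have UF : U `<=` U `&` fdom EF x by move=> q Uq; split=> //; have [] := Ux q Uq.
rewrite /coordBF; case: (fintype.split j) => i; split => /=.
- exact: rsmooth_sub UB (Z1 x i).
- exact: rsmooth_sub UB (Z2 x i).
- exact: rsmooth_sub UF (Z3 x i).
- exact: rsmooth_sub UF (Z4 x i).
Qed.

Lemma frameBF_smooth U x j : open U -> U `<=` fdBF x ->
  bsm (EBFb EB EF) U (fun q => tnth (frameBF EB EF x q) j).
Proof.
move=> oU Ux; have hB := vbundle_sheaf EB; have hF := vbundle_sheaf EF.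
have sB i : bsm EB U (fun q => tnth (frame EB x q) i).
  by apply: frame_section_smooth => q /Ux [].
have sF i : bsm EF U (fun q => tnth (frame EF x q) i).
  by apply: frame_section_smooth => q /Ux [].
rewrite -(splitK j); case: (fintype.split j) => i.
  apply: (bsm_eq (EBFb_sheaf EB EF) oU
    (s := fun q => ((tnth (frame EB x q) i, 0), 0) : EBF EB EF q)).
    by move=> q _; rewrite frameBF_lshift.
  by do !split; rewrite /=;
    [exact: sB|exact: (bsm0 hB)|exact: (bsm0 hF)|exact: (bsm0 hF)].
apply: (bsm_eq (EBFb_sheaf EB EF) oU
    (s := fun q => (0, (tnth (frame EF x q) i, 0)) : EBF EB EF q)).
  by move=> q _; rewrite frameBF_rshift.
by do !split; rewrite /=;
    [exact: (bsm0 hB)|exact: (bsm0 hB)|exact: sF|exact: (bsm0 hF)].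
Qed.

End Frames.

(** * The dual connection *)

Section TypedFrames.
Variables (R : realType) (n : nat) (M : manifold R n) (m : nat).
Variables (EB EF : vbundle M m).
Let K := complex R.

Definition EBFc : cbundle M := CBundle (EBFb_sheaf EB EF).

Section OneFrame.
Variables (W : odom M) (x : M) (Wx : oset W `<=` fdBF EB EF x).

Definition tframe (j : 'I_(m + m)) : gsec EBFc W :=
  gtr (F := EBFc) (frameBF_smooth j (oset_open W) Wx).

Definition tcoord (j : 'I_(m + m)) (Z : gsec EBFc W) : ofun W :=
  otr (coordBF_smooth j (oset_open W) Wx (gsec_smooth Z)).

Lemma tframeE j p : oset W p -> tframe j p = tnth (frameBF EB EF x p) j.
Proof. exact: gtrE. Qed.

Lemma tcoordE j Z p : oset W p -> tcoord j Z p = coordBF x j (Z p : EBF EB EF p).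
Proof. exact: otrE. Qed.

Lemma tframe_expand Z : Z = \sum_j tcoord j Z *: tframe j.
Proof.
apply: gsec_eq => p Wp; rewrite gsec_sumE.
rewrite [LHS](coordBF_expand (Z p : EBF EB EF p) (Wx Wp)).
by apply: eq_bigr => j _; rewrite gsecZE tcoordE // tframeE.
Qed.

End OneFrame.

Lemma ocst_smooth (W : odom M) (a : K) : csmooth W (fun _ : M => a).
Proof. exact: csmooth_cst. Qed.

Definition ocst W a : ofun W := otr (ocst_smooth W a).

Section Evaluation.
Variables (W : odom M) (a : dsect EB EF) (ha : dsmooth W a).

Lemma oeval_smooth (Z : gsec EBFc W) :
  csmooth W (fun p => a p (Z p : EBF EB EF p)).
Proof. exact: (ha (oset_open W) (fun _ Wp => Wp) (gsec_smooth Z)). Qed.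

Definition oeval Z : ofun W := otr (oeval_smooth Z).

Lemma oevalE Z p : oset W p -> oeval Z p = a p (Z p : EBF EB EF p).
Proof. exact: otrE. Qed.

Lemma oeval_linear f Z Z' : oeval (f *: Z + Z') = f * oeval Z + oeval Z'.
Proof.
apply: ofun_eq => p Wp; rewrite oevalE //.
rewrite [LHS](linearP (a p) (f p) (Z p : EBF EB EF p) (Z' p : EBF EB EF p)).
by rewrite [RHS](_ : _ = f p * oeval Z p + oeval Z' p) // !oevalE.
Qed.

End Evaluation.
End TypedFrames.

Section DualConnection.
Variables (R : realType) (n : nat) (M : manifold R n) (m : nat).
Variables (EB EF : vbundle M m) (CB : courant EB) (CF : courant EF).
Variable iota : forall p, 'Hom(EB p, EF p).
Variable DB : sect EB -> sect EB -> sect EB.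
Hypothesis iotaP : is_courant_iso CB CF iota.
Hypothesis DBP : is_rconnection CB DB.
Let K := complex R.
Let G := EBFc EB EF.

Definition bconn (W : odom M) : gsec G W -> gsec G W -> gsec G W :=
  tconn (A := G) (F := G) (connBF_connection iotaP DBP) (W := W).

Definition bact (W : odom M) : gsec G W -> ofun W -> ofun W :=
  tact (A := G) (@actZ_smooth _ _ _ _ EB EF CB DB DBP) (W := W).

Lemma bconnE W (X Z : gsec G W) p : oset W p ->
  bconn X Z p = connBF iota DB (projB (gsec_val X)) (gsec_val Z) p :> EBF EB EF p.
Proof.
by move=> Wp; exact: (tconnE (A := G) (F := G)
  (connBF_connection iotaP DBP) X Z Wp). Qed.

Lemma bactE W (X : gsec G W) f p : oset W p ->
  bact X f p = actB CB (projB (gsec_val X)) (ofun_val f) p.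
Proof.
by move=> Wp; exact: (tactE (A := G)
  (@actZ_smooth _ _ _ _ EB EF CB DB DBP) X f Wp). Qed.

Lemma bconnl W f (X X' Z : gsec G W) :
  bconn (f *: X + X') Z = f *: bconn X Z + bconn X' Z.
Proof. exact: (tconnl (A := G) (F := G) (connBF_connection iotaP DBP)). Qed.

Lemma bconnr W (X : gsec G W) f Z Z' :
  bconn X (f *: Z + Z') = bact X f *: Z + f *: bconn X Z + bconn X Z'.
Proof.
exact: (tconnr (A := G) (F := G) (@actZ_smooth _ _ _ _ EB EF CB DB DBP)
  (connBF_connection iotaP DBP)).
Qed.

Lemma bactD W (X : gsec G W) f g : bact X (f + g) = bact X f + bact X g.
Proof.
apply: ofun_eq => p Wp; rewrite [RHS](_ : _ = bact X f p + bact X g p) // !bactE //.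
exact: cactD Wp (oset_open W) (ofun_smooth f) (ofun_smooth g).
Qed.

Lemma bactM W (X : gsec G W) f g : bact X (f * g) = bact X f * g + f * bact X g.
Proof.
apply: ofun_eq => p Wp.
rewrite [RHS](_ : _ = bact X f p * g p + f p * bact X g p) // !bactE //.
exact: cactM Wp (oset_open W) (ofun_smooth f) (ofun_smooth g).
Qed.

Lemma bact_cst W (X : gsec G W) a : bact X (ocst W a) = 0.
Proof.
apply: ofun_eq => p Wp; rewrite bactE // -[RHS](cact_cst CB (projB (gsec_val X)) a p).
by apply: (cact_eq _ (oset_open W)) => // q Wq; exact: otrE.
Qed.

Lemma ocst1 (W : odom M) : ocst W 1 = 1.
Proof. by apply: ofun_eq => p Wp; rewrite otrE //= asboolT. Qed.

Lemma bact1 W (X : gsec G W) : bact X 1 = 0.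
Proof. by rewrite -ocst1 bact_cst. Qed.

(* (nabla_X a)(Z), as a function of the section Z *)
Definition dconn (W : odom M) (a : dsect EB EF) (ha : dsmooth W a)
    (X Z : gsec G W) : ofun W :=
  bact X (oeval ha Z) - oeval ha (bconn X Z).

(** The two derivatives of f, from [bact] and from [bconnr], cancel. *)
Lemma dconn_linear (W : odom M) a (ha : dsmooth W a) X f Z Z' :
  dconn ha X (f *: Z + Z') = f * dconn ha X Z + dconn ha X Z'.
Proof.
rewrite /dconn oeval_linear bactD bactM.
rewrite bconnr -[in X in _ - X]addrA !oeval_linear; ring.
Qed.

Lemma dconn_sum (W : odom M) a (ha : dsmooth W a) X (I : finType) (c : I -> ofun W) Z :
  dconn ha X (\sum_i c i *: Z i) = \sum_i c i * dconn ha X (Z i).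
Proof.
have D u v : dconn ha X (u + v) = dconn ha X u + dconn ha X v.
  by have := dconn_linear ha X 1 u v; rewrite scale1r mul1r.
have d0 : dconn ha X 0 = 0.
  by apply: (addrI (dconn ha X 0)); rewrite -D !addr0.
by elim/big_rec2: _ => // i y z _ <-; rewrite dconn_linear.
Qed.

Lemma ofun_sumE (W : odom M) (I : Type) (r : seq I) (P : pred I)
    (f : I -> ofun W) p :
  (\sum_(i <- r | P i) f i) p = \sum_(i <- r | P i) f i p.
Proof. by elim/big_rec2: _ => // i y x _ <-. Qed.

Lemma dconnE (W : odom M) a (ha : dsmooth W a) X (Z : gsec G W)
    (s : sect (EBFb EB EF)) p :
  oset W p -> (forall q, oset W q -> Z q = s q) ->
  dconn ha X Z p = actB CB (projB (gsec_val X)) (fun q => a q (s q : EBF EB EF q)) p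
    - a p (connBF iota DB (projB (gsec_val X)) s p).
Proof.
move=> Wp Zs; have oW := oset_open W.
have sW : bsm (EBFb EB EF) W s.
  by apply: (bsm_eq (EBFb_sheaf EB EF) oW _ (gsec_smooth Z)) => q Wq; rewrite Zs.
rewrite [LHS](_ : _ = bact X (oeval ha Z) p - oeval ha (bconn X Z) p) //.
rewrite bactE // oevalE // bconnE //.
have -> : actB CB (projB (gsec_val X)) (ofun_val (oeval ha Z)) p =
    actB CB (projB (gsec_val X)) (fun q => a q (s q : EBF EB EF q)) p.
  by apply: (cact_eq _ oW) => // q Wq; rewrite oevalE // Zs.
congr (_ - a p _); exact: (conn_local (connBF_connection iotaP DBP) oW (gsec_smooth X)
  (gsec_smooth X) (gsec_smooth Z) sW).
Qed.

(* nabla_e a is tensorial: the extension [extBF] in the definition of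
   [dual_conn] may be replaced by any smooth section. *)
Lemma dual_connE (W : odom M) a (X Z : gsec G W) p (ha : dsmooth W a) : oset W p ->
  dual_conn CB iota DB (projB (gsec_val X)) a p (Z p : EBF EB EF p) =
  dconn ha X Z p.
Proof.
(* [extBF] uses the frame around p, so everything is restricted to the part of W where that frame is
   a basis. *)
move=> Wp; pose oV := openI (oset_open W) (fdBF_open EB EF p).
pose V := ODom oV; have Vp : oset V p by split=> //; exact: fdBF_center.
have VW : oset V `<=` oset W by move=> q [].
have Vx : oset V `<=` fdBF EB EF p by move=> q [].
have hV : dsmooth V a by move=> W' Y oW' W'V; apply: ha => //; exact: subset_trans VW.
have XV : bsm G V (gsec_val X) := bsm_sub (EBFb_sheaf EB EF) VW (gsec_smooth X).
have ZV : bsm G V (gsec_val Z) := bsm_sub (EBFb_sheaf EB EF) VW (gsec_smooth Z).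
pose X' : gsec G V := gtr XV; pose Z' : gsec G V := gtr ZV.
(* [dual_conn] applies [linfun] to an expression whose linearity is not evident. The map f is the
   linear form with the values c on the frame; both sides are shown to be given by it. *)
pose c j := dconn hV X' (tframe Vx j) p.
pose f u := \sum_j coordBF p j (u : EBF EB EF p) * c j.
have fl : linear (f : EBF EB EF p -> K^o).
  move=> b u v; rewrite /f scaler_sumr -big_split; apply: eq_bigr => j _ /=.
  by rewrite coordBF_linear mulrDl -mulrA.
pose fL : {linear EBF EB EF p -> K^o} :=
  HB.pack (f : EBF EB EF p -> K^o) (GRing.isLinear.Build _ _ _ _ _ fl).
have dE (Y : gsec G V) (s : sect (EBFb EB EF)) :
    (forall q, oset V q -> Y q = s q) ->
    dconn hV X' Y p = actB CB (projB (gsec_val X)) (fun q => a q (s q : EBF EB EF q)) p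
      - a p (connBF iota DB (projB (gsec_val X)) s p).
  move=> Ys; rewrite (dconnE hV X' Vp Ys).
  have sV : bsm (EBFb EB EF) V s.
    by apply: (bsm_eq (EBFb_sheaf EB EF) oV _ (gsec_smooth Y)) => q Wq; rewrite Ys.
  have XX' q : oset V q -> gsec_val X' q = gsec_val X q by move=> Vq; exact: trunc_in.
  have E1 : actB CB (projB (gsec_val X')) (fun q => a q (s q : EBF EB EF q)) p =
      actB CB (projB (gsec_val X)) (fun q => a q (s q : EBF EB EF q)) p.
    by apply: (cact_eq _ oV) => //; rewrite /projB XX'.
  have E2 : connBF iota DB (projB (gsec_val X')) s p =
      connBF iota DB (projB (gsec_val X)) s p.
    exact: (conn_local (connBF_connection iotaP DBP) oV (gsec_smooth X') XV sV sV XX').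
  by rewrite E1 E2.
rewrite [LHS](_ : _ = f (Z p)).
  transitivity (dconn hV X' Z' p).
    rewrite [in RHS](tframe_expand Vx Z') dconn_sum ofun_sumE; apply: eq_bigr => j _.
    rewrite [RHS](_ : _ = tcoord Vx j Z' p * c j) // tcoordE //.
    by rewrite /Z' /= trunc_in.
  rewrite (dE Z' (gsec_val Z)); last by move=> q Vq; rewrite /= trunc_in.
  by rewrite (dconnE ha X Wp (s := gsec_val Z)).
rewrite /dual_conn; set g := (X in linfun X).
have -> : g = fL; last by exact: (lfunE fL (Z p)).
apply/funext => u; rewrite /g /= /f.
(* Y represents [extBF u] over V: the frame sections with the constant coordinates of u. *)
pose Y : gsec G V := \sum_j ocst V (coordBF p j u) *: tframe Vx j.
rewrite -(dE Y (extBF u)) => [|q Vq].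
  rewrite dconn_sum ofun_sumE; apply: eq_bigr => j _.
  by rewrite [LHS](_ : _ = ocst V (coordBF p j u) p * c j) // otrE.
rewrite gsec_sumE; apply: eq_bigr => j _.
by rewrite gsecZE otrE // tframeE // coord_frameBF //; exact: fdBF_center.
Qed.

End DualConnection.

Lemma map_mktuple_in (I T : Type) (f : I -> T) (J : seq I) :
  [tuple f (tnth (in_tuple J) i) | i < size J] = map f J :> seq T.
Proof. by rewrite /= (map_comp f) map_tnth_enum. Qed.

(** * Components of parallel tensors in a frame *)

Section Coframes.
Variables (R : realType) (n : nat) (M : manifold R n) (m : nat).
Variables (EB EF : vbundle M m) (CB : courant EB) (CF : courant EF).
Variable iota : forall p, 'Hom(EB p, EF p).
Variable DB : sect EB -> sect EB -> sect EB.
Hypothesis iotaP : is_courant_iso CB CF iota.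
Hypothesis DBP : is_rconnection CB DB.
Let K := complex R.
Let G := EBFc EB EF.

Definition coframe_sect (x : M) (j : 'I_(m + m)) : dsect EB EF :=
  fun p => coframeBF EB EF x p j.

Lemma coframeE x q j v : fdBF EB EF x q ->
  coframeBF EB EF x q j v = coordBF x j v.
Proof. by move=> xq; rewrite lfunE /= coord_frameBF. Qed.

Lemma coframe_smooth x j U : U `<=` fdBF EB EF x -> dsmooth U (coframe_sect x j).
Proof.
move=> Ux V Z oV VU ZV; have Vx := subset_trans VU Ux.
apply: (csmooth_eq oV _ (coordBF_smooth j oV Vx ZV)) => p Vp.
by rewrite /coframe_sect coframeE //; exact: Vx.
Qed.

Section OnDomain.
Variables (W : odom M) (x : M) (Wx : oset W `<=` fdBF EB EF x).

Definition connmx (X : gsec G W) (i j : 'I_(m + m)) : ofun W :=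
  tcoord Wx i (bconn iotaP DBP X (tframe Wx j)).

Lemma bconn_frame X j :
  bconn iotaP DBP X (tframe Wx j) = \sum_i connmx X i j *: tframe Wx i.
Proof. exact: tframe_expand. Qed.

(** The coframe takes constant values on the frame, so only the term [- a (nabla F_j)] survives: the
    dual connection has the negated connection matrix, summed over its other index. *)
Lemma dual_coframe (X : gsec G W) i p : oset W p ->
  dual_conn CB iota DB (projB (gsec_val X)) (coframe_sect x i) p =
  \sum_j (- connmx X i j p) *: coframeBF EB EF x p j.
Proof.
move=> Wp; have xp := Wx Wp; apply/lfunP => u.
pose Z : gsec G W := \sum_j ocst W (coordBF x j u) *: tframe Wx j.
have Zp : Z p = u :> EBF EB EF p.
  rewrite gsec_sumE [RHS](coordBF_expand u xp); apply: eq_bigr => j _.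
  by rewrite gsecZE otrE // tframeE.
have hth := coframe_smooth i Wx.
rewrite -{1}Zp (dual_connE iotaP DBP X Z hth Wp) dconn_sum ofun_sumE.
rewrite sum_lfunE; apply: eq_bigr => j _.
rewrite scale_lfunE coframeE //.
rewrite [LHS](_ : _ = ocst W (coordBF x j u) p *
  dconn iotaP DBP hth X (tframe Wx j) p) // otrE //.
rewrite /dconn (_ : oeval hth (tframe Wx j) = ocst W (j == i)%:R); last first.
  apply: ofun_eq => q Wq; rewrite oevalE // otrE // tframeE //.
  by rewrite /coframe_sect coframeE ?coordBF_frame //; exact: Wx.
rewrite bact_cst sub0r.
rewrite [X in _ * X](_ : _ = - oeval hth (bconn iotaP DBP X (tframe Wx j)) p) //.
rewrite oevalE // /coframe_sect coframeE // /connmx tcoordE //.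
by rewrite mulrN mulrC -mulNr.
Qed.

Section Components.
Variables (t : tensor EB EF) (U : set M) (WU : oset W `<=` U).
Hypothesis tU : tensor_field U t.
Arguments t : clear implicits.

Lemma tcomp_smooth (J : seq 'I_(m + m)) :
  csmooth W (fun p => t p [seq coframeBF EB EF x p i | i <- J]).
Proof.
have := tensor_smooth tU (a := fun i => coframe_sect x (tnth (in_tuple J) i))
  (oset_open W) WU (fun i => coframe_smooth _ Wx).
apply: csmooth_eq; first exact: oset_open.
by move=> p Wp; rewrite -map_mktuple_in.
Qed.

Definition tcomp J : ofun W := otr (tcomp_smooth J).

Lemma tcompE J p : oset W p ->
  tcomp J p = t p [seq coframeBF EB EF x p i | i <- J].
Proof. exact: otrE. Qed.

End Components.
End OnDomain.

Lemma connT_lder (e : sect (cplxb EB)) (t : tensor EB EF) k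
    (a : 'I_k -> dsect EB EF) p :
  connT CB iota DB e t a p =
  actB CB e (fun q => t q [tuple a i q | i < k]) p -
  lder (dual_conn CB iota DB e) (fun l => t p [seq b p | b <- l] : K)
    [tuple a i | i < k].
Proof.
rewrite /connT lder_tuple; congr (_ - _); apply: eq_bigr => h _; congr (t p _).
by rewrite /= -[RHS]map_comp; apply: eq_map => i /=; case: eqP.
Qed.

Lemma parallel_lder U (t : tensor EB EF) (W : set M) e k
    (a : 'I_k -> dsect EB EF) p :
  parallel CB iota DB U t -> open W -> W `<=` U -> bsm (cplxb EB) W e ->
  (forall i, dsmooth W (a i)) -> W p ->
  actB CB e (fun q => t q [tuple a i q | i < k]) p =
  lder (dual_conn CB iota DB e) (fun l => t p [seq b p | b <- l] : K)
    [tuple a i | i < k].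
Proof.
move=> [_ tp] oW WU eW aW Wp; apply/eqP; rewrite -subr_eq0 -connT_lder.
by apply/eqP; exact: tp oW WU eW aW _ Wp.
Qed.

Lemma lder_coframe (W : odom M) x (Wx : oset W `<=` fdBF EB EF x) (X : gsec G W)
    p (T : seq (covector EB EF p) -> K) (J : seq 'I_(m + m)) :
  oset W p -> multilinear T ->
  lder (dual_conn CB iota DB (projB (gsec_val X)))
    (fun l => T [seq (b : dsect EB EF) p | b <- l]) (map (coframe_sect x) J) =
  - ider (fun i j => connmx Wx X i j p)
      (fun J => T [seq coframeBF EB EF x p i | i <- J]) J.
Proof.
move=> Wp; elim: J T => [|i J IH] T hT /=; first by rewrite oppr0.
rewrite dual_coframe //.
rewrite [X in X + _](mlin_sum _ _ _ (hT : mlin (S := K^o) T)).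
rewrite (IH (fun l => T (coframe_sect x i p :: l))); last first.
  exact: (mlin_consl _ (hT : mlin (S := K^o) T)).
rewrite opprD; congr (_ + _); rewrite -sumrN; apply: eq_bigr => j _.
by rewrite -mulNr -map_comp.
Qed.

Lemma ider_ofunE (W : odom M) (I : finType) (w : I -> I -> ofun W)
    (c : seq I -> ofun W) J p :
  ider w c J p = ider (fun i j => w i j p) (fun J => c J p) J.
Proof.
elim: J c => [|i J IH] c //=; rewrite -IH.
rewrite [LHS](_ : _ = (\sum_j w i j * c (j :: J)) p +
  ider w (fun l => c (i :: l)) J p) //.
by rewrite ofun_sumE.
Qed.

(** Parallelism tested on the coframe fields, with [dual_coframe] in each slot, becomes the
    differential equation for components required by [frame_parallel]. *)
Lemma tcomp_parallel (W : odom M) x (Wx : oset W `<=` fdBF EB EF x)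
    (t : tensor EB EF) (U : set M) (WU : oset W `<=` U) (X : gsec G W)
    (tU : parallel CB iota DB U t) J :
  bact DBP X (tcomp Wx WU (proj1 tU) J) =
  - ider (connmx Wx X) (tcomp Wx WU (proj1 tU)) J.
Proof.
apply: ofun_eq => p Wp; rewrite bactE //.
rewrite [RHS](_ : _ = - ider (connmx Wx X) (tcomp Wx WU (proj1 tU)) J p) //.
have oW := oset_open W.
rewrite ider_ofunE.
have -> : (fun J => tcomp Wx WU (proj1 tU) J p) =
    fun J => t p [seq coframeBF EB EF x p i | i <- J].
  by apply/funext => J'; rewrite tcompE.
rewrite -lder_coframe //; last exact: (tensor_multilinear (proj1 tU) (WU _ Wp)).
rewrite -[in RHS](map_mktuple_in (coframe_sect x)).
rewrite -(parallel_lder tU oW WU _ _ Wp); last first.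
- by move=> i; exact: coframe_smooth.
- by have [] := gsec_smooth X.
apply: (cact_eq _ oW) => // q Wq; rewrite tcompE //.
by rewrite -[in LHS]map_mktuple_in.
Qed.

End Coframes.

(** * The action Phi *)

Arguments tprod {R n M m EB EF} t t' p l.
Arguments tone {R n M m EB EF} p l.
Arguments tlin {R n M m EB EF} z t t' p l.

Section PhiSection.
Variables (R : realType) (n : nat) (M : manifold R n) (m : nat).
Variables (EB EF : vbundle M m) (CB : courant EB) (CF : courant EF).
Variable iota : forall p, 'Hom(EB p, EF p).
Variable DB : sect EB -> sect EB -> sect EB.
Variable SS : bundle M (complex R).
Variable cl : forall p, cplx (EF p) -> bfib SS p -> bfib SS p.
Variable DS : sect (cplxb EF) -> sect SS -> sect SS.
Hypothesis iotaP : is_courant_iso CB CF iota.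
Hypothesis DBP : is_rconnection CB DB.
Hypothesis SSP : section_sheaf (@csmooth R n M) SS.
Hypothesis DSP : is_cconnection CF DS.
Hypothesis cl_smooth : forall U z t, open U -> bsm (cplxb EF) U z ->
  bsm SS U t -> bsm SS U (fun p => cl (z p) (t p)).
Hypothesis cll : forall p a (z z' : cplx (EF p)) t,
  cl (a *: z + z') t = a *: cl z t + cl z' t.
Hypothesis clr : forall p a (z : cplx (EF p)) t t',
  cl z (a *: t + t') = a *: cl z t + cl z t'.
Let K := complex R.
Let G := EBFc EB EF.
Let S := CBundle SSP.
Let scP := superconn_connection iotaP SSP DSP cl_smooth cll clr.

Definition tsuperconn (W : odom M) : gsec G W -> gsec S W -> gsec S W :=
  tconn (A := G) (F := S) scP (W := W).

Lemma tsuperconnl W f (X X' : gsec G W) (s : gsec S W) :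
  tsuperconn (f *: X + X') s = f *: tsuperconn X s + tsuperconn X' s.
Proof. exact: (tconnl (A := G) (F := S) scP). Qed.

Lemma tsuperconnr W (X : gsec G W) f (s s' : gsec S W) :
  tsuperconn X (f *: s + s') = bact DBP X f *: s + f *: tsuperconn X s + tsuperconn X s'.
Proof.
exact: (tconnr (A := G) (F := S) (@actZ_smooth _ _ _ _ EB EF CB DB DBP) scP).
Qed.

Lemma tsuperconnE W (X : gsec G W) (s : gsec S W) p : oset W p ->
  tsuperconn X s p = superconn iota cl DS (gsec_val X) (gsec_val s) p.
Proof. by move=> Wp; exact: (tconnE (A := G) (F := S) scP X s Wp). Qed.

Definition covW (W : odom M) (s : gsec S W) (l : seq (gsec G W)) : gsec S W :=
  covA (@bconn _ _ _ _ _ _ _ _ _ _ iotaP DBP W) (@tsuperconn W) s l.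

Lemma covW_mlin (W : odom M) (s : gsec S W) : mlin (covW s).
Proof.
exact: (mlin_covA (@bconnl _ _ _ _ _ _ _ _ _ _ iotaP DBP W)
  (@bconnr _ _ _ _ _ _ _ _ _ _ iotaP DBP W) (@tsuperconnl W) (@tsuperconnr W) s).
Qed.

(** Agreement is assumed only over W because the induction replaces slots by [connBF] on one side
    and by [bconn] on the other, and [bconn] is cut off to 0 outside W. *)
Lemma superconn_iter_covW (W : odom M) k (s : sect SS) (s' : gsec S W)
    (X : 'I_k -> sect (EBFb EB EF)) (X' : 'I_k -> gsec G W) :
  (forall p, oset W p -> s' p = s p) ->
  (forall i p, oset W p -> X' i p = X i p) ->
  forall p, oset W p ->
    superconn_iter iota DB cl DS s X p = covW s' [tuple X' i | i < k] p.
Proof.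
move=> ss; have oW := oset_open W; elim: k X X' => [|k IH] X X' XX p Wp.
  by rewrite (size0nil (size_tuple [tuple X' i | i < 0])) -[LHS](ss p Wp).
have XW i : bsm G W (X i).
  by apply: (bsm_eq (EBFb_sheaf EB EF) oW _ (gsec_smooth (X' i))) => q; exact: XX.
rewrite mktuple_cons /covW covA_cons.
rewrite -/(covW s' _) lder_tuple.
set Xr := fun i => X (lift ord0 i); set Xr' := fun i => X' (lift ord0 i).
have XXr i q : oset W q -> Xr' i q = Xr i q by exact: XX.
rewrite gsecDE gsecNE gsec_sumE; congr (_ - _).
  rewrite tsuperconnE //.
  have IHr q : oset W q -> covW s' [tuple Xr' i | i < k] q =
      superconn_iter iota DB cl DS s Xr q by move=> Wq; rewrite (IH Xr Xr').
  apply: (conn_local scP oW) => //.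
  - exact: (gsec_smooth (X' ord0)).
  - apply: (bsm_eq SSP oW _ (gsec_smooth (covW s' [tuple Xr' i | i < k]))).
    exact: IHr.
  - exact: (gsec_smooth (covW s' [tuple Xr' i | i < k])).
  - by move=> q Wq; rewrite XX.
  - by move=> q Wq; exact/esym/IHr.
apply: eq_bigr => h _.
apply: (IH (fun i => if i == h then connBF iota DB (projB (X ord0)) (Xr h) else Xr i)
  (fun i => if i == h then bconn iotaP DBP (X' ord0) (Xr' h) else Xr' i)) => // i q Wq.
case: eqP => _; last exact: XXr.
rewrite [LHS](bconnE iotaP DBP (X' ord0) (Xr' h) Wq).
exact: (conn_local (connBF_connection iotaP DBP) oW (gsec_smooth (X' ord0))
  (XW ord0) (gsec_smooth (Xr' h)) (XW (lift ord0 h)) (XX ord0) (XXr h) Wq).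
Qed.

Lemma superconn_iter_frame (W : odom M) x (Wx : oset W `<=` fdBF EB EF x) k
    (s : sect SS) (s' : gsec S W) (I : k.-tuple 'I_(m + m)) p :
  (forall p, oset W p -> s' p = s p) -> oset W p ->
  superconn_iter iota DB cl DS s
    (fun i q => tnth (frameBF EB EF x q) (tnth I i) : EBF EB EF q) p =
  covW s' (map (tframe Wx) I) p.
Proof.
move=> ss Wp; rewrite (superconn_iter_covW (X' := fun i => tframe Wx (tnth I i)) ss) //.
  by rewrite /= (map_comp (tframe Wx)) map_tnth_enum.
by move=> i q Wq; rewrite tframeE.
Qed.

(** Both sides compute the same [superconn_iter] of total sections. *)
Lemma covW_restrict (W V : odom M) (VW : oset V `<=` oset W)
    x (Wx : oset W `<=` fdBF EB EF x) (Vx : oset V `<=` fdBF EB EF x)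
    (s : gsec S W) (s' : gsec S V) k (I : k.-tuple 'I_(m + m)) p :
  (forall p, oset V p -> s' p = s p) -> oset V p ->
  covW s (map (tframe Wx) I) p = covW s' (map (tframe Vx) I) p.
Proof.
move=> ss Vp; rewrite -(superconn_iter_frame Wx (s := gsec_val s)) //; last exact: VW.
by rewrite -(superconn_iter_frame Vx (s := gsec_val s)).
Qed.

Lemma multilinear_mlin p (t : seq (covector EB EF p) -> K) :
  multilinear t -> mlin (G := covector EB EF p) (S := K^o) t.
Proof. by []. Qed.

Lemma ofun_prodE (W : odom M) (I : Type) (r : seq I) (f : I -> ofun W) p :
  oset W p -> (\prod_(i <- r) f i) p = \prod_(i <- r) f i p.
Proof.
move=> Wp; elim: r => [|i r IH]; first by rewrite !big_nil /= asboolT.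
by rewrite !big_cons -IH.
Qed.

Lemma zip_swap (A B : Type) (s : seq A) (t : seq B) :
  zip t s = [seq (ab.2, ab.1) | ab <- zip s t].
Proof. by elim: s t => [|a s IH] [|b t] //=; rewrite IH. Qed.

(** With g the transition matrix, frames change by g and coframes by its transpose, so expanding
    either side gives the same double sum over multi-indices. *)
Lemma contraction_frame (W : odom M) x y (Wx : oset W `<=` fdBF EB EF x)
    (Wy : oset W `<=` fdBF EB EF y) (s : gsec S W) k p
    (t : seq (covector EB EF p) -> K) : multilinear t -> oset W p ->
  \sum_(I : k.-tuple 'I_(m + m)) t [seq coframeBF EB EF y p i | i <- I] *:
    covW s (map (tframe Wy) I) p =
  \sum_(I : k.-tuple 'I_(m + m)) t [seq coframeBF EB EF x p i | i <- I] *: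
    covW s (map (tframe Wx) I) p.
Proof.
move=> /multilinear_mlin ht Wp; have [xp yp] := (Wx _ Wp, Wy _ Wp).
pose g i j := tcoord Wx j (tframe Wy i).
have fy : tframe Wy =1 fun i => \sum_j g i j *: tframe Wx j.
  by move=> i; exact: tframe_expand.
have cx : coframeBF EB EF x p =1 fun j => \sum_i g i j p *: coframeBF EB EF y p i.
  move=> j; apply/lfunP => u; rewrite coframeE // sum_lfunE.
  rewrite {1}(coordBF_expand u yp) coordBF_sum; apply: eq_bigr => i _.
  by rewrite scale_lfunE coframeE // /g tcoordE // tframeE // mulrC.
under eq_bigr => I _.
  rewrite (eq_map fy) (mlin_expand _ _ (covW_mlin s)) gsec_sumE scaler_sumr.
  over.
rewrite exchange_big /=; apply: eq_bigr => J _.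
rewrite (eq_map cx) (mlin_expand (fun j i => g i j p) _ ht) scaler_suml.
apply: eq_bigr => I _. rewrite ofun_prodE // scalerA.
(* The two products of entries of g pair the multi-indices in opposite orders. *)
by rewrite zip_swap big_map mulrC.
Qed.

Lemma Phi_frame (W : odom M) x (Wx : oset W `<=` fdBF EB EF x)
    (t : tensor EB EF) (s : sect SS) (s' : gsec S W) p :
  (forall p, oset W p -> s' p = s p) -> oset W p -> multilinear (t p) ->
  Phi iota DB cl DS t s p =
  \sum_(k \in [set: nat]) \sum_(I : k.-tuple 'I_(m + m))
    t p [seq coframeBF EB EF x p i | i <- I] *: covW s' (map (tframe Wx) I) p.
Proof.
move=> ss Wp ht; apply: eq_fsbigr => k _.
(* On V both the frame around p, used by [Phi], and the frame around x are bases. *)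
pose V := ODom (openI (oset_open W) (fdBF_open EB EF p)).
have Vp : oset V p by split=> //; exact: fdBF_center.
have VW : oset V `<=` oset W by move=> q [].
have Vx : oset V `<=` fdBF EB EF x by exact: subset_trans Wx.
have Vy : oset V `<=` fdBF EB EF p by move=> q [].
pose sV : gsec S V := gtr (F := S) (bsm_sub SSP VW (gsec_smooth s')).
have sVE q : oset V q -> sV q = s' q by move=> Vq; exact: trunc_in.
have sVs q : oset V q -> sV q = s q by move=> Vq; rewrite sVE // ss //; exact/VW.
under eq_bigr do rewrite (superconn_iter_frame Vy _ sVs Vp).
rewrite (contraction_frame Vx) //.
by apply: eq_bigr => I _; rewrite (covW_restrict VW Wx Vx I sVE Vp).
Qed.

(** Phi(t)s over W as an element of the module of sections: one frame, smooth coefficients, bounded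
    degree. In this form A can be iterated on it. *)
Definition contraction (W : odom M) x (Wx : oset W `<=` fdBF EB EF x) U
    (WU : oset W `<=` U) (t : tensor EB EF) (tU : tensor_field U t) N
    (s : gsec S W) : gsec S W :=
  \sum_(k < N) \sum_(I : k.-tuple 'I_(m + m))
    tcomp Wx WU tU I *: covW s (map (tframe Wx) I).

Lemma contractionE (W : odom M) x (Wx : oset W `<=` fdBF EB EF x) U
    (WU : oset W `<=` U) (t : tensor EB EF) (tU : tensor_field U t) N s p :
  oset W p -> contraction Wx WU tU N s p =
  \sum_(k < N) \sum_(I : k.-tuple 'I_(m + m))
    t p [seq coframeBF EB EF x p i | i <- I] *: covW s (map (tframe Wx) I) p.
Proof.
move=> Wp; rewrite gsec_sumE; apply: eq_bigr => k _.
rewrite gsec_sumE; apply: eq_bigr => I _.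
by rewrite gsecZE tcompE.
Qed.

Lemma Phi_bounded (W : odom M) x (Wx : oset W `<=` fdBF EB EF x)
    (t : tensor EB EF) N (s : sect SS) (s' : gsec S W) p :
  (forall p, oset W p -> s' p = s p) -> oset W p -> multilinear (t p) ->
  (forall l, (N <= size l)%N -> t p l = 0) ->
  Phi iota DB cl DS t s p =
  \sum_(k < N) \sum_(I : k.-tuple 'I_(m + m))
    t p [seq coframeBF EB EF x p i | i <- I] *: covW s' (map (tframe Wx) I) p.
Proof.
move=> ss Wp tp tN; rewrite (Phi_frame Wx ss Wp tp).
rewrite -(big_nat_fsum (N := N) (F := fun k => \sum_(I : k.-tuple 'I_(m + m))
    t p [seq coframeBF EB EF x p i | i <- I] *: covW s' (map (tframe Wx) I) p)) //.
move=> k Nk; apply: big1 => I _.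
by rewrite tN ?scale0r // size_map size_tuple.
Qed.

Lemma Phi_contraction (W : odom M) x (Wx : oset W `<=` fdBF EB EF x) U
    (WU : oset W `<=` U) (t : tensor EB EF) (tU : tensor_field U t) N
    (s : sect SS) (s' : gsec S W) p :
  (forall p, oset W p -> s' p = s p) -> oset W p ->
  (forall q l, oset W q -> (N <= size l)%N -> t q l = 0) ->
  contraction Wx WU tU N s' p = Phi iota DB cl DS t s p.
Proof.
move=> ss Wp tN; rewrite contractionE // (Phi_bounded Wx (N := N) ss) //.
  exact: (tensor_multilinear tU (WU _ Wp)).
by move=> l; exact: tN.
Qed.

(** [covA_parallel] in each degree: the tensor enters through its components, and [frame_parallel]
    turns their equation [tcomp_parallel] into the required vanishing. *)
Lemma covW_contraction (W : odom M) x (Wx : oset W `<=` fdBF EB EF x) U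
    (WU : oset W `<=` U) (t : tensor EB EF) (tU : parallel CB iota DB U t) N s l :
  covW (contraction Wx WU (proj1 tU) N s) l =
  \sum_(k < N) \sum_(I : k.-tuple 'I_(m + m))
    tcomp Wx WU (proj1 tU) I *: covW s (l ++ map (tframe Wx) I).
Proof.
rewrite /covW /contraction (covA_sum _ (@tsuperconnr W) (@bact1 _ _ _ _ EB EF CB DB DBP W)).
apply: eq_bigr => k _.
apply: (covA_parallel (@bconnl _ _ _ _ _ _ _ _ _ _ iotaP DBP W)
  (@bconnr _ _ _ _ _ _ _ _ _ _ iotaP DBP W) (@tsuperconnl W) (@tsuperconnr W)
  (@bact1 _ _ _ _ EB EF CB DB DBP W)) => T X hT.
apply: (frame_parallel (w := connmx iotaP DBP Wx X)) => //.
  by move=> j; exact: bconn_frame.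
by move=> J; exact: tcomp_parallel.
Qed.

Lemma bounded_degree_nbhd U (t : tensor EB EF) p : open U -> tensor_field U t -> U p ->
  exists (W : odom M) N, [/\ oset W `<=` fdBF EB EF p, oset W `<=` U, oset W p &
    forall q l, oset W q -> (N <= size l)%N -> t q l = 0].
Proof.
move=> oU tU Up; have [V [k [oV Vp Vt]]] := tensor_locally_finite tU Up.
(* Local finiteness kills the degrees greater than k, so the strict bound is [k.+1]. *)
exists (ODom (openI (openI oU oV) (fdBF_open EB EF p))), k.+1; split.
- by move=> q [].
- by move=> q [[]].
- by split=> //; exact: fdBF_center.
- by move=> q l [[Uq Vq] _]; exact: Vt.
Qed.

Lemma tprod_multilinear p (t t' : tensor EB EF) :
  multilinear (t p) -> multilinear (t' p) -> multilinear (tprod t t' p).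
Proof.
move=> ht ht' l l' z a b; rewrite /tprod !size_cat /= mulr_sumr -big_split /=.
apply: eq_bigr => i _; rewrite !take_cat !drop_cat; case: ltnP => il.
  by rewrite ht' mulrDr mulrCA.
(* Here the cut falls just before the varying slot, which then heads the right factor; any later cut
   leaves it in the left factor. *)
have [->|] := eqVneq (i - size l)%N 0%N.
  by have /= E := ht' [::] l' z a b; rewrite ?take0 ?drop0 ?cats0 E mulrDr mulrCA.
move: (i - size l)%N => [|j] // _ /=.
by rewrite ht mulrDl mulrA.
Qed.

Lemma Phi_tprod U (t t' : tensor EB EF) s : open U ->
  tensor_field U t -> parallel CB iota DB U t' -> bsm SS U s ->
  forall p, U p -> Phi iota DB cl DS (tprod t t') s p =
    Phi iota DB cl DS t (Phi iota DB cl DS t' s) p.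
Proof.
move=> oU tU tU' sU p Up.
have [W1 [N1 [W1x W1U W1p tN1]]] := bounded_degree_nbhd oU tU Up.
have [W2 [N2 [W2x W2U W2p tN2]]] := bounded_degree_nbhd oU (proj1 tU') Up.
pose W := ODom (openI (oset_open W1) (oset_open W2)).
have Wp : oset W p by [].
have Wx : oset W `<=` fdBF EB EF p by move=> q [/W1x].
have WU : oset W `<=` U by move=> q [/W1U].
pose N := maxn N1 N2.
have tN q l : oset W q -> (N <= size l)%N -> t q l = 0.
  by move=> [W1q _]; rewrite geq_max => /andP[? _]; exact: tN1.
have tN' q l : oset W q -> (N <= size l)%N -> t' q l = 0.
  by move=> [_ W2q]; rewrite geq_max => /andP[_ ?]; exact: tN2.
pose s' : gsec S W := gtr (F := S) (bsm_sub SSP WU sU).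
have ss q : oset W q -> s' q = s q by exact: trunc_in.
have tm := tensor_multilinear tU Up.
have tm' := tensor_multilinear (proj1 tU') Up.
have s2 q : oset W q -> contraction Wx WU (proj1 tU') N s' q = Phi iota DB cl DS t' s q.
  by move=> Wq; exact: (Phi_contraction Wx WU (proj1 tU') ss Wq tN').
rewrite (Phi_bounded Wx (N := N) s2) //; last by move=> l; exact: tN.
rewrite (Phi_bounded Wx (N := (N + N)%N) ss) //; last 2 first.
- exact: tprod_multilinear.
(* A list of length at least N + N, cut in two, has a piece of length at least N, on which t or t'
   vanishes. *)
- move=> l lN; apply: big1 => i _.
  have [Ni|iN] := leqP N i.
    rewrite tN ?mul0r // size_take; case: ltnP => // _.
    by rewrite (leq_trans _ lN) ?leq_addr.
  rewrite tN' ?mulr0 // size_drop -[leqLHS](addnK N).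
  by apply: leq_sub => //; exact: ltnW.
pose th i := coframeBF EB EF p p i.
pose F := tframe Wx.
(* The contribution of bidegree (i, j). It vanishes outside the square i, j < N, so the triangle i +
   j < N + N of the left side may be replaced by that square. *)
pose g i j := \sum_(I : i.-tuple 'I_(m + m)) \sum_(J : j.-tuple 'I_(m + m))
  (t p (map th I) * t' p (map th J)) *: covW s' (map F I ++ map F J) p.
transitivity (\sum_(k < N + N) \sum_(i < k.+1) g i (k - i)%N).
  apply: eq_bigr => k _.
  under eq_bigr do rewrite /tprod scaler_suml size_map size_tuple.
  rewrite exchange_big /=; apply: eq_bigr => i _.
  rewrite /g -(big_tuple_take (fun I J => (t p (map th I) * t' p (map th J)) *:
    covW s' (map F I ++ map F J) p)); last by rewrite -ltnS.
  by apply: eq_bigr => I _; rewrite -map_cat cat_take_drop -map_take -map_drop.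
have g0l i j : (N <= i)%N -> g i j = 0.
  move=> Ni; apply: big1 => I _; apply: big1 => J _.
  by rewrite tN ?mul0r ?scale0r // size_map size_tuple.
have g0r i j : (N <= j)%N -> g i j = 0.
  move=> Nj; apply: big1 => I _; apply: big1 => J _.
  by rewrite tN' ?mulr0 ?scale0r // size_map size_tuple.
rewrite big_triangle -(big_nat_fsum (N := (N + N)%N)
  (F := fun i => \sum_(j < (N + N - i)%N) g i j)); last first.
  move=> k Nk; rewrite big1 // => j _; apply: g0l.
  by apply: leq_trans Nk; rewrite leq_addr.
rewrite (big_nat_fsum (N := N)); last first.
  by move=> k Nk; rewrite big1 // => j _; exact: g0l.
apply: eq_bigr => i _.
rewrite -(big_nat_fsum (N := (N + N - i)%N) (F := g i)); last first.
  move=> k Nk; apply: g0r; apply: leq_trans Nk.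
  by rewrite -addnBA ?leq_addr // ltnW.
rewrite (big_nat_fsum (N := N)); last by move=> k; exact: g0r.
rewrite /g exchange_big /=; apply: eq_bigr => I _.
(* This is where parallelism of t' enters. *)
rewrite covW_contraction gsec_sumE scaler_sumr; apply: eq_bigr => j _.
rewrite gsec_sumE scaler_sumr; apply: eq_bigr => J _.
by rewrite gsecZE tcompE // scalerA.
Qed.

Lemma Phi_bsm U (t : tensor EB EF) s : open U -> tensor_field U t ->
  bsm SS U s -> bsm SS U (Phi iota DB cl DS t s).
Proof.
move=> oU tU sU; apply: (bsm_local SSP) => p Up.
have [W [N [Wx WU Wp tN]]] := bounded_degree_nbhd oU tU Up.
pose s' : gsec S W := gtr (F := S) (bsm_sub SSP WU sU).
have ss q : oset W q -> s' q = s q by exact: trunc_in.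
exists (oset W) => //.
apply: (bsm_eq SSP (oset_open W) _ (gsec_smooth (contraction Wx WU tU N s'))) => q Wq.
exact: Phi_contraction ss Wq tN.
Qed.

(** One typed section [s1] represents both s and s' near p, so their iterates at p are values of the
    same [covW]. *)
Lemma Phi_eq U (t t' : tensor EB EF) s s' p : open U -> bsm SS U s -> U p ->
  t p = t' p -> (forall q, U q -> s q = s' q) ->
  Phi iota DB cl DS t s p = Phi iota DB cl DS t' s' p.
Proof.
move=> oU sU Up tt ss; pose W := ODom (openI oU (fdBF_open EB EF p)).
have Wp : oset W p by split=> //; exact: fdBF_center.
have Wx : oset W `<=` fdBF EB EF p by move=> q [].
have WU : oset W `<=` U by move=> q [].
pose s1 : gsec S W := gtr (F := S) (bsm_sub SSP WU sU).
have ss1 q : oset W q -> s1 q = s q by exact: trunc_in.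
have ss2 q : oset W q -> s1 q = s' q by move=> Wq; rewrite ss1 // ss //; exact/WU.
rewrite /Phi; apply: eq_fsbigr => k _; apply: eq_bigr => I _; rewrite tt.
by rewrite (superconn_iter_frame Wx I ss1 Wp) (superconn_iter_frame Wx I ss2 Wp).
Qed.

Lemma Phi_linear_tensor U z (t t' : tensor EB EF) s p : open U ->
  tensor_field U t -> tensor_field U t' -> bsm SS U s -> U p ->
  Phi iota DB cl DS (tlin z t t') s p =
  z *: Phi iota DB cl DS t s p + Phi iota DB cl DS t' s p.
Proof.
move=> oU tU tU' sU Up.
have [W1 [N1 [_ _ W1p tN1]]] := bounded_degree_nbhd oU tU Up.
have [W2 [N2 [_ _ W2p tN2]]] := bounded_degree_nbhd oU tU' Up.
pose N := maxn N1 N2; rewrite /Phi.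
have tN k (I : k.-tuple 'I_(m + m)) : (N <= k)%N ->
    t p [seq coframeBF EB EF p p i | i <- I] = 0.
  by rewrite geq_max => /andP[Nk _]; apply: tN1; rewrite // size_map size_tuple.
have tN' k (I : k.-tuple 'I_(m + m)) : (N <= k)%N ->
    t' p [seq coframeBF EB EF p p i | i <- I] = 0.
  by rewrite geq_max => /andP[_ Nk]; apply: tN2; rewrite // size_map size_tuple.
(* A sum over all degrees is additive only under finite support; N bounds the degrees of t, t' and
   their combination at p. *)
rewrite !(big_nat_fsum (N := N)).
- rewrite scaler_sumr -big_split; apply: eq_bigr => k _ /=.
  rewrite scaler_sumr -big_split; apply: eq_bigr => I _ /=.
  by rewrite /tlin scalerDl scalerA.
- by move=> k Nk; apply: big1 => I _; rewrite tN' // scale0r.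
- by move=> k Nk; apply: big1 => I _; rewrite tN // scale0r.
- by move=> k Nk; apply: big1 => I _; rewrite /tlin tN // tN' // mulr0 addr0 scale0r.
Qed.

Lemma Phi_linear_section U z (t : tensor EB EF) s s' p : open U ->
  tensor_field U t -> bsm SS U s -> bsm SS U s' -> U p ->
  Phi iota DB cl DS t (fun q => z *: s q + s' q) p =
  z *: Phi iota DB cl DS t s p + Phi iota DB cl DS t s' p.
Proof.
move=> oU tU sU sU' Up.
have [W [N [Wx WU Wp tN]]] := bounded_degree_nbhd oU tU Up.
pose s1 : gsec S W := gtr (F := S) (bsm_sub SSP WU sU).
pose s2 : gsec S W := gtr (F := S) (bsm_sub SSP WU sU').
have ss1 q : oset W q -> s1 q = s q by exact: trunc_in.
have ss2 q : oset W q -> s2 q = s' q by exact: trunc_in.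
have ss q : oset W q -> (ocst W z *: s1 + s2) q = z *: s q + s' q.
  by move=> Wq; rewrite gsecDE gsecZE otrE // ss1 // ss2.
rewrite -(Phi_contraction Wx WU tU ss1 Wp tN) -(Phi_contraction Wx WU tU ss2 Wp tN).
rewrite -(Phi_contraction Wx WU tU ss Wp tN) !contractionE // scaler_sumr -big_split.
apply: eq_bigr => k _ /=; rewrite scaler_sumr -big_split; apply: eq_bigr => I _ /=.
rewrite /covW (covA_lin _ (@tsuperconnr W)); last by move=> X; exact: bact_cst.
by rewrite gsecDE gsecZE otrE // scalerDr !scalerA mulrC.
Qed.

Lemma Phi_tone s p : Phi iota DB cl DS (@tone _ _ _ _ EB EF) s p = s p.
Proof.
rewrite /Phi (big_nat_fsum (N := 1)) => [|k k0]; last first.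
  apply: big1 => I _; rewrite /tone /nilp size_map size_tuple.
  by rewrite (gtn_eqF k0) scale0r.
rewrite big_ord1 (big_pred1 [tuple]) => [|I]; last by apply/esym/eqP/tuple0.
by rewrite /tone /= scale1r.
Qed.

Lemma Phi_module U : open U ->
  parallel_module CB iota DB cl DS U.
Proof.
move=> oU; split.
- move=> z s s' sU sU'; apply: (bsmD SSP) => //.
  by apply: (bsmZ SSP) => //; exact: csmooth_cst.
- by move=> t s [tU _]; exact: Phi_bsm.
- move=> t t' s s' _ _ sU _ tt ss p Up.
  exact: (Phi_eq oU sU Up (tt p Up) ss).
- by move=> z t t' s [tU _] [tU' _] sU p; exact: Phi_linear_tensor.
- by move=> z t s s' [tU _] sU sU' p; exact: Phi_linear_section.
- by move=> s _ p _; exact: Phi_tone.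
- by move=> t t' s [tU _] tU' sU; exact: Phi_tprod.
Qed.

End PhiSection.

(** * The algebra of parallel tensor fields *)

Section ParallelAlgebra.
Variables (R : realType) (n : nat) (M : manifold R n) (m : nat).
Variables (EB EF : vbundle M m) (CB : courant EB).
Variable iota : forall p, 'Hom(EB p, EF p).
Variable DB : sect EB -> sect EB -> sect EB.
Variables (U : set M) (oU : open U).
Let K := complex R.

Definition dsect0 : dsect EB EF := fun _ => 0.

Lemma dsmooth0 W : dsmooth W dsect0.
Proof.
move=> V Z oV _ _; apply: (csmooth_eq oV _ (csmooth_cst V 0)) => p _.
by rewrite zero_lfunE.
Qed.

(** Since the default [dsect0] is smooth, i may range over all naturals, and the property passes to
    [take] and [drop] without bounds on lengths. *)
Definition dsmooths W (la : seq (dsect EB EF)) :=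
  forall i, dsmooth W (nth dsect0 la i).

Lemma dsmooths_mktuple W k (a : 'I_k -> dsect EB EF) :
  (forall i, dsmooth W (a i)) -> dsmooths W [tuple a i | i < k].
Proof.
move=> aW i; have [ik|ki] := ltnP i k.
  by have := tnth_nth dsect0 [tuple a i | i < k] (Ordinal ik); rewrite tnth_mktuple => <-.
by rewrite nth_default ?size_tuple //; exact: dsmooth0.
Qed.

Lemma dsmooths_take W i la : dsmooths W la -> dsmooths W (take i la).
Proof.
move=> laW j; have [ji|ij] := ltnP j i; first by rewrite nth_take.
rewrite nth_default; first exact: dsmooth0.
by rewrite size_take_min geq_min ij.
Qed.

Lemma dsmooths_drop W i la : dsmooths W la -> dsmooths W (drop i la).
Proof. by move=> laW j; rewrite nth_drop. Qed.

Lemma dsmooths_tnth W la (i : 'I_(size la)) :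
  dsmooths W la -> dsmooth W (tnth (in_tuple la) i).
Proof. by move=> laW; rewrite (tnth_nth dsect0). Qed.

Lemma tensor_smooth_seq (t : tensor EB EF) W la : tensor_field U t -> open W ->
  W `<=` U -> dsmooths W la -> csmooth W (fun p => t p [seq b p | b <- la]).
Proof.
move=> tU oW WU laW; have := tensor_smooth tU oW WU (fun i => dsmooths_tnth i laW).
apply: csmooth_eq => // p _.
by rewrite (map_mktuple_in (fun b : dsect EB EF => b p)).
Qed.

Lemma parallel_lder_seq (t : tensor EB EF) W e la p : parallel CB iota DB U t ->
  open W -> W `<=` U -> bsm (cplxb EB) W e -> dsmooths W la -> W p ->
  actB CB e (fun q => t q [seq b q | b <- la]) p =
  lder (dual_conn CB iota DB e) (fun l => t p [seq b p | b <- l] : K) la.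
Proof.
move=> tU oW WU eW laW Wp.
rewrite -[in RHS](map_id la) -[in RHS](map_mktuple_in id la).
rewrite -(parallel_lder tU oW WU eW (fun i => dsmooths_tnth i laW) Wp).
congr (actB CB e _ p); apply/funext => q.
by rewrite (map_mktuple_in (fun b : dsect EB EF => b q)).
Qed.

Lemma map_mktuple_at k (a : 'I_k -> dsect EB EF) q :
  [tuple a i q | i < k] = [seq b q | b <- [tuple a i | i < k]] :> seq _.
Proof. by rewrite /= -[RHS]map_comp. Qed.

Lemma parallel_of_seq (t : tensor EB EF) : tensor_field U t ->
  (forall W e la, open W -> W `<=` U -> bsm (cplxb EB) W e -> dsmooths W la ->
    forall p, W p -> actB CB e (fun q => t q [seq b q | b <- la]) p =
    lder (dual_conn CB iota DB e) (fun l => t p [seq b p | b <- l] : K) la) ->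
  parallel CB iota DB U t.
Proof.
move=> tU tp; split=> // W e k a oW WU eW aW p Wp.
rewrite connT_lder -(tp W) //; last exact: dsmooths_mktuple.
apply/eqP; rewrite subr_eq0; apply/eqP; congr (actB CB e _ p).
by apply/funext => q; rewrite map_mktuple_at.
Qed.

Lemma tone_field : tensor_field U (@tone _ _ _ _ EB EF).
Proof.
split.
- by move=> p _ l l' z a b; rewrite /tone; case: l => [|? ?] /=; rewrite mulr0 addr0.
- by move=> p Up; exists U, 0%N; split=> // q l _ _; rewrite /tone /nilp; case: l.
- move=> W k a oW _ _; apply: (csmooth_eq oW _ (csmooth_cst W ((k == 0)%N)%:R)).
  by move=> p _; rewrite /tone /nilp size_tuple.
Qed.

Lemma tone_parallel : parallel CB iota DB U (@tone _ _ _ _ EB EF).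
Proof.
apply: parallel_of_seq tone_field _ => W e la _ _ _ _ p _.
have -> : (fun q => tone q [seq (b : dsect EB EF) q | b <- la]) =
    fun _ => (nilp la)%:R.
  by apply/funext => q; rewrite /tone /nilp size_map.
rewrite [LHS]cact_cst; case: la => [|b la] //.
rewrite (lder_ext _ (T' := fun _ => 0)) ?lder0 // => l sl.
by rewrite /tone /nilp size_map sl.
Qed.

Lemma tlin_field z t t' : tensor_field U t -> tensor_field U t' ->
  tensor_field U (@tlin _ _ _ _ EB EF z t t').
Proof.
move=> tU tU'; split.
- move=> p Up l l' w a b; rewrite /tlin (tensor_multilinear tU Up).
  by rewrite (tensor_multilinear tU' Up); ring.
- move=> p Up; have [W [k [oW Wp tW]]] := tensor_locally_finite tU Up.
  have [W' [k' [oW' Wp' tW']]] := tensor_locally_finite tU' Up.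
  exists (W `&` W'), (maxn k k'); split=> //; first exact: openI.
  move=> q l [Wq Wq'] Uq; rewrite gtn_max => /andP[kl kl'].
  by rewrite /tlin tW // tW' // mulr0 addr0.
- move=> W k a oW WU aW; apply: csmoothD => //.
    by apply: csmoothM => //; [exact: csmooth_cst | exact: (tensor_smooth tU)].
  exact: (tensor_smooth tU').
Qed.

Lemma tlin_parallel z t t' : parallel CB iota DB U t ->
  parallel CB iota DB U t' -> parallel CB iota DB U (@tlin _ _ _ _ EB EF z t t').
Proof.
move=> tP tP'; have [tU _] := tP; have [tU' _] := tP'.
apply: parallel_of_seq (tlin_field z tU tU') _ => W e la oW WU eW laW p Wp.
have ts := tensor_smooth_seq tU oW WU laW.
have ts' := tensor_smooth_seq tU' oW WU laW.
rewrite lderD lderMl -!(parallel_lder_seq _ oW WU eW laW Wp) //.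
rewrite [LHS](cactD _ _ Wp oW (csmoothM oW (csmooth_cst W z) ts) ts').
by rewrite (cactM _ _ Wp oW (csmooth_cst W z) ts) cact_cst mul0r add0r.
Qed.

Lemma tprod_seq (t t' : tensor EB EF) p (la : seq (dsect EB EF)) :
  tprod t t' p [seq b p | b <- la] = \sum_(i < (size la).+1)
    t p [seq b p | b <- take i la] * t' p [seq b p | b <- drop i la].
Proof.
by rewrite /tprod size_map; apply: eq_bigr => i _; rewrite map_take map_drop.
Qed.

Lemma tprod_field t t' : tensor_field U t -> tensor_field U t' ->
  tensor_field U (@tprod _ _ _ _ EB EF t t').
Proof.
move=> tU tU'; split.
- by move=> p Up; apply: tprod_multilinear; apply: tensor_multilinear Up.
- move=> p Up; have [W [k [oW Wp tW]]] := tensor_locally_finite tU Up.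
  have [W' [k' [oW' Wp' tW']]] := tensor_locally_finite tU' Up.
  exists (W `&` W'), (k + k')%N; split=> //; first exact: openI.
  move=> q l [Wq Wq'] Uq kl; apply: big1 => i _.
  have [ki|ik] := ltnP k i.
    rewrite tW ?mul0r // size_take_min leq_min ki.
    by apply: leq_ltn_trans kl; rewrite leq_addr.
  by rewrite tW' ?mulr0 // size_drop ltn_subRL (leq_ltn_trans _ kl) // leq_add2r.
- move=> W k a oW WU aW; have laW := dsmooths_mktuple aW.
  pose la := val [tuple a i | i < k].
  apply: (csmooth_eq oW (f := fun p => \sum_(i < (size la).+1)
    t p [seq b p | b <- take i la] * t' p [seq b p | b <- drop i la])).
    by move=> p _; rewrite -tprod_seq map_mktuple_at.
  apply: csmooth_sum => // i; apply: csmoothM => //.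
    by apply: (tensor_smooth_seq tU) => //; exact: dsmooths_take.
  by apply: (tensor_smooth_seq tU') => //; exact: dsmooths_drop.
Qed.

Lemma cact_sum W (e : sect (cplxb EB)) (I : Type) (r : seq I)
    (f : I -> M -> K) p : W p -> open W -> (forall i, csmooth W (f i)) ->
  actB CB e (fun q => \sum_(i <- r) f i q) p = \sum_(i <- r) actB CB e (f i) p.
Proof.
move=> Wp oW fW; elim: r => [|i r IH].
  rewrite big_nil -[RHS](cact_cst CB e 0 p); congr (actB CB e _ p).
  by apply/funext => q; rewrite big_nil.
rewrite big_cons -IH -[RHS](cactD CB e Wp oW (fW i) (csmooth_sum r oW fW)).
by congr (actB CB e _ p); apply/funext => q; rewrite big_cons.
Qed.

(** For each cut of the list of covector fields, both sides obey a product rule: [actB] on the two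
    component functions, and [lder] on the concatenation, by [lder_cat]. *)
Lemma tprod_parallel t t' : parallel CB iota DB U t ->
  parallel CB iota DB U t' -> parallel CB iota DB U (@tprod _ _ _ _ EB EF t t').
Proof.
move=> tP tP'; have [tU _] := tP; have [tU' _] := tP'.
apply: parallel_of_seq (tprod_field tU tU') _ => W e la oW WU eW laW p Wp.
have ts i := tensor_smooth_seq tU oW WU (dsmooths_take i laW).
have ts' i := tensor_smooth_seq tU' oW WU (dsmooths_drop i laW).
under [X in actB _ _ X]funext do rewrite tprod_seq.
rewrite (cact_sum _ _ Wp oW) => [|i]; last exact: csmoothM.
pose T l := t p [seq b p | b <- l]; pose T' l := t' p [seq b p | b <- l].
rewrite (lder_ext _ (T' := fun l => \sum_(i < (size la).+1)
  T (take i l) * T' (drop i l))); last by move=> l sl; rewrite tprod_seq sl.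
rewrite lder_sum; apply: eq_bigr => i _.
rewrite [LHS](cactM CB e Wp oW (ts i) (ts' i)).
rewrite -[X in _ = lder _ _ X](cat_take_drop i la) lder_cat.
have si : size (take i la) = i by rewrite size_takel // -ltnS.
congr (_ + _).
  rewrite [X in X * _](parallel_lder_seq tP oW WU eW (dsmooths_take i laW) Wp).
  rewrite -lderMr; apply: lder_ext => l; rewrite si => sl.
  by rewrite -sl take_size_cat ?drop_size_cat.
rewrite [X in _ * X](parallel_lder_seq tP' oW WU eW (dsmooths_drop i laW) Wp).
rewrite -lderMl; apply: lder_ext => l _.
by rewrite take_size_cat ?drop_size_cat.
Qed.

(** Both sides sum over two cuts of l; g is the term with pieces of lengths i, j and the rest. The
    left side is indexed by the first cut, the right side by the second, whence [big_triangle]. *)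
Lemma tprod_assoc (t t' t'' : tensor EB EF) p :
  tprod t (tprod t' t'') p = tprod (tprod t t') t'' p.
Proof.
apply/funext => l; rewrite /tprod.
pose g i j := t p (take i l) * t' p (take j (drop i l)) * t'' p (drop (i + j) l).
transitivity (\sum_(i < (size l).+1) \sum_(j < (size l).+1 - i) g i j).
  apply: eq_bigr => i _; have il : (i <= size l)%N by rewrite -ltnS.
  rewrite mulr_sumr size_drop subSn //.
  by apply: eq_bigr => j _; rewrite drop_drop addnC mulrA.
rewrite -big_triangle; apply: eq_bigr => k _; rewrite mulr_suml.
have kl : (k <= size l)%N by rewrite -ltnS.
rewrite size_takel //; apply: eq_bigr => i _.
have ik : (i <= k)%N by rewrite -ltnS.
by rewrite /g take_takel // take_drop subnK // subnKC.
Qed.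

Lemma tprod_tone_l (t : tensor EB EF) p : tprod (@tone _ _ _ _ EB EF) t p = t p.
Proof.
apply/funext => l; rewrite /tprod big_ord_recl take0 drop0 /tone /= mul1r.
rewrite big1 ?addr0 // => i _.
by rewrite /nilp size_takel ?mul0r //; exact: ltn_ord.
Qed.

Lemma tprod_tone_r (t : tensor EB EF) p : tprod t (@tone _ _ _ _ EB EF) p = t p.
Proof.
apply/funext => l; rewrite /tprod big_ord_recr /= take_size drop_size /tone /= mulr1.
rewrite big1 ?add0r // => i _.
by rewrite /nilp size_drop subn_eq0 leqNgt ltn_ord mulr0.
Qed.

Lemma parallel_tensors_algebra : parallel_algebra CB iota DB U.
Proof.
split.
- exact: tone_parallel.
- exact: tprod_parallel.
- exact: tlin_parallel.
- by move=> t t' t'' _ _ _ p _; exact: tprod_assoc.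
- by move=> t _ p _; exact: tprod_tone_l.
- by move=> t _ p _; exact: tprod_tone_r.
- move=> z t t' t'' _ _ _ p _; apply/funext => l.
  rewrite /tlin /tprod mulr_sumr -big_split; apply: eq_bigr => i _ /=.
  by rewrite mulrDl mulrA.
- move=> z t t' t'' _ _ _ p _; apply/funext => l.
  rewrite /tlin /tprod mulr_sumr -big_split; apply: eq_bigr => i _ /=.
  by rewrite mulrDr mulrCA.
Qed.

End ParallelAlgebra.

(** * The weighted spinor bundle *)

Section WeightedMaps.
Variables (R : realType) (V : vectType R) (r : nat) (chi : R -> R).
Variables (K : comNzRingType) (j : {rmorphism R -> K}) (W : lmodType K).
Implicit Types (phi : {linear W -> W}) (w : weighted V r chi j W).

Lemma wmap_linear phi a w w' :
  wmap phi (a *: w + w') = a *: wmap phi w + wmap phi w'.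
Proof. by apply/val_inj/funext => b; exact: linearP. Qed.

Lemma wmap_comb a phi phi1 phi2 w : (forall s, phi s = a *: phi1 s + phi2 s) ->
  wmap phi w = a *: wmap phi1 w + wmap phi2 w.
Proof. by move=> phiE; apply/val_inj/funext => b; exact: phiE. Qed.

End WeightedMaps.

(** Applied to the Clifford action on real spinors, this gives complex linearity in the Clifford
    vector. *)
Lemma cplx_bilinear (R : rcfType) (V W : lmodType R) (T : V -> W -> W) :
  (forall k v v' w, T (k *: v + v') w = k *: T v w + T v' w) ->
  forall a (z z' : cplx V) (t : cplx W),
  let B (z : cplx V) (t : cplx W) : cplx W :=
    (T z.1 t.1 - T z.2 t.2, T z.1 t.2 + T z.2 t.1) in
  B (a *: z + z') t = a *: B z t + B z' t.
Proof.
move=> TP a z z' t B.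
have TD v v' w : T (v + v') w = T v w + T v' w.
  by have := TP 1 v v' w; rewrite !scale1r.
have T0 w : T 0 w = 0 by apply: (addrI (T 0 w)); rewrite -TD !addr0.
have TZ k v w : T (k *: v) w = k *: T v w.
  by have := TP k v 0 w; rewrite T0 !addr0.
have TN v w : T (- v) w = - T v w by rewrite -scaleN1r TZ scaleN1r.
case: z z' t a => [u v] [u' v'] [t1 t2] [a1 a2]; congr pair; rewrite /= !(TD, TN, TZ).
  rewrite !(scalerBr, scalerDr, opprD).
  by rewrite [LHS](AC (3*3) ((1*4)*(5*2)*(3*6))).
rewrite !(scalerBr, scalerDr, opprD).
by rewrite [LHS](AC (3*3) ((1*4)*(5*2)*(3*6))).
Qed.

Section WeightedSpinor.
Variables (R : realType) (n : nat) (M : manifold R n) (m N : nat).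
Variables (E : vbundle M m) (C : courant E) (S0 : vbundle M N).
Variable c : forall p, 'Hom(E p, 'End(S0 p)).
Hypothesis cP : is_spinor_module C c.

Lemma weighted_spinor_sheaf : section_sheaf (@csmooth R n M) (weighted_spinor S0).
Proof.
apply: weightb_sheaf.
- by move=> U U' f; exact: csmooth_sub.
- by move=> x; exact: cdom_open.
- apply: cplxb_sheaf; apply: weightb_sheaf.
  + by move=> U U' f; exact: rsmooth_sub.
  + by move=> x; exact: fdom_open.
  + exact: vbundle_sheaf.
Qed.

(** Smoothness is tested on the coordinate frames and then on the frames of [S0]; on such values the
    action is [c] itself, so [clifford_smooth] applies to each of the four real products. *)
Lemma clifford_weighted_smooth U z t : open U -> bsm (cplxb E) U z ->
  bsm (weighted_spinor S0) U t ->
  bsm (weighted_spinor S0) U (fun p => clifford_weighted c (z p) (t p)).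
Proof.
move=> oU [z1 z2] tU x.
have oV : open (U `&` fdom (tangent M) x) by apply: openI => //; exact: cdom_open.
have VU : U `&` fdom (tangent M) x `<=` U by move=> p [].
have hE := vbundle_sheaf E; have hS := vbundle_sheaf S0.
have [t1 t2] := tU x.
have P (v : sect E) (s : forall p, bfib (real_spinor S0) p) y :
    bsm E U v -> bsm (real_spinor S0) (U `&` fdom (tangent M) x) s ->
    bsm S0 (U `&` fdom (tangent M) x `&` fdom S0 y)
      (fun p => c p (v p) (s p (frame S0 y p))).
  move=> vU sV; apply: (clifford_smooth cP); last exact: sV.
    by apply: openI => //; exact: fdom_open.
  by apply: (bsm_sub hE) vU => p [[]].
have k1 W : rsmooth W (fun _ : M => -1 : R) by exact: rsmooth_cst.
have oVy y : open (U `&` fdom (tangent M) x `&` fdom S0 y).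
  by apply: openI => //; exact: fdom_open.
by split=> y; [apply: (section_sheafB hS) | apply: (bsmD hS)] => //; exact: P.
Qed.

Lemma clifford_weighted_linear_r p a (z : cplx (E p))
    (t t' : bfib (weighted_spinor S0) p) :
  clifford_weighted c z (a *: t + t') =
  a *: clifford_weighted c z t + clifford_weighted c z t'.
Proof. exact: wmap_linear. Qed.

Lemma clifford_weighted_linear_l p a (z z' : cplx (E p))
    (t : bfib (weighted_spinor S0) p) :
  clifford_weighted c (a *: z + z') t =
  a *: clifford_weighted c z t + clifford_weighted c z' t.
Proof.
apply: wmap_comb => s.
apply: (cplx_bilinear (T := fun v (w : bfib (real_spinor S0) p) =>
  wmap (c p v) w : bfib (real_spinor S0) p)) => k v v' w.
apply: wmap_comb => u.
have -> : c p (k *: v + v') = k *: c p v + c p v' by exact: linearP.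
by rewrite [LHS](add_lfunE (k *: c p v) (c p v')) [X in X + _](scale_lfunE k (c p v)).
Qed.

End WeightedSpinor.

Theorem theorem3p3 (R : realType) (n : nat) (M : manifold R n) (m N : nat)
  (EB EF : vbundle M m) (CB : courant EB) (CF : courant EF)
  (GB : forall p, 'End(EB p)) (GF : forall p, 'End(EF p))
  (iota : forall p, 'Hom(EB p, EF p))
  (DB : sect EB -> sect EB -> sect EB)
  (S0 : vbundle M N) (c : forall p, 'Hom(EF p, 'End(S0 p)))
  (D0 : sect EF -> sect S0 -> sect S0)
  (DSR : sect EF -> sect (real_spinor S0) -> sect (real_spinor S0))
  (J : forall p, bfib (spinor S0) p -> bfib (spinor S0) p)
  (DL : sect EF -> sect (half_density M) -> sect (half_density M))
  (DS : sect (cplxb EF) -> sect (weighted_spinor S0) ->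
        sect (weighted_spinor S0)) :
  transitive_courant CB ->
  is_gmetric CB GB ->
  is_courant_iso CB CF iota ->
  (forall p u, GF p (iota p u) = iota p (GB p u)) ->
  is_levi_civita CB GB DB ->
  ~~ odd m ->
  is_spinor_module CF c ->
  is_rconnection CF D0 ->
  clifford_compatible c (connFF iota DB) D0 ->
  is_real_spinor_conn CF D0 DSR ->
  is_spinor_involution c J ->
  is_half_density_conn CF (connFF iota DB) DL ->
  is_weighted_spinor_conn CF DSR DL DS ->
  forall U : set M, open U ->
  let cl := @clifford_weighted R n M m N EF S0 c in
  (forall X Y s,
     tensor_field U X -> parallel CB iota DB U Y ->
     bsm (weighted_spinor S0) U s ->
     forall p, U p ->
       Phi iota DB cl DS (tprod X Y) s p =
       Phi iota DB cl DS X (Phi iota DB cl DS Y s) p) /\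
  parallel_algebra CB iota DB U /\
  parallel_module CB iota DB cl DS U.
Proof.
move=> _ _ iotaP _ [DBP _ _ _] _ cP _ _ _ _ _ [DSP _] U oU cl.
(* The action was studied for any bundle whose smooth sections form a sheaf, with a smooth,
   fibrewise bilinear [cl]; these facts place the weighted spinor bundle in that setting. *)
have SSP := weighted_spinor_sheaf S0.
have cl_sm := clifford_weighted_smooth cP.
have cll := @clifford_weighted_linear_l _ _ _ _ _ EF S0 c.
have clr := @clifford_weighted_linear_r _ _ _ _ _ EF S0 c.
split; last split.
- move=> X Y s XU YU sU p Up.
  exact: (Phi_tprod iotaP DBP SSP DSP cl_sm cll clr oU XU YU sU Up).
- exact: parallel_tensors_algebra.
- exact: (Phi_module iotaP DBP SSP DSP cl_sm cll clr oU).
Qed.
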